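(* Let $\mathbb{R}' = \prod_{m \in \omega} \mathbb{Z}_{m+3}$ and $C_{EK} = \prod_{m \in \omega} \left(\mathbb{Z}_{m+3} \setminus \{m+2\}\right) \subset \mathbb{R}'$ (a Cantor set). It is consistent with ZFC that for every non-meagre set $X \subset \mathbb{R}'$ there exists $t \in \mathbb{R}'$ such that $C_{EK} \cap (X + t)$ is relatively non-meagre in $C_{EK}$.
   Context: $\omega = \{0,1,2,\dots\}$. $\mathbb{Z}_{m+3} = \{0,1,\dots,m+2\}$ with addition modulo $m+3$ and the discrete topology; $\mathbb{R}'$ carries the product topology and coordinatewise addition, so it is a compact abelian Polish group. $X+t=\{x+t:x\in X\}$. A Cantor set is a space homeomorphic to the classical middle-thirds Cantor set. ''It is consistent with ZFC that $\varphi$'' means: if ZFC is consistent, then so is ZFC together with $\varphi$. *)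

(* Defs.v *)
From mathcomp Require Import ssreflect ssrfun ssrbool eqtype ssrnat seq.

Set Implicit Arguments.
Unset Strict Implicit.
Unset Printing Implicit Defensive.

(* First-order logic with equality over the language {∈}.  Variables are de   *)
(* Bruijn indices; the language has no function symbols, so variables are the *)
(* only terms and substitution is renaming.                                   *)

Inductive form : Type :=
| Bot
| Eq of nat & nat
| Mem of nat & nat
| Imp of form & form
| All of form.

Definition up (r : nat -> nat) (i : nat) : nat :=
  if i is j.+1 then (r j).+1 else 0.

Fixpoint ren (r : nat -> nat) (A : form) : form :=
  match A with
  | Bot => Bot
  | Eq i j => Eq (r i) (r j)
  | Mem i j => Mem (r i) (r j)
  | Imp B C => Imp (ren r B) (ren r C)
  | All B => All (ren (up r) B)
  end.

Definition subst0 (x : nat) : form -> form :=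
  ren (fun i => if i is j.+1 then j else x).

(* All free variables of A are < fv_bound A. *)
Fixpoint fv_bound (A : form) : nat :=
  match A with
  | Bot => 0
  | Eq i j | Mem i j => maxn i.+1 j.+1
  | Imp B C => maxn (fv_bound B) (fv_bound C)
  | All B => (fv_bound B).-1
  end.

Definition universal_closure (A : form) : form := iter (fv_bound A) All A.

Definition theory := form -> Prop.

Definition extend (T : theory) (A : form) : theory := fun B => T B \/ B = A.

Definition shift (T : theory) : theory := fun B => exists2 A, T A & B = ren S A.

(* Classical natural deduction. *)
Inductive provable : theory -> form -> Prop :=
| p_ax T A : T A -> provable T A
| p_impI T A B : provable (extend T A) B -> provable T (Imp A B)
| p_impE T A B : provable T (Imp A B) -> provable T A -> provable T B
| p_raa T A : provable (extend T (Imp A Bot)) Bot -> provable T A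
| p_allI T A : provable (shift T) A -> provable T (All A)
| p_allE T A x : provable T (All A) -> provable T (subst0 x A)
| p_eqI T x : provable T (Eq x x)
| p_eqE T A x y :
    provable T (Eq x y) -> provable T (subst0 x A) -> provable T (subst0 y A).

Definition consistent (T : theory) : Prop := ~ provable T Bot.

(* To write formulas with named binders, a formula is given as a function of  *)
(* the number n of quantifiers in whose scope it stands.  A bound variable is *)
(* denoted by its level (the number of quantifiers enclosing its own one),    *)
(* which, unlike its index, does not change under further quantifiers; level  *)
(* x is index n - x.+1 at depth n.  A sentence F stands for the form F 0.     *)

Definition fm := nat -> form.
Definition var := nat.

Declare Scope fm_scope.
Delimit Scope fm_scope with fm.
Bind Scope fm_scope with fm.

Definition fbot : fm := fun=> Bot.
Definition feq (x y : var) : fm := fun n => Eq (n - x.+1) (n - y.+1).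
Definition fmem (x y : var) : fm := fun n => Mem (n - x.+1) (n - y.+1).
Definition fimp (A B : fm) : fm := fun n => Imp (A n) (B n).
Definition fall (F : var -> fm) : fm := fun n => All (F n n.+1).
Definition fnot (A : fm) : fm := fimp A fbot.
Definition fconj (A B : fm) : fm := fnot (fimp A (fnot B)).
Definition fdisj (A B : fm) : fm := fimp (fnot A) B.
Definition fiff (A B : fm) : fm := fconj (fimp A B) (fimp B A).
Definition fex (F : var -> fm) : fm := fnot (fall (fun x => fnot (F x))).

Notation "x ≐ y" := (feq x y) (at level 70, no associativity) : fm_scope.
Notation "x ∈ y" := (fmem x y) (at level 70, no associativity) : fm_scope.
Notation "¬ A" := (fnot A) (at level 75, right associativity) : fm_scope.
Notation "A ∧ B" := (fconj A B) (at level 80, right associativity) : fm_scope.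
Notation "A ∨ B" := (fdisj A B) (at level 85, right associativity) : fm_scope.
Notation "A ↔ B" := (fiff A B) (at level 95, no associativity) : fm_scope.
Notation "A → B" := (fimp A B)
  (at level 99, B at level 200, right associativity) : fm_scope.
Notation "∀ x .. y , P" := (fall (fun x => .. (fall (fun y => P%fm)) ..))
  (at level 200, x binder, y binder, right associativity) : fm_scope.
Notation "∃ x .. y , P" := (fex (fun x => .. (fex (fun y => P%fm)) ..))
  (at level 200, x binder, y binder, right associativity) : fm_scope.
Notation "∀[ x ∈ a ] P" := (fall (fun x => fimp (fmem x a) P%fm))
  (at level 200, x name, a at level 69, right associativity) : fm_scope.
Notation "∃[ x ∈ a ] P" := (fex (fun x => fconj (fmem x a) P%fm))
  (at level 200, x name, a at level 69, right associativity) : fm_scope.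

Open Scope fm_scope.

(* The formula A with its variables 0, .., size xs - 1 replaced by xs; its    *)
(* remaining variables are parameters, free in the whole sentence.            *)
Definition inst (A : form) (xs : seq var) : fm := fun n =>
  ren (fun i => if i < size xs then n - (nth 0 xs i).+1 else i - size xs + n) A.

Definition is_empty (e : var) : fm := ∀ u, ¬ u ∈ e.
Definition subset (a b : var) : fm := ∀[ u ∈ a ] u ∈ b.
Definition disjoint (a b : var) : fm := ¬ ∃[ u ∈ a ] u ∈ b.
Definition is_upair (p x y : var) : fm := ∀ u, u ∈ p ↔ u ≐ x ∨ u ≐ y.
Definition is_inter (c a b : var) : fm := ∀ u, u ∈ c ↔ u ∈ a ∧ u ∈ b.
Definition is_succ (y x : var) : fm := ∀ u, u ∈ y ↔ u ∈ x ∨ u ≐ x.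
Definition inductive_set (a : var) : fm :=
  (∃[ e ∈ a ] is_empty e) ∧ ∀[ x ∈ a ] ∃[ y ∈ a ] is_succ y x.

Definition ax_ext : fm := ∀ a b, (∀ u, u ∈ a ↔ u ∈ b) → a ≐ b.
Definition ax_found : fm := ∀ a, ¬ is_empty a → ∃[ x ∈ a ] disjoint x a.
Definition ax_pair : fm := ∀ x y, ∃ p, is_upair p x y.
Definition ax_union : fm := ∀ a, ∃ b, ∀ u, u ∈ b ↔ ∃[ x ∈ a ] u ∈ x.
Definition ax_power : fm := ∀ a, ∃ b, ∀ u, u ∈ b ↔ subset u a.
Definition ax_inf : fm := ∃ a, inductive_set a.
Definition ax_choice : fm :=
  ∀ a, (∀[ x ∈ a ] ¬ is_empty x) →
       (∀[ x ∈ a ] ∀[ y ∈ a ] (¬ x ≐ y → disjoint x y)) →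
       ∃ c, ∀[ x ∈ a ] ∃ u, ∀ v, v ∈ c ∧ v ∈ x ↔ v ≐ u.
Definition ax_sep (A : form) : fm :=
  ∀ a, ∃ b, ∀ x, x ∈ b ↔ x ∈ a ∧ inst A [:: x].
Definition ax_repl (A : form) : fm :=
  ∀ a, (∀[ x ∈ a ] ∀ y z, inst A [:: x; y] → inst A [:: x; z] → y ≐ z) →
       ∃ b, ∀ y, y ∈ b ↔ ∃[ x ∈ a ] inst A [:: x; y].

Inductive ZFC : theory :=
| zfc_ext : ZFC (ax_ext 0)
| zfc_found : ZFC (ax_found 0)
| zfc_pair : ZFC (ax_pair 0)
| zfc_union : ZFC (ax_union 0)
| zfc_power : ZFC (ax_power 0)
| zfc_inf : ZFC (ax_inf 0)
| zfc_choice : ZFC (ax_choice 0)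
| zfc_sep A : ZFC (universal_closure (ax_sep A 0))
| zfc_repl A : ZFC (universal_closure (ax_repl A 0)).

(* Natural numbers are von Neumann ordinals, ordered pairs are Kuratowski's,  *)
(* and functions are sets of ordered pairs.                                   *)

Definition is_omega (w : var) : fm :=
  inductive_set w ∧ ∀ a, inductive_set a → subset w a.

Definition is_pair (p x y : var) : fm :=
  ∀ z, z ∈ p ↔ is_upair z x x ∨ is_upair z x y.

(* f(x) = y *)
Definition maps (f x y : var) : fm := ∃[ p ∈ f ] is_pair p x y.

Definition is_fun (f d : var) : fm :=
  (∀[ p ∈ f ] ∃[ x ∈ d ] ∃ y, is_pair p x y) ∧
  ∀[ x ∈ d ] ∃ y, ∀ z, maps f x z ↔ z ≐ y.

Definition is_finite (w a : var) : fm :=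
  ∃[ n ∈ w ] ∃ g, is_fun g n ∧ ∀ x, x ∈ a ↔ ∃[ i ∈ n ] maps g i x.

(* s = x + y in ω, by recursion on y *)
Definition nat_sum (w s x y : var) : fm :=
  ∃ g, is_fun g w ∧ (∀ e, is_empty e → maps g e x) ∧
       (∀[ i ∈ w ] ∀ j a b, is_succ j i → maps g i a → is_succ b a →
          maps g j b) ∧
       maps g y s.

(* z = x + y in Z_n = {0, .., n - 1}, for x and y in Z_n: then x + y < 2n, so *)
(* x + y is either z or z + n.                                                *)
Definition mod_sum (w n z x y : var) : fm :=
  z ∈ n ∧ ∃ s, nat_sum w s x y ∧ (s ≐ z ∨ nat_sum w s z n).

(* k = m + 2 *)
Definition plus2 (k m : var) : fm := ∃ l, is_succ l m ∧ is_succ k l.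
(* n = m + 3 *)
Definition plus3 (n m : var) : fm := ∃ k, plus2 k m ∧ is_succ n k.

(* R = ∏_m Z_(m+3) *)
Definition is_R' (w R : var) : fm :=
  ∀ f, f ∈ R ↔ is_fun f w ∧
    ∀[ m ∈ w ] ∀ n y, plus3 n m → maps f m y → y ∈ n.

(* C = ∏_m (Z_(m+3) \ {m+2}) *)
Definition is_CEK (w C : var) : fm :=
  ∀ f, f ∈ C ↔ is_fun f w ∧
    ∀[ m ∈ w ] ∀ n k y, plus3 n m → plus2 k m → maps f m y → y ∈ n ∧ ¬ y ≐ k.

(* z = x + y in R' *)
Definition R'_sum (w R z x y : var) : fm :=
  z ∈ R ∧
  ∀[ m ∈ w ] ∀ n a b c, plus3 n m → maps x m a → maps y m b → maps z m c →
    mod_sum w n c a b.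

(* Y = X + t *)
Definition is_translate (w R Y X t : var) : fm :=
  ∀ z, z ∈ Y ↔ ∃[ x ∈ X ] R'_sum w R z x t.

(* T is the product topology of R ⊆ ∏_m Z_(m+3), the factors being discrete:  *)
(* a basic open set prescribes finitely many coordinates.                     *)
Definition is_product_topology (w R T : var) : fm :=
  ∀ U, U ∈ T ↔ subset U R ∧
    ∀[ x ∈ U ] ∃ F, subset F w ∧ is_finite w F ∧
      ∀[ y ∈ R ] ((∀[ m ∈ F ] ∀ k, maps x m k → maps y m k) → y ∈ U).

Definition is_subspace_topology (S T C : var) : fm :=
  ∀ V, V ∈ S ↔ ∃[ U ∈ T ] is_inter V U C.

(* In what follows, T is a topology on the set Y. *)

Definition is_closure (Y T B A : var) : fm :=
  ∀ x, x ∈ B ↔ x ∈ Y ∧ ∀[ U ∈ T ] (x ∈ U → ¬ disjoint U A).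

Definition nowhere_dense (Y T A : var) : fm :=
  subset A Y ∧
  ∃ B, is_closure Y T B A ∧ ∀[ U ∈ T ] (subset U B → is_empty U).

Definition meagre (w Y T A : var) : fm :=
  ∃ N, is_fun N w ∧
       (∀[ i ∈ w ] ∀ B, maps N i B → nowhere_dense Y T B) ∧
       ∀ x, x ∈ A ↔ ∃[ i ∈ w ] ∃ B, maps N i B ∧ x ∈ B.

Definition phi : fm :=
  ∃ w R C T S,
    is_omega w ∧ is_R' w R ∧ is_CEK w C ∧
    is_product_topology w R T ∧ is_subspace_topology S T C ∧
    ∀ X, subset X R → ¬ meagre w R T X →
      ∃[ t ∈ R ] ∃ Y D, is_translate w R Y X t ∧ is_inter D C Y ∧
        ¬ meagre w C S D.

(* Main.v *)
From mathcomp Require Import ssreflect ssrfun ssrbool eqtype ssrnat seq choice.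
From mathcomp Require Import boolp wochoice zify.
Require Import Defs.

Set Implicit Arguments.
Unset Strict Implicit.
Unset Printing Implicit Defensive.

(** Over any preorder of conditions, reading formulas as regular open sets of
    conditions makes all theorems of ZFC forced everywhere, so it suffices to find a
    preorder forcing [phi].  We iterate, with countable support along a well-order
    [K], forcing with infinitely splitting trees of finite sequences in which a node
    of level [d] has, for any [d + 1] given reals, arbitrarily long successors that
    differ from the forbidden values [m + 2 - g(m)] for each of these reals [g].

    Suppose some condition forces a non-meagre [X] to have meagre trace on [C_EK]
    after every translation.  Passing to a stronger condition and a basic open set
    [s0], [X] is non-meagre everywhere in [s0].  As [K] is closed under countable
    operations, there is a coordinate [al] such that this is already witnessed by
    reals read continuously from the coordinates below [al].  Let [t] be the generic
    real at [al].  The trace of [X + t] on [C_EK] lies in a union of nowhere dense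
    sets; over a countable set of names one finds a real [f] in [X], read from the
    coordinates below [al], that belongs to countably many dense open sets, and
    these can be chosen so that a tree of possible values of [t] with
    [f(m) + t(m) <> m + 2] for all [m] still consists of generic branches.  Then
    [f + t] lies in [C_EK] but outside that union, a contradiction. *)

(** * Labelled trees *)

(** The trees can have so much room because place m carries m+3 values: a node of level d has a
    label of length at least d, so at each later place m the value 0 can be reserved for telling
    siblings apart, and m+2 > d+1 values remain for dodging d+1 functions. The pruned tree spends
    the room for one more function on f itself and regains it one level deeper.

    The obstacle is the order of choices. The tree at [al] is pruned according to f, so f must not
    depend on coordinate [al]; yet the dense sets that f has to enter speak of t and of coordinates
    above [al]. They are therefore turned into tasks about coordinates below [al]: each asks a real
    to leave a suitable next node for the pruned tree. The tasks are dense, so non-meagreness of X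
    yields a real that meets them all, and the closure of [al] lets it be read below [al].

    Iterands have no names. A condition is the set of its branches, with trees that depend
    continuously on earlier coordinates, and instead of a generic filter there is a condition all of
    whose branches are generic over a countable set of names. *)

Definition pref (s : seq nat) (z : nat -> nat) := forall m, m < size s -> nth 0 s m = z m.
Definition spref (s t : seq nat) := size s <= size t /\ pref s (nth 0 t).
Definition stem (s : seq nat) := forall m, m < size s -> nth 0 s m < m.+3.
(** For values at most m+2 the sum is at most 2m+4, which is less than (m+2)+(m+3); it is congruent
    to m+2 modulo m+3 only if it equals m+2. So the plain sum decides whether the sum in R' takes
    the value that [C_EK] excludes. *)
Definition avo (s : seq nat) (g : nat -> nat) (i j : nat) :=
  forall m, i <= m < j -> nth 0 s m + g m <> m.+2.

Lemma pref_spref s t z : spref s t -> pref t z -> pref s z.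
Proof. by move=> [st H] tz m ms; rewrite H // tz // (leq_trans ms). Qed.

Lemma spref_trans s t u : spref s t -> spref t u -> spref s u.
Proof. by move=> st [tu H]; split; [apply: leq_trans tu; case: st | apply: pref_spref H]. Qed.

Lemma pref_le s t z : size s <= size t -> pref s z -> pref t z -> spref s t.
Proof. by move=> st sz tz; split=> // m ms; rewrite sz // tz // (leq_trans ms). Qed.

Lemma spref_cat s t : spref s (s ++ t).
Proof. by split=> [|m ms]; [rewrite size_cat leq_addr | rewrite nth_cat ms]. Qed.

Lemma spref_size_eq s t : spref s t -> size t <= size s -> s = t.
Proof.
move=> [st H] ts; apply: (@eq_from_nth _ 0).
  by apply/eqP; rewrite eqn_leq st.
exact: H.
Qed.

Section Trees.

Implicit Types (L : seq nat -> seq nat) (a b : seq nat).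

(* In the last clause a node at depth [d] can, beyond its own label, keep away
   from any [d + 1] given functions for as long as desired. *)
Record OK L : Prop := {
  OK_pref : forall a i, spref (L a) (L (rcons a i));
  OK_inc : forall a i j, i <> j -> exists m, [/\ m < size (L (rcons a i)),
    m < size (L (rcons a j)) & nth 0 (L (rcons a i)) m <> nth 0 (L (rcons a j)) m];
  OK_stem : forall a, stem (L a);
  OK_avo : forall a (F : seq (seq nat)) n, size F <= (size a).+1 ->
    exists i, n <= size (L (rcons a i)) /\
      forall g, g \in F -> avo (L (rcons a i)) (nth 0 g) (size (L a)) n }.

Definition Br L (z : nat -> nat) := exists c, forall n, pref (L (mkseq c n)) z.
Definition shift_tree a L := fun b => L (a ++ b).

Lemma OK_cat L a b : OK L -> spref (L a) (L (a ++ b)).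
Proof.
move=> ok; elim/last_ind: b => [|b i IH]; first by rewrite cats0.
by rewrite -rcons_cat; apply: spref_trans IH _; apply: OK_pref.
Qed.

Lemma OK_shift L a : OK L -> OK (shift_tree a L).
Proof.
move=> ok; split=> [b i|b i j ij|b|b F n sF]; rewrite /shift_tree -?rcons_cat.
- exact: OK_pref.
- exact: OK_inc.
- exact: OK_stem.
- have sF' : size F <= (size (a ++ b)).+1.
    by apply: leq_trans sF _; rewrite size_cat ltnS leq_addl.
  by have [i [ni H]] := OK_avo ok n sF'; exists i; rewrite -?rcons_cat.
Qed.

Lemma OK_ltn L a i : OK L -> size (L a) < size (L (rcons a i)).
Proof.
move=> ok; rewrite ltnNge; apply/negP => le.
have [m [mi mj]] := OK_inc ok a (i := i) (j := i.+1) ltac:(by elim: i {le}).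
have E := spref_size_eq (OK_pref ok a i) le.
have [_ /(_ m)] := OK_pref ok a i.+1.
by rewrite -E in mi *; move=> /(_ mi) ->.
Qed.

Lemma OK_size L a : OK L -> size a <= size (L a).
Proof.
move=> ok; elim/last_ind: a => [|a i IH] //; rewrite size_rcons.
exact: leq_ltn_trans IH (OK_ltn _ _ ok).
Qed.

(** Siblings carry incompatible labels, so a real passes at most one node of each level, and every
    node that it passes lies on its branch. *)
Lemma Br_node L c z a : OK L -> (forall n, pref (L (mkseq c n)) z) ->
  pref (L a) z -> a = mkseq c (size a).
Proof.
move=> ok cz; elim/last_ind: a => [|a i IH] //= az.
rewrite size_rcons mkseqS; have E := IH (pref_spref (OK_pref ok a i) az).
rewrite -E; congr rcons; apply: contrapT => ne.
have [m [mi mj]] := OK_inc ok a ne; apply.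
by rewrite az // -(cz (size a).+1) // mkseqS -E.
Qed.

Lemma node_unique L a b z : OK L -> pref (L a) z -> pref (L b) z ->
  size a = size b -> a = b.
Proof.
move=> ok; elim/last_ind: a b => [|a i IH] b az bz; first by case: b bz.
case/lastP: b bz => [_|b j bz]; first by rewrite size_rcons.
rewrite !size_rcons => -[sab].
have E := IH b (pref_spref (OK_pref ok a i) az) (pref_spref (OK_pref ok b j) bz) sab.
subst b; congr rcons; apply: contrapT => ne.
have [m [mi mj]] := OK_inc ok a ne; apply.
by rewrite az // bz.
Qed.

Lemma mkseq_prefix (c : nat -> nat) m n : m <= n ->
  mkseq c n = mkseq c m ++ mkseq (fun k => c (m + k)) (n - m).
Proof.
move=> mn; rewrite /mkseq -[in LHS](subnKC mn) iotaD map_cat add0n; congr (_ ++ _).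
by rewrite -[m in iota m _]addn0 iotaDl -map_comp.
Qed.

Lemma Br_shift L a z : OK L -> Br (shift_tree a L) z <-> Br L z /\ pref (L a) z.
Proof.
move=> ok; split=> [[c H]|[[c H] az]].
  have az : pref (L a) z by have := H 0; rewrite /shift_tree cats0.
  split=> //; exists (fun k => if k < size a then nth 0 a k else c (k - size a)) => n.
  set d := fun k => _.
  have E : mkseq d (size a + n) = a ++ mkseq c n.
    rewrite (mkseq_prefix _ (leq_addr n (size a))) addKn; congr (_ ++ _).
      apply: (@eq_from_nth _ 0); rewrite size_mkseq // => i ia.
      by rewrite nth_mkseq // /d ia.
    by apply: eq_mkseq => k; rewrite /d ltnNge leq_addr addKn.
  apply: pref_spref (_ : pref (L (mkseq d (size a + n))) z); last by rewrite E; apply: H.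
  by rewrite (mkseq_prefix d (leq_addl (size a) n)); apply: OK_cat.
have E := Br_node ok H az.
exists (fun k => c (size a + k)) => n; rewrite /shift_tree [a]E.
have := H (size a + n); rewrite (mkseq_prefix c (leq_addr n (size a))) addKn.
by rewrite -E.
Qed.

(** The nodes met at the various levels are not given as one path; uniqueness of the node at each
    level makes their truncations cohere. *)
Lemma Br_of L z : OK L -> (forall m, exists a, m <= size a /\ pref (L a) z) -> Br L z.
Proof.
move=> ok /choice [f H]; exists (fun k => nth 0 (f k.+1) k) => n.
have T k a : k <= size a -> pref (L a) z -> pref (L (take k a)) z.
  by move=> ka az; apply: pref_spref az; rewrite -{2}(cat_take_drop k a); apply: OK_cat.
suff -> : mkseq (fun k => nth 0 (f k.+1) k) n = take n (f n).
  by have [nf fz] := H n; apply: T.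
have [nf fz] := H n.
apply: (@eq_from_nth _ 0); rewrite size_mkseq ?size_takel // => k kn.
have [kf fkz] := H k.+1.
rewrite nth_mkseq // nth_take // -(nth_take (n0 := k.+1)) // -[RHS](nth_take (n0 := k.+1)) //.
congr nth; apply: (node_unique ok (z := z)).
- exact: T.
- by apply: T => //; apply: leq_trans nf.
- by rewrite !size_takel // (leq_trans kn).
Qed.

Definition lbranch L (m : nat) := nth 0 (L (nseq m.+1 0)) m.

Lemma lbranch_Br L : OK L -> Br L (lbranch L).
Proof.
move=> ok; exists (fun=> 0) => n.
have Z k : mkseq (fun=> 0) k = nseq k 0.
  apply: (@eq_from_nth _ 0); rewrite size_mkseq ?size_nseq // => i ik.
  by rewrite nth_mkseq // nth_nseq ik.
rewrite Z => m ms; rewrite /lbranch.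
have H i j : i <= j -> spref (L (nseq i 0)) (L (nseq j 0)).
  by move=> ij; rewrite -(subnKC ij) nseqD; apply: OK_cat.
have [nm|mn] := leqP n m.+1; first by have [_ ->] := H _ _ nm.
have [_ ->] // := H _ _ (ltnW mn).
by have := OK_size (nseq m.+1 0) ok; rewrite size_nseq.
Qed.

Lemma Br_stem L z m : OK L -> Br L z -> z m < m.+3.
Proof.
move=> ok [c H]; have sm : m < size (L (mkseq c m.+1)).
  by have := OK_size (mkseq c m.+1) ok; rewrite size_mkseq.
by rewrite -(H m.+1) //; apply: OK_stem.
Qed.

End Trees.

Lemma well_order_exists (T : Type) : exists lt : T -> T -> Prop,
  [/\ well_founded lt, (forall x y z, lt x y -> lt y z -> lt x z)
    & forall x y, lt x y \/ x = y \/ lt y x].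
Proof.
pose T' : eqType := {classic T}; have [R woR] := well_ordering_principle T'.
have ex (B : T -> Prop) : (exists x, B x) ->
    exists z, B z /\ forall x, B x -> R z x.
  case=> x Bx; pose A : {pred T'} := fun x => `[< B x >].
  have [|z [[Az lz] _]] := woR A; first by exists x; apply/asboolP.
  exists z; split; first exact/asboolP.
  by move=> y By; apply: lz; apply/asboolP.
have refl x : R x x.
  by have [|z [-> H]] := ex (eq^~ x); [exists x | apply: H].
have anti x y : R x y -> R y x -> x = y.
  move=> xy yx; pose A : {pred T'} := fun z => `[< z = x \/ z = y >].
  have [|z [_ U]] := woR A; first by exists x; apply/asboolP; left.
  have /U <- : minimum_of R A x.
    by split; [apply/asboolP; left | move=> w /asboolP [->|->]].
  by apply: U; split; [apply/asboolP; right | move=> w /asboolP [->|->]].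
have total x y : R x y \/ R y x.
  have [|z [Bz lz]] := ex (fun z => z = x \/ z = y); first by exists x; left.
  by case: Bz lz => -> lz; [left; apply: lz; right | right; apply: lz; left].
have trans x y z : R x y -> R y z -> R x z.
  move=> xy yz.
  have [|w [Bw lw]] := ex (fun w => [\/ w = x, w = y | w = z]).
    by exists x; constructor 1.
  case: Bw lw => -> lw.
  - by apply: lw; constructor 3.
  - have yx : R y x by apply: lw; constructor 1.
    by rewrite (anti _ _ xy yx).
  - have zy : R z y by apply: lw; constructor 2.
    by rewrite -(anti _ _ yz zy).
exists (fun x y => R x y /\ x <> y); split.
- move=> x; apply: contrapT => nx.
  have [|z [nz lz]] := ex (fun z => ~ Acc (fun x y => R x y /\ x <> y) z).
    by exists x.
  apply: nz; constructor=> y [yz nyz]; apply: contrapT => ny.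
  by apply: nyz; apply: anti yz (lz y ny).
- move=> x y z [xy nxy] [yz nyz]; split; first exact: trans yz.
  by move=> e; apply: nxy; apply: anti xy _; rewrite e.
- move=> x y; have [<-|nxy] := lem (x = y); first by right; left.
  by case: (total x y) => H; [left | right; right]; split=> // /esym.
Qed.

(** * Forcing semantics over an arbitrary preorder *)

Section Names.

Variables (P : Type) (le : P -> P -> Prop).

Definition Om := P -> Prop.
Definition dn (A : Om) : Om := fun p => exists r, le p r /\ A r.
Definition dense (A : Om) : Om := fun p => forall q, le q p -> exists r, le r q /\ A r.
Definition mono (A : Om) := forall p q, le q p -> A p -> A q.

Class Reg (A : Om) : Prop :=
  { reg_mono : mono A; reg_dense : forall p, dense A p -> A p }.

(* As [I] ranges over all types, the names form a proper class. *)
Inductive name := Nm (I : Type) (el : I -> name) (d : I -> Om).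

Definition idx (x : name) : Type := match x with Nm J _ _ => J end.
Definition el (x : name) : idx x -> name := match x with Nm _ f _ => f end.
Definition dm (x : name) : idx x -> Om := match x with Nm _ _ d => fun i => dn (d i) end.
Arguments el : clear implicits.
Arguments dm : clear implicits.

(** In both clauses a member of [x] stands on the left of the recursive call, which keeps the
    recursion structural in [x]; symmetry is then a lemma. *)
Fixpoint eqn (x y : name) (p : P) : Prop :=
  match x, y with
  | Nm _ f d, Nm _ g e =>
    (forall i q, le q p -> dn (d i) q ->
       dense (fun r => exists j, dn (e j) r /\ eqn (f i) (g j) r) q) /\
    (forall j q, le q p -> dn (e j) q ->
       dense (fun r => exists i, dn (d i) r /\ eqn (f i) (g j) r) q)
  end.

Definition memn (x y : name) : Om :=
  dense (fun r => exists j, dm y j r /\ eqn x (el y j) r).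

Definition simp (A B : Om) : Om := fun p => forall q, le q p -> A q -> B q.
Definition sbot : Om := fun=> False.
Definition sall X (F : X -> Om) : Om := fun p => forall x, F x p.
(** The derived operations copy the encodings of [fnot], [fconj], [fdisj], [fiff] and [fex], so that
    a forced formula unfolds to them by conversion. Their direct readings, with [dense] for
    disjunction and existence, are [sandP], [siffP], [sorP] and [sexP]. *)
Definition snot A := simp A sbot.
Definition sand A B := snot (simp A (snot B)).
Definition sor A B := simp (snot A) B.
Definition siff A B := sand (simp A B) (simp B A).
Definition sex X (F : X -> Om) := snot (sall (fun x => snot (F x))).

Definition scons (a : name) (rho : nat -> name) (i : nat) :=
  if i is j.+1 then rho j else a.

Fixpoint force (rho : nat -> name) (A : form) : Om :=
  match A with
  | Bot => sbot
  | Eq i j => eqn (rho i) (rho j)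
  | Mem i j => memn (rho i) (rho j)
  | Imp B C => simp (force rho B) (force rho C)
  | All B => sall (fun a => force (scons a rho) B)
  end.

End Names.

Arguments Nm {P} I el d.
Arguments idx {P} x.
Arguments el {P} x _.
Arguments dm {P} le x _.

Class PreOrd P (le : P -> P -> Prop) : Prop :=
  { le_refl : forall p, le p p;
    le_trans : forall p q r, le p q -> le q r -> le p r }.

(** Distinct names can be forced equal, so a predicate of names describes a class of the extension
    only if it respects [eqn]. Separation over a name relies on this. *)
Class Cong P (le : P -> P -> Prop) (A : name P -> Om P) : Prop :=
  cong : forall x y p, eqn le x y p -> A x p -> A y p.

Section Forcing.

Context {P : Type} {le : P -> P -> Prop} {PO : PreOrd le}.

Local Notation dn := (dn le).
Local Notation dense := (dense le).
Local Notation mono := (mono le).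
Local Notation Reg := (Reg le).
Local Notation dm := (dm le).
Local Notation eqn := (eqn le).
Local Notation memn := (memn le).
Local Notation simp := (simp le).
Local Notation snot := (snot le).
Local Notation sand := (sand le).
Local Notation sor := (sor le).
Local Notation siff := (siff le).
Local Notation sex := (sex le).
Local Notation force := (force le).
Local Notation sbot := (@sbot P).
Local Notation name := (name P).
Local Notation Om := (Om P).
Local Notation Cong := (Cong le).
Local Notation reg_mono := (@reg_mono P le _ _).
Local Notation reg_dense := (@reg_dense P le _ _).
Local Notation cong := (@cong P le _ _).
Local Hint Extern 0 (le _ _) => exact: le_refl : core.
Implicit Types (p q r : P) (x y z : name).

Lemma dn_mono A : mono (dn A).
Proof. by move=> p q qp [r [pr Ar]]; exists r; split=> //; apply: le_trans pr. Qed.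

Lemma dnI A p : A p -> dn A p.
Proof. by exists p. Qed.

Lemma dense_mono A : mono (dense A).
Proof. by move=> p q qp dA r rq; apply: dA; apply: le_trans qp. Qed.

Global Instance Reg_dense A : Reg (dense A).
Proof.
split; first exact: dense_mono.
move=> p dA q qp; have [r [rq dr]] := dA _ qp.
have [s [sr As]] := dr _ (le_refl r).
by exists s; split=> //; apply: le_trans rq.
Qed.

Lemma denseI A p : mono A -> A p -> dense A p.
Proof. by move=> mA Ap q qp; exists q; split=> //; apply: mA Ap. Qed.

Lemma dense_imp A B p :
  (forall q, le q p -> A q -> B q) -> dense A p -> dense B p.
Proof.
move=> AB dA q qp; have [r [rq Ar]] := dA _ qp.
by exists r; split=> //; apply: AB => //; apply: le_trans qp.
Qed.

Lemma denseE A B p : Reg B ->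
  dense A p -> (forall q, le q p -> A q -> B q) -> B p.
Proof. by move=> rB dA AB; apply: reg_dense; apply: dense_imp dA. Qed.

Lemma dense_bind A B p :
  dense A p -> (forall q, le q p -> A q -> dense B q) -> dense B p.
Proof. exact: denseE. Qed.

Global Instance Reg_bot : Reg sbot.
Proof. by split=> // p /(_ _ (le_refl p)) [r []]. Qed.

Global Instance Reg_simp A B : Reg A -> Reg B -> Reg (simp A B).
Proof.
move=> rA rB; split=> [p q qp AB r rq|p d q qp Aq].
  by apply: AB; apply: le_trans qp.
apply: (denseE (A := simp A B) rB) => [|r rq AB]; first exact: dense_mono d.
by apply: AB => //; apply: reg_mono Aq.
Qed.

Global Instance Reg_all X (F : X -> Om) : (forall t, Reg (F t)) -> Reg (sall F).
Proof.
move=> rF; split=> [p q qp H t|p d t]; first by apply: reg_mono (H t).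
by apply: denseE d _ => q qp; apply.
Qed.

Global Instance Reg_not A : Reg A -> Reg (snot A).
Proof. by move=> rA; apply: Reg_simp. Qed.
Global Instance Reg_and A B : Reg A -> Reg B -> Reg (sand A B).
Proof. by move=> rA rB; do !apply: Reg_simp. Qed.
Global Instance Reg_or A B : Reg A -> Reg B -> Reg (sor A B).
Proof. by move=> rA rB; do !apply: Reg_simp. Qed.
Global Instance Reg_iff A B : Reg A -> Reg B -> Reg (siff A B).
Proof. by move=> rA rB; apply: Reg_and; apply: Reg_simp. Qed.
Global Instance Reg_ex X (F : X -> Om) : (forall t, Reg (F t)) -> Reg (sex F).
Proof. by move=> rF; apply: Reg_not; apply: Reg_all=> x; apply: Reg_not. Qed.

Lemma snotnot A p : Reg A -> snot (snot A) p -> A p.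
Proof.
move=> rA nn; apply: reg_dense => q qp.
apply: contrapT => nex; apply: (nn q qp) => r rq Ar.
by apply: nex; exists r.
Qed.

Lemma not_snot A p : ~ snot A p -> exists q, le q p /\ A q.
Proof.
move=> nA; apply: contrapT => nex; apply: nA => q qp Aq.
by apply: nex; exists q.
Qed.

Lemma sandP A B p : Reg A -> Reg B -> sand A B p <-> A p /\ B p.
Proof.
move=> rA rB; split=> [H|[Ap Bp] q qp].
  split; apply: snotnot => q qp.
    by move=> nA; apply: (H _ qp) => r rq Ar s sr; case: (nA _ rq Ar).
  by move=> nB; apply: (H _ qp) => r rq Ar s sr Bs; apply: (nB s) => //;
    apply: le_trans rq.
by move=> /(_ _ (le_refl q) (reg_mono qp Ap) _ (le_refl q)); apply; apply: reg_mono Bp.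
Qed.

Lemma siffP A B p : Reg A -> Reg B ->
  siff A B p <-> (forall q, le q p -> (A q <-> B q)).
Proof.
move=> rA rB; split=> [/sandP [AB BA] q qp|H].
  by split; [apply: AB | apply: BA].
by apply/sandP; split=> q qp; apply H.
Qed.

Lemma sorP A B p : Reg A -> Reg B ->
  sor A B p <-> dense (fun r => A r \/ B r) p.
Proof.
move=> rA rB; split=> [H q qp|H q qp nA].
  have [/not_snot [r [rq Ar]]|nA] := lem (~ snot A q).
    by exists r; split=> //; left.
  by exists q; split=> //; right; apply: H => //; apply: contrapT.
apply: denseE (dense_mono qp H) _ => r rq [Ar|//].
by case: (nA r rq Ar).
Qed.

Lemma sexP X (F : X -> Om) p : (forall t, Reg (F t)) ->
  sex F p <-> dense (fun r => exists t, F t r) p.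
Proof.
move=> rF; split=> [H q qp|H q qp nF].
  apply: contrapT => nex; apply: (H q qp) => x r rq Fx; apply: nex.
  by exists r; split=> //; exists x.
have [r [rq [x Fx]]] := H q qp.
exact: (nF x r rq Fx).
Qed.

Lemma sexI X (F : X -> Om) p (t : X) : (forall t, Reg (F t)) -> F t p -> sex F p.
Proof.
move=> rF Ft; apply/sexP; move=> q qp; exists q; split=> //; exists t.
exact: reg_mono Ft.
Qed.

Lemma sexE X (F : X -> Om) (B : Om) p : (forall t, Reg (F t)) -> Reg B ->
  sex F p -> (forall q (t : X), le q p -> F t q -> B q) -> B p.
Proof.
move=> rF rB /sexP H FB; apply: denseE H _ => q qp [x Fx].
exact: FB Fx.
Qed.

Lemma dm_mono x i : mono (dm x i).
Proof. by case: x i => I f d i /=; apply: dn_mono. Qed.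

Lemma eqnE x y p : eqn x y p <->
  (forall i q, le q p -> dm x i q -> memn (el x i) y q) /\
  (forall j q, le q p -> dm y j q ->
     dense (fun r => exists i, dm x i r /\ eqn (el x i) (el y j) r) q).
Proof. by case: x y => I f d [J g e]. Qed.

Global Instance Reg_eq x y : Reg (eqn x y).
Proof.
split=> [p q qp /eqnE [H K]|p d]; apply/eqnE.
  split=> [i r rq|j r rq]; first by apply: H; apply: le_trans qp.
  by apply: K; apply: le_trans qp.
split=> i q qp di; apply: (dense_bind (dense_mono qp d)) => r rq /eqnE [H K].
- by apply: H => //; apply: dm_mono di.
- by apply: K => //; apply: dm_mono di.
Qed.

Global Instance Reg_mem x y : Reg (memn x y).
Proof. exact: Reg_dense. Qed.

Lemma memn_el x i p : eqn (el x i) (el x i) p -> dm x i p -> memn (el x i) x p.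
Proof.
move=> e di; apply: denseI; last by exists i.
move=> q r rq [j [dj ej]]; exists j; split; first exact: dm_mono dj.
exact: reg_mono ej.
Qed.

Lemma eqn_refl x p : eqn x x p.
Proof.
elim: x p => I f IH d p; apply/eqnE; split=> i q qp di; last first.
  by move=> r rq; exists r; split=> //; exists i; split=> //; apply: dm_mono di.
exact: (@memn_el (Nm I f d) i q (IH i q) di).
Qed.

Lemma memn_idx x i p : dm x i p -> memn (el x i) x p.
Proof. exact/memn_el/eqn_refl. Qed.

Lemma eqn_sym x y p : eqn x y p -> eqn y x p.
Proof.
elim: x y p => I f IH d [J g e] p /eqnE [H K]; apply/eqnE.
split=> i q qp di.
  by apply: dense_imp (K i q qp di) => r rq [j [dj ej]]; exists j; split=> //; apply: IH.
by apply: dense_imp (H i q qp di) => r rq [j [dj ej]]; exists j; split=> //; apply: IH.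
Qed.

Lemma eqn_trans x y z p : eqn x y p -> eqn y z p -> eqn x z p.
Proof.
elim: x y z p => I f IH d y z p /eqnE [H K] /eqnE [H' K']; apply/eqnE.
split=> i q qp di.
  apply: dense_bind (H i q qp di) _ => r rq [j [dj ej]].
  apply: dense_imp (H' j r (le_trans rq qp) dj) => s sr [k [dk ek]].
  exists k; split=> //; apply: IH ek; exact: reg_mono ej.
apply: dense_bind (K' i q qp di) _ => r rq [j [dj ej]].
apply: dense_imp (K j r (le_trans rq qp) dj) => s sr [k [dk ek]].
by exists k; split=> //; apply: IH ek _; apply: reg_mono ej.
Qed.

Lemma memn_eql x x' y p : eqn x x' p -> memn x y p -> memn x' y p.
Proof.
move=> e; apply: dense_imp => q qp [j [dj ej]]; exists j; split=> //.
by apply: eqn_trans ej; apply: eqn_sym; apply: reg_mono e.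
Qed.

Lemma memn_eqr x y y' p : eqn y y' p -> memn x y p -> memn x y' p.
Proof.
move=> /eqnE [H _] m; apply: dense_bind m _ => q qp [j [dj ej]].
by apply: memn_eql (H j q qp dj); apply: eqn_sym.
Qed.

Lemma eqn_ext x y p :
  (forall z q, le q p -> (memn z x q <-> memn z y q)) -> eqn x y p.
Proof.
move=> H; apply/eqnE; split=> i q qp di; first by apply/H/memn_idx.
have /H : memn (el y i) y q by apply: memn_idx.
move=> /(_ qp); apply: dense_imp => r rq [j [dj ej]]; exists j; split=> //.
exact: eqn_sym.
Qed.

Lemma memn_elim x y p (B : Om) : Reg B -> memn x y p ->
  (forall q j, le q p -> dm y j q -> eqn x (el y j) q -> B q) -> B p.
Proof.
by move=> rB m H; apply: denseE m _ => q qp [j [dj ej]]; apply: H ej.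
Qed.

Global Instance Cong_const (A : Om) : Cong (fun=> A).
Proof. by []. Qed.
Global Instance Cong_meml y : Cong (fun x => memn x y).
Proof. by move=> x x' p; apply: memn_eql. Qed.
Global Instance Cong_memr y : Cong (fun x => memn y x).
Proof. by move=> x x' p; apply: memn_eqr. Qed.
Global Instance Cong_simp (A B : name -> Om) :
  Cong A -> Cong B -> Cong (fun x => simp (A x) (B x)).
Proof.
move=> cA cB x y p e H q qp Ay; have eq : eqn x y q by apply: reg_mono e.
by apply: cB eq (H q qp (cA _ _ _ (eqn_sym eq) Ay)).
Qed.
Global Instance Cong_all X (F : name -> X -> Om) :
  (forall t, Cong (fun x => F x t)) -> Cong (fun x => sall (F x)).
Proof. by move=> cF x y p e H t; apply: cF e (H t). Qed.
Global Instance Cong_not (A : name -> Om) : Cong A -> Cong (fun x => snot (A x)).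
Proof. by move=> cA; apply: Cong_simp. Qed.
Global Instance Cong_and (A B : name -> Om) :
  Cong A -> Cong B -> Cong (fun x => sand (A x) (B x)).
Proof. by move=> cA cB; do !apply: Cong_simp. Qed.
Global Instance Cong_iff (A B : name -> Om) :
  Cong A -> Cong B -> Cong (fun x => siff (A x) (B x)).
Proof. by move=> cA cB; apply: Cong_and; apply: Cong_simp. Qed.
Global Instance Cong_ex X (F : name -> X -> Om) :
  (forall t, Cong (fun x => F x t)) -> Cong (fun x => sex (F x)).
Proof. by move=> cF; apply: Cong_not; apply: Cong_all => z; apply: Cong_not. Qed.

Global Instance Reg_force rho (A : form) : Reg (force rho A).
Proof. by elim: A rho => [|i j|i j|A IHA B IHB|A IH] rho /=; exact _. Qed.

Lemma force_ren rho f (A : form) : force rho (ren f A) = force (rho \o f) A.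
Proof.
elim: A rho f => [|i j|i j|A IHA B IHB|A IH] rho f //=; first by rewrite IHA IHB.
congr sall; apply: funext => a; rewrite IH; congr force.
by apply: funext => -[|i].
Qed.

Lemma force_eqv rho rho' (A : form) p :
  (forall i, eqn (rho i) (rho' i) p) -> force rho A p -> force rho' A p.
Proof.
elim: A rho rho' p => [|i j|i j|A IHA B IHB|A IH] rho rho' p e //=.
- by move=> eij; exact: eqn_trans (eqn_sym (e i)) (eqn_trans eij (e j)).
- by move=> m; exact: memn_eqr (e j) (memn_eql (e i) m).
- move=> H q qp Aq; have eq i : eqn (rho i) (rho' i) q by apply: reg_mono (e i).
  have Bq := H q qp (IHA _ _ _ (fun i => eqn_sym (eq i)) Aq).
  exact: IHB eq Bq.
- move=> H a; apply: (IH (scons a rho)); last exact: H.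
  by case=> [|i] /=; [apply: eqn_refl | apply: e].
Qed.

Theorem soundness T (A : form) : provable T A ->
  forall rho p, (forall B : form, T B -> force rho B p) -> force rho A p.
Proof.
have ext (T' : theory) (A' : form) rho p q : (forall B : form, T' B -> force rho B p) -> le q p ->
    force rho A' q -> forall B : form, extend T' A' B -> force rho B q.
  by move=> H qp Aq B [/H|->] //; apply: reg_mono.
elim=> {T A} [T A TA|T A C _ IH|T A C _ IH1 _ IH2|T A _ IH|T A _ IH|T A i _ IH
  |T i|T A i j _ IH1 _ IH2] rho p H /=.
- exact: H.
- by move=> q qp Aq; exact: IH _ _ (ext _ _ _ _ _ H qp Aq).
- exact: IH1 H _ (le_refl p) (IH2 _ _ H).
- apply: snotnot => q qp nA; apply: (IH rho q).
  exact: (ext _ (Imp A Bot) _ _ _ H qp nA).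
- move=> a; apply: IH => _ [B TB ->]; rewrite force_ren.
  rewrite (_ : _ \o S = rho) //; exact: H.
- rewrite /subst0 force_ren; move: (IH _ _ H (rho i)); congr (force _ _ _).
  by apply: funext => -[|k].
- exact: eqn_refl.
- move: (IH2 _ _ H); rewrite /subst0 !force_ren; apply: force_eqv => -[|k] /=.
    exact: IH1.
  exact: eqn_refl.
Qed.

Lemma force_closure rho (A : form) p :
  (forall rho, force rho A p) -> force rho (universal_closure A) p.
Proof.
rewrite /universal_closure; elim: (fv_bound A) rho => [|n IH] rho H //=.
by move=> a; apply: IH.
Qed.

(** * Names for pairs, unions, power sets, separated sets and omega *)

Section ZFC.

Implicit Types (a b c u v : name).

Definition nupair x y : name := Nm bool (fun t : bool => if t then x else y) (fun _ _ => True).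

Lemma memn_upair u x y p :
  memn u (nupair x y) p <-> dense (fun r => eqn u x r \/ eqn u y r) p.
Proof.
split; apply: dense_imp => q qp; first by case=> -[] [_ e]; [left | right].
have dmT i : dm (nupair x y) i q by exists q.
by case=> e; [exists true | exists false].
Qed.

Definition nunion a : name :=
  Nm {i : idx a & idx (el a i)} (fun ij => el (el a (projT1 ij)) (projT2 ij))
    (fun ij p => dm a (projT1 ij) p /\ dm (el a (projT1 ij)) (projT2 ij) p).

Lemma memn_union u a p :
  memn u (nunion a) p <-> dense (fun r => exists x, memn x a r /\ memn u x r) p.
Proof.
split=> [|H].
  apply: dense_imp => q qp [[i j] [[r [qr [di dj]]] e]]; exists (el a i).
  split; first by apply: memn_idx; apply: dm_mono di.
  by apply: (memn_eql (eqn_sym e)); apply: memn_idx; apply: dm_mono dj.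
apply: dense_bind H _ => q qp [x [xa ux]].
apply: dense_bind xa _ => r rq [i [di e]].
have : memn u (el a i) r by apply: (memn_eqr e); apply: reg_mono ux.
apply: dense_imp => s sr [j [dj e']]; exists (existT _ i j); split=> //=.
by apply: dnI; split=> //; apply: dm_mono di.
Qed.

Definition nrestr a (U : idx a -> Om) : name :=
  Nm (idx a) (el a) (fun i p => dm a i p /\ U i p).

(** Up to [eqn], a subset of [a] is given by one truth value for each index of [a], so these
    assignments suffice to index the power set. *)
Definition npow a : name := Nm (idx a -> Om) (@nrestr a) (fun _ _ => True).

Lemma memn_pow u a p :
  memn u (npow a) p <-> sall (fun z => simp (memn z u) (memn z a)) p.
Proof.
split=> [H z q qp zu|H].
  apply: memn_elim (dense_mono qp H) _ => r U rq _ e.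
  have : memn z (nrestr U) r by apply: (memn_eqr e); apply: reg_mono zu.
  apply: dense_imp => s sr [i [[t [st [di _]]] e']]; exists i; split=> //.
  exact: dm_mono st di.
apply: denseI; last first.
  exists (fun i q => memn (el a i) u q); split; first by exists p.
  apply: eqn_ext => z q qp; split=> [zu|].
    apply: memn_elim (H z q qp zu) _ => r i rq di e.
    apply: (memn_eql (eqn_sym e)); apply: (@memn_idx (nrestr _) i).
    by apply: dnI; split=> //; apply: (memn_eql e); apply: reg_mono zu.
  move=> zN; apply: memn_elim zN _ => r i rq [s [rs [di mu]]] e.
  by apply: (memn_eql (eqn_sym e)); apply: reg_mono mu.
move=> q r rq [U [_ e]]; exists U; split; first by exists r.
exact: reg_mono e.
Qed.

Definition nsep a (A : name -> Om) : name := @nrestr a (fun i => A (el a i)).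

Lemma memn_sep a (F : name -> Om) {RF : forall t, Reg (F t)} {CF : Cong F} x p :
  memn x (nsep a F) p <-> memn x a p /\ F x p.
Proof.
split=> [H|[xa Fx]].
  split; [apply: dense_imp H => q qp | apply: memn_elim H _ => q i qp].
    case=> i [[s [qs [di _]]] e]; exists i; split=> //; exact: dm_mono di.
  move=> [s [qs [_ Fi]]] e; apply: (cong (eqn_sym e)); exact: reg_mono Fi.
apply: memn_elim xa _ => q i qp di e; apply: (memn_eql (eqn_sym e)).
apply: (@memn_idx (nrestr _) i); apply: dnI; split=> //.
by apply: (cong e); apply: reg_mono Fx.
Qed.

Definition nempty : name := Nm False (fun i => match i with end) (fun _ _ => True).

Lemma memn_empty u p : ~ memn u nempty p.
Proof. by move=> /(_ p (le_refl p)) [r [_ [[]]]]. Qed.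

Definition nsucc x : name :=
  Nm (option (idx x)) (fun o => if o is Some i then el x i else x)
    (fun o => if o is Some i then dm x i else fun=> True).

Lemma memn_succ u x p :
  memn u (nsucc x) p <-> dense (fun r => memn u x r \/ eqn u x r) p.
Proof.
split=> H.
  apply: dense_imp H => q qp [[i|] [d e]]; last by right.
  left; apply: (memn_eql (eqn_sym e)); apply: memn_idx.
  by case: d => r [qr di]; apply: dm_mono di.
apply: dense_bind H _ => q qp [m|e]; last first.
  move=> r rq; exists r; split=> //; exists None; split; first by exists r.
  exact: reg_mono e.
apply: dense_imp m => r rq [i [di e]]; exists (Some i); split=> //.
exact: dnI.
Qed.

Fixpoint nnat n : name := if n is m.+1 then nsucc (nnat m) else nempty.
Definition nomega : name := Nm nat nnat (fun _ _ => True).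

Lemma memn_omega u p :
  memn u nomega p <-> dense (fun r => exists n, eqn u (nnat n) r) p.
Proof.
split; apply: dense_imp => q qp; first by case=> n [_ e]; exists n.
by case=> n e; exists n; split=> //; exists q.
Qed.

(** * The axioms of ZFC are forced *)

Definition s_subset a b : Om := sall (fun u => simp (memn u a) (memn u b)).
Definition s_empty x : Om := sall (fun u => snot (memn u x)).
Definition s_bex (a : name) (F : name -> Om) := sex (fun x => sand (memn x a) (F x)).
Definition s_ball (a : name) (F : name -> Om) := sall (fun x => simp (memn x a) (F x)).
Definition s_disjoint a b : Om := snot (s_bex a (fun u => memn u b)).
Definition s_upair z x y : Om :=
  sall (fun u => siff (memn u z) (sor (eqn u x) (eqn u y))).
Definition s_inter c a b : Om :=
  sall (fun u => siff (memn u c) (sand (memn u a) (memn u b))).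
Definition s_succ y x : Om :=
  sall (fun u => siff (memn u y) (sor (memn u x) (eqn u x))).
Definition s_ind a : Om :=
  sand (s_bex a s_empty) (s_ball a (fun x => s_bex a (fun y => s_succ y x))).

Global Instance Reg_bex a F : (forall x, Reg (F x)) -> Reg (s_bex a F).
Proof. by move=> ?; rewrite /s_bex; exact _. Qed.
Global Instance Reg_ball a F : (forall x, Reg (F x)) -> Reg (s_ball a F).
Proof. by move=> ?; rewrite /s_ball; exact _. Qed.
Global Instance Reg_subset a b : Reg (s_subset a b).
Proof. by rewrite /s_subset; exact _. Qed.
Global Instance Reg_empty a : Reg (s_empty a).
Proof. by rewrite /s_empty; exact _. Qed.
Global Instance Reg_disjoint a b : Reg (s_disjoint a b).
Proof. by rewrite /s_disjoint; exact _. Qed.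
Global Instance Reg_upair a b c : Reg (s_upair a b c).
Proof. by rewrite /s_upair; exact _. Qed.
Global Instance Reg_inter a b c : Reg (s_inter a b c).
Proof. by rewrite /s_inter; exact _. Qed.
Global Instance Reg_succ a b : Reg (s_succ a b).
Proof. by rewrite /s_succ; exact _. Qed.
Global Instance Reg_ind a : Reg (s_ind a).
Proof. by rewrite /s_ind; exact _. Qed.

Lemma bexP a F p : (forall x, Reg (F x)) ->
  s_bex a F p <-> dense (fun r => exists x, memn x a r /\ F x r) p.
Proof.
move=> rF; split=> H.
  by move/sexP: H; apply: dense_imp => q qp [x /sandP Hx]; exists x.
by apply/sexP; apply: dense_imp H => q qp [x Hx]; exists x; apply/sandP.
Qed.

Lemma bexI a F p x : (forall x, Reg (F x)) -> memn x a p -> F x p -> s_bex a F p.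
Proof. by move=> rF xa Fx; apply: (sexI (t := x)); apply/sandP. Qed.

Lemma bexE a F B p : (forall x, Reg (F x)) -> Reg B -> s_bex a F p ->
  (forall q x, le q p -> memn x a q -> F x q -> B q) -> B p.
Proof.
move=> rF rB /bexP H FB; apply: denseE H _ => q qp [x [xa Fx]].
exact: FB xa Fx.
Qed.

Lemma upairP z x y p : s_upair z x y p <-> eqn z (nupair x y) p.
Proof.
split=> [H|e u].
  apply: eqn_ext => u q qp; rewrite memn_upair.
  by have /siffP /(_ _ qp) -> := H u; rewrite sorP.
apply/siffP => q qp; rewrite sorP -memn_upair.
split; apply: memn_eqr; last apply: eqn_sym; exact: reg_mono e.
Qed.

Lemma succP y x p : s_succ y x p <-> eqn y (nsucc x) p.
Proof.
split=> [H|e u].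
  apply: eqn_ext => u q qp; rewrite memn_succ.
  by have /siffP /(_ _ qp) -> := H u; rewrite sorP.
apply/siffP => q qp; rewrite sorP -memn_succ.
split; apply: memn_eqr; last apply: eqn_sym; exact: reg_mono e.
Qed.

Lemma emptyP x p : s_empty x p <-> eqn x nempty p.
Proof.
split=> [H|e u q qp ux].
  by apply: eqn_ext => u q qp; split=> [/(H u q qp)|/memn_empty].
by apply: (@memn_empty u q); apply: memn_eqr ux; apply: reg_mono e.
Qed.

Lemma omega_ind p : s_ind nomega p.
Proof.
apply/sandP; split.
  apply: (bexI (x := nnat 0)); last exact/emptyP/eqn_refl.
  by apply/memn_omega => q qp; exists q; split=> //; exists 0; apply: eqn_refl.
move=> x q qp /memn_omega xw; apply: denseE xw _ => r rq [n e].
apply: (bexI (x := nnat n.+1)).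
  by apply/memn_omega => s sr; exists s; split=> //; exists n.+1; apply: eqn_refl.
apply/succP; apply: eqn_ext => u s sr; rewrite !memn_succ.
have es : eqn x (nnat n) s by apply: reg_mono e.
split; apply: dense_imp => t ts; have et : eqn x (nnat n) t by apply: reg_mono es.
  case=> H; [left; apply: memn_eqr (eqn_sym et) H | right].
  exact: eqn_trans H (eqn_sym et).
case=> H; [left; apply: memn_eqr et H | right].
exact: eqn_trans H et.
Qed.

Lemma force_inst rho (A : form) xs n :
  force rho (inst A xs n) =
  force (fun i => if i < size xs then rho (n - (nth 0 xs i).+1)
                  else rho (i - size xs + n)) A.
Proof.
rewrite /inst force_ren; congr (force _ _); apply: funext => i /=.
by case: ifP.
Qed.

Lemma force_ext rho p : force rho (ax_ext 0) p.
Proof.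
move=> a b q qp H; apply: eqn_ext => z r rq.
have /siffP : siff (memn z a) (memn z b) q by apply: (H z).
by apply.
Qed.

(** Induction on the name of a member of [a]: either some stronger condition puts a member of it
    into [a], and the induction hypothesis applies to that member, or it is itself forced to be
    disjoint from [a]. *)
Lemma force_found rho p : force rho (ax_found 0) p.
Proof.
rewrite -[force _ _]/(sall (fun a => simp (snot (s_empty a))
  (s_bex a (fun x => s_disjoint x a)))) => a q qp ne.
have ind x r : memn x a r -> s_bex a (fun x => s_disjoint x a) r.
  elim: x r => I f IH d r xa; apply: reg_dense => s sr.
  have [H|H] := lem (exists t u, [/\ le t s, memn u (Nm I f d) t & memn u a t]).
    have [t [u [ts ux ua]]] := H.
    have [v [vt [i [di e]]]] := ux _ (le_refl t).
    exists v; split; first exact: le_trans vt ts.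
    by apply: (IH i); apply: (memn_eql e); apply: reg_mono ua.
  exists s; split=> //; apply: (bexI (x := Nm I f d)); first exact: reg_mono xa.
  move=> t ts /bexP /(_ _ (le_refl t)) [v [vt [u [ux ua]]]]; apply: H.
  by exists v, u; split=> //; apply: le_trans ts.
apply: contrapT => nb; apply: nb; apply: reg_dense => r rq.
have [u [s [sr ua]]] : exists u s, le s r /\ memn u a s.
  apply: contrapT => H; apply: (ne r rq) => u s sr ua; apply: H.
  by exists u, s.
by exists s; split=> //; apply: ind ua.
Qed.

Lemma force_pair rho p : force rho (ax_pair 0) p.
Proof.
rewrite -[force _ _]/(sall (fun x => sall (fun y => sex (fun z => s_upair z x y)))).
move=> x y; apply: (sexI (t := nupair x y)); exact/upairP/eqn_refl.
Qed.

Lemma force_union rho p : force rho (ax_union 0) p.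
Proof.
rewrite -[force _ _]/(sall (fun a => sex (fun b => sall (fun u =>
  siff (memn u b) (s_bex a (fun x => memn u x)))))).
move=> a; apply: (sexI (t := nunion a)) => u; apply/siffP => q qp.
by rewrite memn_union bexP.
Qed.

Lemma force_power rho p : force rho (ax_power 0) p.
Proof.
rewrite -[force _ _]/(sall (fun a => sex (fun b => sall (fun u =>
  siff (memn u b) (s_subset u a))))).
move=> a; apply: (sexI (t := npow a)) => u; apply/siffP => q qp.
exact: memn_pow.
Qed.

Lemma force_inf rho p : force rho (ax_inf 0) p.
Proof.
rewrite -[force _ _]/(sex s_ind); apply: (sexI (t := nomega)); exact: omega_ind.
Qed.

Lemma force_sep rho (A : form) p : force rho (universal_closure (ax_sep A 0)) p.
Proof.
apply: force_closure => {}rho a.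
set G := fun x => force (fun i => if i is j.+1 then rho j else x) A.
change (sex (fun b => sall (fun x => siff (memn x b)
  (sand (memn x a) (force (scons x (scons b (scons a rho))) (inst A [:: 2] 3))))) p).
have rG x : Reg (G x) by rewrite /G; exact _.
have cG : Cong G.
  by move=> x y q e; apply: force_eqv => -[|i] //; apply: eqn_refl.
apply: (sexI (t := nsep a G)) => x; apply/siffP => q qp; rewrite memn_sep sandP.
rewrite force_inst (_ : force _ A = G x) //; congr (force _ _).
by apply: funext => -[|i] //=; rewrite subn1 addn3.
Qed.

Lemma force_repl rho (A : form) p : force rho (universal_closure (ax_repl A 0)) p.
Proof.
apply: force_closure => {}rho a q qp.
change (s_ball a (fun x => sall (fun y => sall (fun z =>
   simp (force (scons z (scons y (scons x (scons a rho)))) (inst A [:: 1; 2] 4))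
  (simp (force (scons z (scons y (scons x (scons a rho)))) (inst A [:: 1; 3] 4))
   (eqn y z))))) q -> sex (fun b => sall (fun y => siff (memn y b)
  (s_bex a (fun x =>
     force (scons x (scons y (scons b (scons a rho)))) (inst A [:: 3; 2] 4))))) q).
pose G x y := force (fun i => if i is j.+1 then if j is k.+1 then rho k else y else x) A.
have rG x y : Reg (G x y) by rewrite /G; exact _.
have cG x x' y y' r : eqn x x' r -> eqn y y' r -> G x y r -> G x' y' r.
  by move=> e e'; apply: force_eqv => -[|[|i]] //; apply: eqn_refl.
have E1 x y z : force (scons z (scons y (scons x (scons a rho)))) (inst A [:: 1; 2] 4) = G x y.
  rewrite force_inst; congr (force _ _); apply: funext => -[|[|i]] //=.
  by rewrite subn2 addn4.
have E2 x y z : force (scons z (scons y (scons x (scons a rho)))) (inst A [:: 1; 3] 4) = G x z.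
  rewrite force_inst; congr (force _ _); apply: funext => -[|[|i]] //=.
  by rewrite subn2 addn4.
have E3 b x y : force (scons x (scons y (scons b (scons a rho)))) (inst A [:: 3; 2] 4) = G x y.
  rewrite force_inst; congr (force _ _); apply: funext => -[|[|i]] //=.
  by rewrite subn2 addn4.
move=> fn.
have {}fn x y z r : le r q -> memn x a r -> G x y r -> G x z r -> eqn y z r.
  move=> rq xa Gy Gz; have := fn x r rq xa y z r (le_refl r).
  by rewrite E1 E2; apply.
(* One witness is chosen for each index of [a] and each condition, which bounds the witnesses by a
   set; functionality identifies any other value with the chosen one. *)
have [F FP] : exists F : idx a * P -> name,
    forall i r, (exists y, G (el a i) y r) -> G (el a i) (F (i, r)) r.
  have /choice [F FP] : forall ir : idx a * P, exists y,
      (exists y, G (el a ir.1) y ir.2) -> G (el a ir.1) y ir.2.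
    move=> [i r] /=; have [[y Gy]|n] := lem (exists y, G (el a i) y r).
      by exists y.
    by exists a => /n.
  by exists F => i r; apply: FP (i, r).
pose b := Nm (idx a * P) F (fun ir s => le s ir.2 /\ dm a ir.1 s /\ G (el a ir.1) (F ir) s).
have rE y : forall x, Reg (force (scons x (scons y (scons b (scons a rho)))) (inst A [:: 3; 2] 4)).
  by move=> x; exact _.
apply: (sexI (t := b)) => y; apply/siffP => r rq; rewrite bexP; split=> [|H].
  apply: dense_imp => s sr [[i t] [[v [sv [/= vt [di Gv]]]] e]]; exists (el a i).
  split; first by apply: memn_idx; apply: dm_mono di.
  by rewrite E3; apply: cG (eqn_refl _ _) (eqn_sym e) _; apply: reg_mono Gv.
apply: dense_bind H _ => s sr [x [xa]]; rewrite E3 => Gxy.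
apply: dense_imp xa => t ts [i [di e]]; exists (i, t).
have Gt : G (el a i) y t.
  by apply: cG e (eqn_refl _ _) _; apply: reg_mono Gxy.
have GF : G (el a i) (F (i, t)) t by apply: FP; exists y.
split; first by apply: dnI.
apply: fn Gt GF; last exact: memn_idx.
exact: le_trans ts (le_trans sr rq).
Qed.

(* The choice set collects, from each element of the family, the first member
   in a fixed well-order of the underlying names of members of members. *)
Lemma force_choice rho p : force rho (ax_choice 0) p.
Proof.
rewrite -[force _ _]/(sall (fun a =>
  simp (s_ball a (fun x => snot (s_empty x)))
  (simp (s_ball a (fun x => s_ball a (fun y => simp (snot (eqn x y)) (s_disjoint x y))))
  (sex (fun c => s_ball a (fun x => sex (fun u => sall (fun v =>
    siff (sand (memn v c) (memn v x)) (eqn v u))))))))).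
move=> a q qp ne r rq dj.
pose J := {i : idx a & idx (el a i)}.
pose X (k : J) := el a (projT1 k); pose E (k : J) := el (X k) (projT2 k).
have [lt [wf trans total]] := well_order_exists J.
pose c := Nm (idx a * J) (fun ik => E ik.2) (fun ik s => [/\ dm a ik.1 s,
  memn (E ik.2) (el a ik.1) s & forall k, lt k ik.2 -> snot (memn (E k) (el a ik.1)) s]).
apply: (sexI (t := c)) => x s sr xa; apply/sexP => t ts.
have neT : ~ s_empty x t.
  have sq : le s q by apply: le_trans sr rq.
  by move=> H; apply: (ne x s sq xa t ts H).
have [k [w [wt kx]] kmin] : exists2 k, exists w, le w t /\ memn (E k) x w
    & forall k', lt k' k -> forall w, le w t -> ~ memn (E k') x w.
  have [k [w [wt kx]]] : exists k w, le w t /\ memn (E k) x w.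
    apply: contrapT => H; apply: neT => u v vt ux; apply: H.
    have xv : memn x a v by apply: reg_mono xa; apply: le_trans ts.
    have [v1 [v1v [i [di e]]]] := xv _ (le_refl v).
    have : memn u (el a i) v1 by apply: (memn_eqr e); apply: reg_mono ux.
    move=> /(_ _ (le_refl v1)) [v2 [v21 [j [dj' e']]]].
    exists (existT _ i j), v2; split; first exact: le_trans v21 (le_trans v1v vt).
    apply: (@memn_eqr _ (el a i)); last exact: memn_idx.
    by apply: eqn_sym; apply: reg_mono e.
  elim: k / (wf k) w wt kx => k _ IH w wt kx.
  have [[k' [lk [w' [wt' kx']]]]|H] :=
      lem (exists k', lt k' k /\ exists w, le w t /\ memn (E k') x w).
    exact: IH lk w' wt' kx'.
  exists k; first by exists w.
  by move=> k' lk w' wt' kx'; apply: H; exists k'; split=> //; exists w'.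
have xw : memn x a w by apply: reg_mono xa; apply: le_trans ts.
have [w1 [w1w [i [di e]]]] := xw _ (le_refl w).
have w1t : le w1 t by apply: le_trans wt.
have kx1 : memn (E k) x w1 by apply: reg_mono kx.
exists w1; split=> //; exists (E k) => v; apply/siffP => z zw; rewrite sandP.
have zt : le z t by apply: le_trans w1t.
have ez : eqn x (el a i) z by apply: reg_mono e.
have kz : memn (E k) x z by apply: reg_mono kx1.
split=> [[vc vx]|ev]; last first.
  split; apply: (memn_eql (eqn_sym ev)) => //.
  apply: (@memn_idx c (i, k)); apply: dnI; split=> /=.
  - exact: dm_mono di.
  - exact: memn_eqr ez _.
  - move=> k' lk y yz kx'; apply: (kmin k' lk y (le_trans yz zt)).
    by apply: memn_eqr kx'; apply: eqn_sym; apply: reg_mono ez.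
apply: memn_elim vc _ => y [i' k'] yz [y' [yy' [/= di' mk' min']]] ek'.
have yt : le y t by apply: le_trans zt.
have ex' : eqn x (el a i') y.
  apply: snotnot => y1 y1y nex.
  have y1r : le y1 r by apply: le_trans (le_trans y1y yt) (le_trans ts sr).
  have xy1 : memn x a y1.
    by apply: reg_mono xa; apply: le_trans (le_trans y1y yt) ts.
  have iy1 : memn (el a i') a y1.
    by apply: memn_idx; apply: dm_mono di'; apply: le_trans yy'.
  have dj' : s_disjoint x (el a i') y1.
    exact: (dj x y1 y1r xy1 (el a i') y1 (le_refl y1) iy1 y1 (le_refl y1) nex).
  apply: (dj' y1 (le_refl y1)); apply: (bexI (x := v)).
    by apply: reg_mono vx; apply: le_trans yz.
  apply: (memn_eql (_ : eqn (E k') v y1)).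
    by apply: eqn_sym; apply: reg_mono ek'.
  by apply: reg_mono mk'; apply: le_trans yy'.
have [lk|[<-|lk]] := total k' k.
- case: (kmin k' lk y yt); apply: (memn_eqr (eqn_sym ex')).
  exact: reg_mono mk'.
- exact: ek'.
- case: (min' k lk y yy'); apply: memn_eqr ex' _; exact: reg_mono kz.
Qed.

Lemma force_ZFC rho (A : form) p : ZFC A -> force rho A p.
Proof.
case=> [||||||| B|B].
- exact: force_ext.
- exact: force_found.
- exact: force_pair.
- exact: force_union.
- exact: force_power.
- exact: force_inf.
- exact: force_choice.
- exact: force_sep.
- exact: force_repl.
Qed.

End ZFC.

(** * Names for elements of R' *)

Section Reals.

(* [f m v r]: the condition [r] was declared to put [f(m) = v]. *)
Definition rname := nat -> nat -> P -> Prop.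
Implicit Types (f t : rname).

Definition dec f r m v := dn (f m v) r.
Definition decs f r s := forall m, m < size s -> dec f r m (nth 0 s m).
Definition isreal p f := (forall m, dense (fun r => exists v, v < m.+3 /\ dec f r m v) p) /\
  forall r m v w, le r p -> dec f r m v -> dec f r m w -> v = w.

Definition avoids r t s := forall r' m v, le r' r -> m < size s -> dec t r' m v ->
  nth 0 s m + v <> m.+2.

(* [U r s]: the condition [r] puts all extensions of [s] into some open set. *)
Definition opens (U : nat -> P -> seq nat -> Prop) :=
  forall i r r' s, le r' r -> U i r s -> U i r' s.
Definition dense_past (U : nat -> P -> seq nat -> Prop) p s0 :=
  forall i r s, le r p -> stem s -> spref s0 s ->
    exists r' s', [/\ le r' r, spref s s', stem s' & U i r' s'].
Definition enters (U : nat -> P -> seq nat -> Prop) p f :=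
  forall i, dense (fun r => exists s, decs f r s /\ U i r s) p.

(* What [p] forcing [X] to be non-meagre provides. *)
Definition nonmeagre_at (inX : P -> rname -> Prop) p :=
  forall q U, le q p -> opens U -> dense_past U q [::] ->
    exists q' f, [/\ le q' q, isreal q' f, inX q' f & enters U q' f].

(* What [p] forcing [C_EK] to meet every translate of [X] in a meagre set provides. *)
Definition meagre_trace_at (inX : P -> rname -> Prop) p :=
  forall q t, le q p -> isreal q t -> exists q' (Bad : nat -> P -> seq nat -> Prop),
    [/\ le q' q, opens Bad,
      forall k r s, le r q' -> stem s -> avoids r t s ->
        exists r' s', [/\ le r' r, spref s s', stem s', avoids r' t s' & Bad k r' s'] &
      ~ exists r f, [/\ le r q', isreal r f, inX r f,
        forall r' m v w, le r' r -> dec f r' m v -> dec t r' m w -> v + w <> m.+2 &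
        enters Bad r f]].

Lemma dec_mono f m v p q : le q p -> dec f p m v -> dec f q m v.
Proof. exact: dn_mono. Qed.

Lemma decs_mono f s p q : le q p -> decs f p s -> decs f q s.
Proof. by move=> qp H m ms; apply: dec_mono qp (H m ms). Qed.

Lemma isreal_mono f p q : le q p -> isreal p f -> isreal q f.
Proof.
move=> qp [H K]; split=> [m|r m v w rq]; first exact: dense_mono qp (H m).
by apply: K; apply: le_trans rq qp.
Qed.

Lemma decs_spref f r s s' : spref s s' -> decs f r s' -> decs f r s.
Proof. by move=> [ss H] d m ms; rewrite H //; apply: d; apply: leq_trans ss. Qed.

Lemma decide_upto p f n : isreal p f ->
  dense (fun r => exists s, [/\ size s = n, stem s & decs f r s]) p.
Proof.
move=> [H _] q qp; elim: n => [|n [r [rq [s [sn ss ds]]]]]; first by exists q; split=> //; exists [::].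
have [r' [r'r [v [vn dv]]]] := H n r (le_trans rq qp).
exists r'; split; first exact: le_trans r'r rq.
exists (rcons s v); rewrite size_rcons sn; split=> // m; rewrite size_rcons sn nth_rcons sn ltnS leq_eqVlt.
  by case: (ltngtP m n) => //= [mn _|-> _ //]; apply: ss; rewrite sn.
case: (ltngtP m n) => //= [mn _|-> _ //]; apply: dec_mono r'r _; apply: ds.
by rewrite sn.
Qed.

Definition clash (s s' : seq nat) :=
  exists m, [/\ m < size s, m < size s' & nth 0 s m <> nth 0 s' m].

Lemma clash_or s s' : clash s s' \/ exists u, [/\ spref s u, spref s' u & u = s \/ u = s'].
Proof.
have [c|nc] := lem (clash s s'); [by left | right].
have E m : m < size s -> m < size s' -> nth 0 s m = nth 0 s' m.
  by move=> ms ms'; apply: contrapT => ne; apply: nc; exists m.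
have [l|l] := leqP (size s) (size s').
  by exists s'; split=> //; [split=> // m ms; apply: E => //; apply: leq_trans l | right].
exists s; split=> //; last by left.
by split=> [|m ms]; [apply: ltnW | rewrite E //; apply: ltn_trans l].
Qed.

(* If no such [q] and [s0] existed, every [s0] would, below every condition, have
   an extension [s1] with [X] meagre in [s1]; the least witness for the latter
   stabilises, and covering X by the resulting sets would make it meagre. *)
Lemma nonmeagre_everywhere inX p :
  (forall q q' f, le q' q -> inX q f -> inX q' f) -> nonmeagre_at inX p ->
  exists q s0, [/\ le q p, stem s0 & forall q1 s1 U, le q1 q -> stem s1 -> spref s0 s1 ->
    opens U -> dense_past U q1 s1 ->
    exists q' f, [/\ le q' q1, isreal q' f, inX q' f, decs f q' s1 & enters U q' f]].
Proof.
move=> inX_mono nm; apply: contrapT => C.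
have /choice [B BP] : forall c : P * seq nat, exists b : P * seq nat * (nat -> P -> seq nat -> Prop),
    le c.1 p -> stem c.2 -> [/\ le b.1.1 c.1, stem b.1.2, spref c.2 b.1.2, opens b.2 &
      dense_past b.2 b.1.1 b.1.2 /\ ~ exists q' f, [/\ le q' b.1.1, isreal q' f, inX q' f,
        decs f q' b.1.2 & enters b.2 q' f]].
  move=> [q s0] /=; have [[qp ss]|n] := lem (le q p /\ stem s0); last first.
    by exists (q, s0, fun _ _ _ => True) => qp ss; case: n.
  apply: contrapT => C'; apply: C; exists q, s0; split=> // q1 s1 U q1q ss1 s01 oU dU.
  by apply: contrapT => C''; apply: C'; exists (q1, s1, U).
have [lt [lt_wf lt_trans lt_total]] := well_order_exists P.
pose stable r s0 q1 := [/\ le q1 p, le r (B (q1, s0)).1.1 & forall r' q2, le r' r -> le q2 p ->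
  lt q2 q1 -> ~ le r' (B (q2, s0)).1.1].
have st_mono r r' s0 q1 : le r' r -> stable r s0 q1 -> stable r' s0 q1.
  move=> r'r [a b c]; split=> //; first exact: le_trans r'r b.
  by move=> r2 q2 r2r'; apply: c; apply: le_trans r2r' r'r.
have st_uniq r s0 q1 q2 : stable r s0 q1 -> stable r s0 q2 -> q1 = q2.
  move=> [a1 b1 c1] [a2 b2 c2]; have [l|[//|l]] := lt_total q1 q2.
    by case: (c2 r q1 (le_refl r) a1 l b1).
  by case: (c1 r q2 (le_refl r) a2 l b2).
have st_dense r s0 : le r p -> stem s0 -> exists r' q1, le r' r /\ stable r' s0 q1.
  move=> rp ss; suff H q1 : (exists r', [/\ le r' r, le q1 p & le r' (B (q1, s0)).1.1]) ->
      exists r' q1, le r' r /\ stable r' s0 q1.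
    apply: (H r); have [b _ _ _ _] := BP (r, s0) rp ss.
    by exists (B (r, s0)).1.1.
  elim: q1 / (lt_wf q1) => q1 _ IH [r' [r'r q1p r'B]].
  have [[q2 [l [r2 [a b c]]]]|n] := lem (exists q2, lt q2 q1 /\
      exists r', [/\ le r' r, le q2 p & le r' (B (q2, s0)).1.1]).
    by apply: (IH q2 l); exists r2.
  exists r', q1; split=> //; split=> // r2 q2 r2r' q2p l r2B; apply: n.
  by exists q2; split=> //; exists r2; split=> //; apply: le_trans r2r' r'r.
pose U i r s := if i is j.+1 then
    let c : seq nat * nat := odflt ([::], 0) (unpickle j) in
    stem c.1 -> exists q1, stable r c.1 q1 /\
      (clash s (B (q1, c.1)).1.2 \/ (B (q1, c.1)).2 c.2 r s)
  else exists s0 q1, [/\ stem s0, stable r s0 q1 & spref (B (q1, s0)).1.2 s].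
have oU : opens U.
  move=> [|i] r r' s r'r /=.
    by move=> [s0 [q1 [a b c]]]; exists s0, q1; split=> //; apply: st_mono b.
  move=> H sc; have [q1 [st H1]] := H sc; exists q1; split; first exact: st_mono st.
  case: H1 => [c|b]; [by left | right].
  by have [q1p _ _] := st; have [_ _ _ o _] := BP (q1, _) q1p sc; apply: o r'r b.
have dU : dense_past U p [::].
  move=> [|i] r s rp ss _ /=.
    have [r' [q1 [r'r st]]] := st_dense r s rp ss; have [q1p _ _] := st.
    have [_ ss1 s01 _ _] := BP (q1, s) q1p ss.
    by exists r', (B (q1, s)).1.2; split=> //; exists s, q1.
  set c := odflt _ _; have [sc|nsc] := lem (stem c.1); last by exists r, s; split=> // /nsc.
  have [r' [q1 [r'r st]]] := st_dense r c.1 rp sc; have [q1p r'B _] := st.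
  have [_ ss1 s01 oB [dB _]] := BP (q1, c.1) q1p sc.
  have [cl|[u [su s1u Eu]]] := clash_or s (B (q1, c.1)).1.2.
    by exists r', s; split=> // _; exists q1; split=> //; left.
  have [|r2 [s2 [r2r' us2 ss2 b]]] := dB c.2 r' u r'B _ s1u; first by case: Eu => ->.
  exists r2, s2; split=> //; [exact: le_trans r2r' r'r | exact: spref_trans su us2 |].
  by move=> _; exists q1; split; [apply: st_mono st | right].
have [q [f [qp rf Xf ef]]] := nm p U (le_refl p) oU dU.
have [r [rq [s [ds [s0 [q1 [ss0 st s1s]]]]]]] := ef 0 q (le_refl q).
have [q1p rB _] := st; have [_ ss1 s01 _ [_ bad]] := BP (q1, s0) q1p ss0.
have dr := decs_spref s1s ds.
apply: bad; exists r, f; split=> //.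
- exact: isreal_mono rq rf.
- exact: inX_mono rq Xf.
- move=> i r' r'r; have [r2 [r2r' [s2 [ds2]]]] := ef (pickle (s0, i)).+1 r' (le_trans r'r rq).
  rewrite /U pickleK /= => /(_ ss0) [q2 [st2 H]].
  have E : q2 = q1 by apply: st_uniq st2 _; apply: st_mono st; apply: le_trans r2r' r'r.
  subst q2; exists r2; split=> //; exists s2; split=> //; case: H => // -[m [m2 m1 ne]].
  case: ne; apply: (proj2 rf r2 m).
  + exact: le_trans r2r' (le_trans r'r rq).
  + exact: ds2.
  + by apply: (decs_mono (le_trans r2r' r'r) dr).
Qed.

End Reals.

(** * Names for pairs, natural numbers and functions *)

Section Functions.

Implicit Types (u : name).

Lemma regular (A : Om) p : Reg A -> ~ A p -> exists q, le q p /\ forall r, le r q -> ~ A r.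
Proof.
move=> rA nA; apply: contrapT => n; apply: nA; apply: reg_dense => q qp.
apply: contrapT => n'; apply: n; exists q; split=> // r rq Ar.
by apply: n'; exists r.
Qed.

Definition opair x y := nupair (nupair x x) (nupair x y).
Definition s_pair u x y : Om :=
  sall (fun z => siff (memn z u) (sor (s_upair z x x) (s_upair z x y))).
Definition s_maps f x y := s_bex f (fun u => s_pair u x y).
Definition s_isfun f d : Om :=
  sand (s_ball f (fun u => s_bex d (fun x => sex (fun y => s_pair u x y))))
    (s_ball d (fun x => sex (fun y => sall (fun z => siff (s_maps f x z) (eqn z y))))).
Definition s_plus2 k m : Om := sex (fun l => sand (s_succ l m) (s_succ k l)).
Definition s_plus3 n m : Om := sex (fun k => sand (s_plus2 k m) (s_succ n k)).

Global Instance Reg_pair u x y : Reg (s_pair u x y).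
Proof. by rewrite /s_pair; exact _. Qed.
Global Instance Reg_maps f x y : Reg (s_maps f x y).
Proof. by rewrite /s_maps; exact _. Qed.
Global Instance Reg_isfun f d : Reg (s_isfun f d).
Proof. by rewrite /s_isfun; exact _. Qed.
Global Instance Reg_plus2 k m : Reg (s_plus2 k m).
Proof. by rewrite /s_plus2; exact _. Qed.
Global Instance Reg_plus3 k m : Reg (s_plus3 k m).
Proof. by rewrite /s_plus3; exact _. Qed.

Lemma upair_l x y p : memn x (nupair x y) p.
Proof. by apply/memn_upair/denseI => [q r rq [|] e|]; [left | right | left; apply: eqn_refl]; apply: reg_mono e. Qed.
Lemma upair_r x y p : memn y (nupair x y) p.
Proof. by apply/memn_upair/denseI => [q r rq [|] e|]; [left | right | right; apply: eqn_refl]; apply: reg_mono e. Qed.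

Lemma upair_congr x x' y y' p : eqn x x' p -> eqn y y' p -> eqn (nupair x y) (nupair x' y') p.
Proof.
move=> ex ey; apply: eqn_ext => z q qp; rewrite !memn_upair.
have ex' : eqn x x' q by apply: reg_mono ex.
have ey' : eqn y y' q by apply: reg_mono ey.
split; apply: dense_imp => r rq [] e; [left|right|left|right].
- by apply: (eqn_trans e); apply: reg_mono ex'.
- by apply: (eqn_trans e); apply: reg_mono ey'.
- by apply: (eqn_trans e); apply: eqn_sym; apply: reg_mono ex'.
- by apply: (eqn_trans e); apply: eqn_sym; apply: reg_mono ey'.
Qed.

Lemma opair_congr x x' y y' p : eqn x x' p -> eqn y y' p -> eqn (opair x y) (opair x' y') p.
Proof. by move=> ex ey; do !apply: upair_congr. Qed.

Lemma upair_case z x y p (B : Om) : Reg B -> memn z (nupair x y) p ->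
  (forall q, le q p -> eqn z x q -> B q) -> (forall q, le q p -> eqn z y q -> B q) -> B p.
Proof.
move=> rB /memn_upair H H1 H2; apply: denseE H _ => q qp [] e; [exact: H1 | exact: H2].
Qed.

Lemma sing_inj x y z p : eqn (nupair x x) (nupair y z) p -> eqn x y p /\ eqn x z p.
Proof.
move=> e; have H u : memn u (nupair y z) p -> eqn x u p.
  move=> /(memn_eqr (eqn_sym e)) m.
  by apply: (upair_case (B := eqn x u) _ m) => q qp e'; apply: eqn_sym.
by split; apply: H; [apply: upair_l | apply: upair_r].
Qed.

Lemma opair_inj x y x' y' p : eqn (opair x y) (opair x' y') p -> eqn x x' p /\ eqn y y' p.
Proof.
move=> e; have ex : eqn x x' p.
  have m : memn (nupair x x) (opair x' y') p by apply: (memn_eqr e); apply: upair_l.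
  by apply: (upair_case (B := eqn x x') _ m) => q qp e'; case: (sing_inj e').
split=> //; have H r : le r p -> eqn y x r -> eqn y y' r.
  move=> rp ey; have m : memn (nupair x' y') (opair x y) r.
    by apply: (memn_eqr (eqn_sym _)); [exact: reg_mono e | apply: upair_r].
  apply: (upair_case (B := eqn y y') _ m) => q qr e'.
    have [_ e2] := sing_inj (eqn_sym e'); apply: eqn_trans e2; exact: reg_mono ey.
  have m2 : memn y' (nupair x y) q by apply: (memn_eqr e'); apply: upair_r.
  apply: (upair_case (B := eqn y y') _ m2) => s sq e3; last exact: eqn_sym.
  by apply: eqn_trans (eqn_sym e3); apply: reg_mono ey; apply: le_trans qr.
have m : memn (nupair x y) (opair x' y') p by apply: (memn_eqr e); apply: upair_r.
apply: (upair_case (B := eqn y y') _ m) => q qp e'.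
  apply: H => //; have [a b] := sing_inj (eqn_sym e').
  exact: eqn_trans (eqn_sym b) a.
have m2 : memn y (nupair x' y') q by apply: (memn_eqr e'); apply: upair_r.
apply: (upair_case (B := eqn y y') _ m2) => s sq e3 //.
have sp : le s p by apply: le_trans sq qp.
apply: H => //; apply: (eqn_trans e3); apply: eqn_sym; exact: reg_mono ex.
Qed.

Lemma pairP z x y p : s_pair z x y p <-> eqn z (opair x y) p.
Proof.
have E u q : sor (s_upair u x x) (s_upair u x y) q <-> memn u (opair x y) q.
  by rewrite sorP memn_upair; split; apply: dense_imp => r _ [] /upairP; [left|right|left|right].
split=> [H|e u].
  apply: eqn_ext => u q qp; rewrite -E.
  by have /siffP /(_ _ qp) := H u.
apply/siffP => q qp; rewrite E.
split; apply: memn_eqr; last apply: eqn_sym; exact: reg_mono e.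
Qed.

Lemma mapsP f x y p : s_maps f x y p <-> memn (opair x y) f p.
Proof.
split=> [H|m]; last by apply: (bexI (x := opair x y)) => //; apply/pairP/eqn_refl.
by apply: (bexE (B := memn (opair x y) f)) H _ => q u qp uf /pairP e; apply: memn_eql e uf.
Qed.

Lemma isfun_uniq f d x y z p : s_isfun f d p -> memn x d p ->
  memn (opair x y) f p -> memn (opair x z) f p -> eqn y z p.
Proof.
move=> /sandP [_ H] xd /mapsP my /mapsP mz.
apply: (sexE (B := eqn y z)) (H x p (le_refl p) xd) _ => q u qp K.
have /siffP /(_ q (le_refl q)) [K1 _] := K y; have /siffP /(_ q (le_refl q)) [K2 _] := K z.
apply: (eqn_trans (K1 _)); first exact: reg_mono my.
by apply: eqn_sym; apply: K2; apply: reg_mono mz.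
Qed.

Lemma isfun_total f d x p : s_isfun f d p -> memn x d p ->
  dense (fun r => exists y, memn (opair x y) f r) p.
Proof.
move=> /sandP [_ H] xd.
have /sexP K : sex (fun y => sall (fun z => siff (s_maps f x z) (eqn z y))) p by apply: H.
apply: dense_imp K => q qp [y K']; exists y; apply/mapsP.
by have /siffP /(_ q (le_refl q)) [_ K1] := K' y; apply: K1; apply: eqn_refl.
Qed.

Lemma isfun_pair f d u p : s_isfun f d p -> memn u f p ->
  dense (fun r => exists x y, memn x d r /\ eqn u (opair x y) r) p.
Proof.
move=> /sandP [H _] uf.
have /bexP K : s_bex d (fun x => sex (fun y => s_pair u x y)) p by apply: H.
apply: dense_bind K _ => q qp [x [xd /sexP K]].
apply: dense_imp K => r rq [y /pairP e]; exists x, y; split=> //.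
exact: reg_mono xd.
Qed.

Lemma succ_congr x x' p : eqn x x' p -> eqn (nsucc x) (nsucc x') p.
Proof.
move=> e; apply: eqn_ext => u q qp; rewrite !memn_succ.
have e' : eqn x x' q by apply: reg_mono e.
split; apply: dense_imp => r rq [] H; [left|right|left|right].
- by apply: memn_eqr H; apply: reg_mono e'.
- by apply: (eqn_trans H); apply: reg_mono e'.
- by apply: memn_eqr H; apply: eqn_sym; apply: reg_mono e'.
- by apply: (eqn_trans H); apply: eqn_sym; apply: reg_mono e'.
Qed.

Lemma plus2P k m p : s_plus2 k m p <-> eqn k (nsucc (nsucc m)) p.
Proof.
split=> [H|e].
  apply: (sexE (B := eqn k (nsucc (nsucc m)))) H _ => q l qp /sandP [/succP e /succP e'].
  exact: eqn_trans e' (succ_congr e).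
by apply: (sexI (t := nsucc m)); apply/sandP; split; apply/succP => //; apply: eqn_refl.
Qed.

Lemma plus3P n m p : s_plus3 n m p <-> eqn n (nsucc (nsucc (nsucc m))) p.
Proof.
split=> [H|e].
  apply: (sexE (B := eqn n (nsucc (nsucc (nsucc m))))) H _ => q l qp /sandP [/plus2P e /succP e'].
  exact: eqn_trans e' (succ_congr e).
apply: (sexI (t := nsucc (nsucc m))); apply/sandP; split; first exact/plus2P/eqn_refl.
exact/succP.
Qed.

Lemma memn_nat u n p :
  memn u (nnat n) p <-> dense (fun r => exists m, m < n /\ eqn u (nnat m) r) p.
Proof.
elim: n u p => [|n IH] u p.
  split=> [H|H]; first by case: (memn_empty H).
  have [r [_ [m []]]] := H p (le_refl p).
  by rewrite ltn0.
rewrite /= memn_succ; split=> H.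
  apply: dense_bind H _ => q qp [/IH|e].
    by apply: dense_imp => r _ [m [mn e]]; exists m; split=> //; apply: ltnW.
  by move=> r rq; exists r; split=> //; exists n; split=> //; apply: reg_mono e.
apply: dense_bind H _ => q qp [m [mn e]] r rq; exists r; split=> //.
move: mn; rewrite ltnS leq_eqVlt => /orP [/eqP E|mn]; [right|left].
  by rewrite -E; apply: reg_mono e.
apply/IH => s sr; exists s; split=> //; exists m; split=> //.
by apply: reg_mono e; apply: le_trans rq.
Qed.

Lemma nat_lt_mem m n p : m < n -> memn (nnat m) (nnat n) p.
Proof. by move=> mn; apply/memn_nat => q _; exists q; split=> //; exists m; split=> //; apply: eqn_refl. Qed.

(** Equality would put [k] into itself, hence make it equal to a smaller number: infinite
    descent. *)
Lemma nat_neq m k p : k < m -> ~ eqn (nnat m) (nnat k) p.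
Proof.
elim/ltn_ind: m k p => m IH k p km e.
have /memn_nat H : memn (nnat k) (nnat k) p by apply: (memn_eqr e); apply: nat_lt_mem.
by have [r [_ [j [jk e']]]] := H p (le_refl p); apply: (IH k km j r jk e').
Qed.

Lemma nat_inj m n p : eqn (nnat m) (nnat n) p -> m = n.
Proof.
move=> e; case: (ltngtP m n) => // l; first by case: (nat_neq l (eqn_sym e)).
by case: (nat_neq l e).
Qed.

Lemma nat_omega n p : memn (nnat n) nomega p.
Proof. by apply/memn_omega => q _; exists q; split=> //; exists n; apply: eqn_refl. Qed.

Lemma omega_case u p (B : Om) : Reg B -> memn u nomega p ->
  (forall q n, le q p -> eqn u (nnat n) q -> B q) -> B p.
Proof. by move=> rB /memn_omega H K; apply: denseE H _ => q qp [n e]; apply: K e. Qed.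

Definition nfun (D : nat -> Prop) (v : nat -> name) : name :=
  Nm nat (fun i => opair (nnat i) (v i)) (fun i _ => D i).

Lemma memn_nfun u D v p :
  memn u (nfun D v) p <-> dense (fun r => exists i, D i /\ eqn u (opair (nnat i) (v i)) r) p.
Proof.
split; apply: dense_imp => q qp [i [H e]]; exists i; split=> //; last by exists q.
by case: H => r [].
Qed.

Lemma nfun_at D v i p : D i -> memn (opair (nnat i) (v i)) (nfun D v) p.
Proof. by move=> Di; apply/memn_nfun => q _; exists q; split=> //; exists i; split=> //; apply: eqn_refl. Qed.

Lemma nfun_inv D v i y p : memn (opair (nnat i) y) (nfun D v) p -> eqn y (v i) p.
Proof.
move=> /memn_nfun H; apply: (denseE (B := eqn y (v i))) H _ => q qp [j [Dj /opair_inj [e e']]].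
by rewrite (nat_inj e).
Qed.

Lemma nfun_isfun D v d p :
  (forall u q, memn u d q <-> dense (fun r => exists i, D i /\ eqn u (nnat i) r) q) ->
  s_isfun (nfun D v) d p.
Proof.
move=> dE; apply/sandP; split=> u q qp.
  move=> /memn_nfun H; apply/bexP; apply: dense_imp H => r rq [i [Di e]].
  exists (nnat i); split.
    by apply/dE => s sr; exists s; split=> //; exists i; split=> //; apply: eqn_refl.
  by apply: (sexI (t := v i)); apply/pairP.
move=> /dE H; apply/sexP; apply: dense_imp H => r rq [i [Di e]]; exists (v i) => z.
apply/siffP => s sr; rewrite mapsP; have es : eqn u (nnat i) s by apply: reg_mono e.
split=> [m|ez].
  apply: (@nfun_inv D v i); apply: (memn_eql _ m); apply: opair_congr es _; exact: eqn_refl.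
apply: (memn_eql _ (@nfun_at D v i s Di)); apply: eqn_sym; exact: (opair_congr es ez).
Qed.

Lemma omega_dom u q : memn u nomega q <-> dense (fun r => exists i, True /\ eqn u (nnat i) r) q.
Proof. by rewrite memn_omega; split; apply: dense_imp => r _ [i H]; exists i => //; case: H. Qed.

Definition s_natsum s x y : Om :=
  sex (fun g => sand (s_isfun g nomega) (sand (sall (fun e => simp (s_empty e) (s_maps g e x)))
    (sand (s_ball nomega (fun i => sall (fun j => sall (fun a => sall (fun b =>
       simp (s_succ j i) (simp (s_maps g i a) (simp (s_succ b a) (s_maps g j b))))))))
    (s_maps g y s)))).
Definition s_modsum n z x y : Om :=
  sand (memn z n) (sex (fun s => sand (s_natsum s x y) (sor (eqn s z) (s_natsum s z n)))).

Global Instance Reg_natsum s x y : Reg (s_natsum s x y).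
Proof. by rewrite /s_natsum; exact _. Qed.
Global Instance Reg_modsum n z x y : Reg (s_modsum n z x y).
Proof. by rewrite /s_modsum; exact _. Qed.

Lemma natsum_nat a b s x y p : eqn x (nnat a) p -> eqn y (nnat b) p ->
  eqn s (nnat (a + b)) p -> s_natsum s x y p.
Proof.
move=> ex ey es; pose g := nfun (fun=> True) (fun i => nnat (a + i)).
have gd q : s_isfun g nomega q by apply: nfun_isfun; apply: omega_dom.
have atg i u v q : eqn u (nnat i) q -> eqn v (nnat (a + i)) q -> s_maps g u v q.
  move=> eu ev; apply/mapsP; apply: (memn_eql _ (@nfun_at (fun=> True) (fun i => nnat (a + i)) i q I)).
  by apply: eqn_sym; apply: opair_congr eu ev.
apply: (sexI (t := g)); do !(apply/sandP; split) => //.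
- move=> e q qp /emptyP ee; apply: (atg 0) => //; rewrite addn0; exact: reg_mono ex.
- move=> i q qp iw j c d r rq /succP ej s1 s1r /mapsP mi s2 s2s /succP ed.
  have iw' : memn i nomega s2 by apply: reg_mono iw; apply: le_trans (le_trans s2s s1r) rq.
  apply: (omega_case (B := s_maps g j d)) iw' _ => s3 n s3s ei.
  have mi' : memn (opair i c) g s3 by apply: reg_mono mi; apply: le_trans s2s.
  have ec : eqn c (nnat (a + n)) s3.
    apply: (@nfun_inv (fun=> True) (fun i => nnat (a + i)) n).
    by apply: (memn_eql _ mi'); apply: opair_congr ei (eqn_refl _ _).
  apply: (atg n.+1).
    apply: eqn_trans (succ_congr ei); apply: reg_mono ej.
    exact: le_trans s3s (le_trans s2s s1r).
  by rewrite addnS; apply: eqn_trans (succ_congr ec); apply: reg_mono ed.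
- exact: atg ey es.
Qed.

Lemma modsum_nat m a b n z x y p : a < m.+3 -> b < m.+3 -> eqn n (nnat m.+3) p ->
  eqn x (nnat a) p -> eqn y (nnat b) p ->
  eqn z (nnat (if a + b < m.+3 then a + b else a + b - m.+3)) p -> s_modsum n z x y p.
Proof.
move=> am bm en ex ey; set c := (if _ then _ else _) => ez.
have cm : c < m.+3.
  rewrite /c; case: (ltnP (a + b) m.+3) => // l.
  by rewrite ltn_subLR // -addSn leq_add // ltnW.
apply/sandP; split.
  by apply: (memn_eql (eqn_sym ez)); apply: (memn_eqr (eqn_sym en)); apply: nat_lt_mem.
apply: (sexI (t := nnat (a + b))); apply/sandP; split.
  exact: natsum_nat ex ey (eqn_refl _ _).
apply/sorP => q qp; exists q; split=> //; case: (ltnP (a + b) m.+3) => l; [left|right].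
  by apply: eqn_sym; rewrite /c l in ez; apply: reg_mono ez.
apply: (natsum_nat (a := c) (b := m.+3)); [exact: reg_mono ez | exact: reg_mono en |].
by rewrite /c ltnNge l /= subnK //; apply: eqn_refl.
Qed.

End Functions.

(** * Names for R', C_EK and their topologies *)

Section Spaces.

Implicit Types (u : name) (f : rname) (s : seq nat).

Definition takes z m v : Om := memn (opair (nnat m) (nnat v)) z.
Definition starts z s : Om := fun p => forall m, m < size s -> takes z m (nth 0 s m) p.

Global Instance Reg_takes z m v : Reg (takes z m v).
Proof. by rewrite /takes; exact _. Qed.
Global Instance Cong_takes m v : Cong (fun z => takes z m v).
Proof. by rewrite /takes; exact _. Qed.

Local Typeclasses Opaque takes starts.

Global Instance Reg_starts z s : Reg (starts z s).
Proof.
split=> [p q qp H m ms|p H m ms]; first by apply: reg_mono (H m ms).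
by apply: reg_dense; apply: dense_imp H => q qp; apply.
Qed.
Global Instance Cong_starts s : Cong (fun z => starts z s).
Proof. by move=> x y p e H m ms; apply: cong e (H m ms). Qed.

Lemma takes_mono z m v p q : le q p -> takes z m v p -> takes z m v q.
Proof. by move=> qp H; apply: reg_mono H. Qed.
Lemma starts_mono z s p q : le q p -> starts z s p -> starts z s q.
Proof. by move=> qp H; apply: reg_mono H. Qed.

Definition Rcond z : Om := sand (s_isfun z nomega) (s_ball nomega (fun m =>
  sall (fun n => sall (fun y => simp (s_plus3 n m) (simp (s_maps z m y) (memn y n)))))).

Global Instance Reg_Rcond z : Reg (Rcond z).
Proof. by rewrite /Rcond; exact _. Qed.
Global Instance Cong_isfun d : Cong (fun z => s_isfun z d).
Proof. by rewrite /s_isfun /s_maps /s_ball /s_bex; exact _. Qed.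
Global Instance Cong_maps x y : Cong (fun z => s_maps z x y).
Proof. by rewrite /s_maps /s_bex; exact _. Qed.
Global Instance Cong_Rcond : Cong Rcond.
Proof. by rewrite /Rcond /s_ball; exact _. Qed.

Local Typeclasses Opaque Rcond s_isfun s_maps s_plus2 s_plus3.

Lemma Rcond_bound z m y p : Rcond z p -> memn (opair (nnat m) y) z p -> memn y (nnat m.+3) p.
Proof.
move=> /sandP [_ H] /mapsP my; have mw : memn (nnat m) nomega p by apply: nat_omega.
apply: (H (nnat m) p (le_refl p) mw (nnat m.+3) y p (le_refl p) _ p (le_refl p) my).
by apply/plus3P/eqn_refl.
Qed.

Lemma Rcond_val z m y p : Rcond z p -> memn (opair (nnat m) y) z p ->
  dense (fun r => exists v, [/\ v < m.+3, eqn y (nnat v) r & takes z m v r]) p.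
Proof.
move=> Rz my; have /memn_nat H := Rcond_bound Rz my.
apply: dense_imp H => q qp [v [vm e]]; exists v; split=> //.
by apply: (memn_eql (opair_congr (eqn_refl _ _) e)); apply: reg_mono my.
Qed.

Lemma Rcond_total z m p : Rcond z p -> dense (fun r => exists v, v < m.+3 /\ takes z m v r) p.
Proof.
move=> Rz; have /sandP [fz _] := Rz.
have H : dense (fun r => exists y, memn (opair (nnat m) y) z r) p.
  by apply: (isfun_total fz); apply: nat_omega.
apply: dense_bind H _ => q qp [y my].
have Rq : Rcond z q by apply: reg_mono Rz.
by apply: dense_imp (Rcond_val Rq my) => r _ [v [a _ b]]; exists v.
Qed.

Lemma Rcond_uniq z m v w p : Rcond z p -> takes z m v p -> takes z m w p -> v = w.
Proof.
move=> /sandP [fz _] hv hw.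
have mw : memn (nnat m) nomega p by apply: nat_omega.
exact: nat_inj (isfun_uniq fz mw hv hw).
Qed.

Definition real_of z : rname := fun m v r => takes z m v r.

Lemma dec_real_of z r m v : dec (real_of z) r m v <-> takes z m v r.
Proof.
split=> [[q [rq H]]|H]; last by exists r.
exact: takes_mono rq H.
Qed.

Lemma real_of_real z p : Rcond z p -> isreal p (real_of z).
Proof.
move=> Rz; split=> [m|r m v w rp /dec_real_of hv /dec_real_of hw].
  by apply: dense_imp (Rcond_total m Rz) => q _ [v [vm hv]]; exists v; split=> //; apply/dec_real_of.
have Rr : Rcond z r by apply: reg_mono Rz.
exact: Rcond_uniq Rr hv hw.
Qed.

Definition nm f : name :=
  Nm (nat * nat) (fun c => opair (nnat c.1) (nnat c.2)) (fun c => f c.1 c.2).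

Lemma memn_nm u f p : memn u (nm f) p <->
  dense (fun r => exists m v, dec f r m v /\ eqn u (opair (nnat m) (nnat v)) r) p.
Proof.
split; apply: dense_imp => q qp; first by case=> -[m v] [d e]; exists m, v.
by case=> m [v [d e]]; exists (m, v).
Qed.

Lemma takes_nm f m v p : takes (nm f) m v p <-> dense (fun r => dec f r m v) p.
Proof.
rewrite /takes memn_nm; split; apply: dense_imp => q qp.
  move=> [m' [v' [d e]]]; have [e1 e2] := opair_inj e.
  by rewrite (nat_inj e1) (nat_inj e2).
by move=> d; exists m, v; split=> //; apply: eqn_refl.
Qed.

Lemma isreal_bound f m v p : isreal p f -> dec f p m v -> v < m.+3.
Proof.
move=> [H K] d; have [q [qp [w [wm dw]]]] := H m p (le_refl p).
by rewrite (K q m v w qp (dec_mono qp d) dw).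
Qed.

Lemma nm_Rcond f p : isreal p f -> Rcond (nm f) p.
Proof.
move=> rf; apply/sandP; split.
  apply/sandP; split=> u q qp.
    move=> /memn_nm H; apply/bexP; apply: dense_imp H => r rq [m [v [d e]]].
    exists (nnat m); split; first exact: nat_omega.
    by apply: (sexI (t := nnat v)); apply/pairP.
  move=> /memn_omega H; apply/sexP; apply: dense_bind H _ => r rq [m e].
  apply: dense_imp (proj1 (isreal_mono (le_trans rq qp) rf) m) => r' r'r [v [_ dv]].
  exists (nnat v) => z; apply/siffP => s sr; rewrite mapsP.
  have rs : isreal s f by apply: isreal_mono rf; apply: le_trans sr (le_trans r'r (le_trans rq qp)).
  have es : eqn u (nnat m) s by apply: reg_mono e; apply: le_trans r'r.
  have ds : dec f s m v by apply: dec_mono dv.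
  split=> [/memn_nm K|ez].
    apply: (denseE (B := eqn z (nnat v))) K _ => t ts [m' [v' [d' e']]]; have [e1 e2] := opair_inj e'.
    have E : m = m'.
      by apply: (@nat_inj _ _ t); apply: eqn_trans e1; apply: eqn_sym; apply: reg_mono es.
    subst m'; rewrite (proj2 rs t m v v') //; exact: dec_mono ds.
  apply/memn_nm => t ts; exists t; split=> //; exists m, v; split; first exact: dec_mono ds.
  by apply: opair_congr; [apply: reg_mono es | apply: reg_mono ez].
move=> u q qp uw n y r rq /plus3P en s sr /mapsP my.
have uw' : memn u nomega s by apply: reg_mono uw; apply: le_trans rq.
apply: (omega_case (B := memn y n)) uw' _ => t m ts eu.
have my' : memn (opair u y) (nm f) t by apply: reg_mono my.
move/memn_nm: my' => K; apply: (denseE (B := memn y n)) K _ => w wt [m' [v' [d' e']]]; have [e1 e2] := opair_inj e'.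
have E : m = m'.
  by apply: (@nat_inj _ _ w); apply: eqn_trans e1; apply: eqn_sym; apply: reg_mono eu.
subst m'; have ws : le w s by apply: le_trans ts.
have wp : le w p by apply: le_trans ws (le_trans sr (le_trans rq qp)).
have vm : v' < m.+3 by apply: (isreal_bound (isreal_mono wp rf) d').
apply: (memn_eql (eqn_sym e2)); apply: (memn_eqr (y := nnat m.+3)); last exact: nat_lt_mem.
apply: eqn_sym; apply: (eqn_trans (y := nsucc (nsucc (nsucc u)))).
  by apply: reg_mono en; apply: le_trans ws sr.
by do !apply: succ_congr; apply: reg_mono eu.
Qed.

Lemma Rcond_nm z p : Rcond z p -> eqn z (nm (real_of z)) p.
Proof.
move=> Rz; apply: eqn_ext => u q qp; have Rq : Rcond z q by apply: reg_mono Rz.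
split=> [uz|/memn_nm H]; last first.
  apply: (denseE (B := memn u z)) H _ => r rq [m [v [/dec_real_of h e]]].
  exact: memn_eql (eqn_sym e) h.
have /sandP [fz _] := Rq.
apply/memn_nm; apply: dense_bind (isfun_pair fz uz) _ => r rq [x [y [/memn_omega xw e]]].
apply: dense_bind xw _ => s sr [m ex].
have Rs : Rcond z s by apply: reg_mono Rq; apply: le_trans sr rq.
have my : memn (opair (nnat m) y) z s.
  apply: (memn_eql (x := u)); last by apply: reg_mono uz; apply: le_trans sr rq.
  apply: (eqn_trans (reg_mono sr e)); exact: opair_congr ex (eqn_refl _ _).
apply: dense_imp (Rcond_val Rs my) => t ts [v [_ ey h]]; exists m, v.
split; first exact/dec_real_of.
apply: (eqn_trans (reg_mono (le_trans ts sr) e)).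
by apply: opair_congr => //; apply: reg_mono ex.
Qed.

(** Every name forced into R' is equal to the nice name read off from it ([Rcond_nm]), so the type
    of nice names suffices as index type. *)
Definition nR : name := Nm (rname) nm (fun f p => isreal p f).

Lemma memn_R z p : memn z nR p <-> Rcond z p.
Proof.
split=> [H|Rz].
  apply: memn_elim H _ => q f qp [r [qr rf]] e; apply: (Cong_Rcond (eqn_sym e)).
  exact/nm_Rcond/(isreal_mono qr).
move=> q qp; exists q; split=> //; exists (real_of z).
have Rq : Rcond z q by apply: reg_mono Rz.
by split; [exists q; split=> //; apply: real_of_real | apply: Rcond_nm].
Qed.

Lemma decide_R z p n : memn z nR p ->
  dense (fun r => exists s, [/\ size s = n, stem s & starts z s r]) p.
Proof.
move=> /memn_R /real_of_real rf; apply: dense_imp (decide_upto n rf) => r _ [s [a b c]].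
by exists s; split=> // m ms; apply/dec_real_of/c.
Qed.

Lemma starts_uniq z s m v p : memn z nR p -> starts z s p -> m < size s -> takes z m v p ->
  v = nth 0 s m.
Proof. by move=> /memn_R Rz hs ms hv; apply: Rcond_uniq Rz hv (hs m ms). Qed.

Lemma starts_spref z s s' p : spref s s' -> starts z s' p -> starts z s p.
Proof. by move=> [l H] h m ms; rewrite H //; apply: h; apply: leq_trans l. Qed.

Definition Ccond z : Om := sand (s_isfun z nomega) (s_ball nomega (fun m =>
  sall (fun n => sall (fun k => sall (fun y => simp (s_plus3 n m) (simp (s_plus2 k m)
    (simp (s_maps z m y) (sand (memn y n) (snot (eqn y k)))))))))).

Definition off_top z : Om := sall (fun m : nat => snot (takes z m m.+2)).
Global Instance Reg_off_top z : Reg (off_top z).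
Proof. by rewrite /off_top; exact _. Qed.
Global Instance Cong_off_top : Cong off_top.
Proof. by rewrite /off_top; exact _. Qed.

Local Typeclasses Opaque off_top.

Definition nC : name := nsep nR off_top.

Lemma memn_C z p : memn z nC p <-> memn z nR p /\ off_top z p.
Proof. exact: memn_sep. Qed.

Lemma Ccond_C z p : memn z nC p <-> Ccond z p.
Proof.
rewrite memn_C memn_R; split=> [[Rz oz]|Cz].
  have /sandP [fz Hz] := Rz; apply/sandP; split=> //.
  move=> u q qp uw n k y r rq e3 s sr e2 t ts my.
  have tr : le t r by apply: le_trans sr.
  have tq : le t q by apply: le_trans rq.
  apply/sandP; split; first by apply: (Hz u q qp uw n y r rq e3 t tr my).
  move=> w wt eyk; have uw' : memn u nomega w by apply: reg_mono uw; apply: le_trans tq.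
  move/memn_omega: uw' => /(_ w (le_refl w)) [w' [w'w [m eu]]].
  apply: (oz m w'); first by apply: le_trans w'w (le_trans wt (le_trans tq qp)).
  move/mapsP: my => my; apply: (memn_eql (x := opair u y)).
    apply: opair_congr => //; apply: (eqn_trans (y := k)); first by apply: reg_mono eyk.
    move/plus2P: e2 => e2; apply: (eqn_trans (y := nsucc (nsucc u))).
      by apply: reg_mono e2; apply: le_trans w'w (le_trans wt ts).
    by do !apply: succ_congr.
  by apply: reg_mono my; apply: le_trans w'w wt.
have /sandP [fz Hz] := Cz.
have K u q n y r (s : P) : le q p -> memn u nomega q -> le r q -> s_plus3 n u r -> le s r ->
    s_maps z u y s -> memn y n s /\ forall k, s_plus2 k u s -> snot (eqn y k) s.
  move=> qp uw rq e3 sr my.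
  have H k t : le t s -> s_plus2 k u t -> memn y n t /\ snot (eqn y k) t.
    move=> ts e2; have tr : le t r by apply: le_trans sr.
    apply/sandP; apply: (Hz u q qp uw n k y r rq e3 t tr e2 t (le_refl t)).
    exact: reg_mono my.
  split; first by case: (H (nsucc (nsucc u)) s) => //; apply/plus2P/eqn_refl.
  by move=> k e2; case: (H k s).
split.
  apply/sandP; split=> // u q qp uw n y r rq e3 s sr my.
  by case: (K u q n y r s qp uw rq e3 sr my).
move=> m q qp h; have mw : memn (nnat m) nomega q by apply: nat_omega.
have e3 : s_plus3 (nnat m.+3) (nnat m) q by apply/plus3P/eqn_refl.
have e2 : s_plus2 (nnat m.+2) (nnat m) q by apply/plus2P/eqn_refl.
move/mapsP: h => h; have [_ H] := K _ q _ _ q q qp mw (le_refl q) e3 (le_refl q) h.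
apply: (H (nnat m.+2) e2 q (le_refl q)); exact: eqn_refl.
Qed.

Definition s_finite a : Om := s_bex nomega (fun n => sex (fun g => sand (s_isfun g n)
  (sall (fun x => siff (memn x a) (s_bex n (fun i => s_maps g i x)))))).
Definition Topen U : Om := s_ball U (fun x => sex (fun F => sand (s_subset F nomega)
  (sand (s_finite F) (s_ball nR (fun y =>
    simp (s_ball F (fun m => sall (fun k => simp (s_maps x m k) (s_maps y m k))))
      (memn y U)))))).
Global Instance Reg_finite a : Reg (s_finite a).
Proof. by rewrite /s_finite; exact _. Qed.
Global Instance Reg_Topen U : Reg (Topen U).
Proof. by rewrite /Topen; exact _. Qed.
Global Instance Cong_Topen : Cong Topen.
Proof. by rewrite /Topen /s_ball; exact _. Qed.

Definition nT : name := nsep (npow nR) Topen.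

Lemma memn_T U p : memn U nT p <-> s_subset U nR p /\ Topen U p.
Proof. by rewrite /nT memn_sep memn_pow. Qed.

Lemma finite_bound F p : s_subset F nomega p -> s_finite F p ->
  dense (fun r => exists N, forall m q, le q r -> memn (nnat m) F q -> m < N) p.
Proof.
move=> Fw /bexP Ff; apply: dense_bind Ff _ => q qp [n [/memn_omega nw /sexP Hn]].
apply: dense_bind nw _ => q1 q1q [k ek].
apply: dense_bind (dense_mono q1q Hn) _ => q2 q21 [g /sandP [gn gF]].
have q2p : le q2 p by apply: le_trans q21 (le_trans q1q qp).
have ek2 : eqn n (nnat k) q2 by apply: reg_mono ek.
(* A bound for all members comes from bounding the values of the enumeration [g] at arguments below
   [j], by induction on [j]: each further value is decided densely. *)
suff H j : j <= k -> dense (fun r => exists N, forall i m q, i < j -> le q r ->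
    memn (opair (nnat i) (nnat m)) g q -> m < N) q2.
  apply: dense_imp (H k (leqnn k)) => r rq2 [N HN]; exists N => m s sr mF.
  have sq2 : le s q2 by apply: le_trans rq2.
  have /siffP /(_ s sq2) [/(_ mF) /bexP /(_ s (le_refl s)) [t [ts [i [iN /mapsP mi]]]] _] := gF (nnat m).
  have : memn i (nnat k) t by apply: memn_eqr iN; apply: reg_mono ek2; apply: le_trans sq2.
  move=> /memn_nat /(_ t (le_refl t)) [w [wt [i0 [i0k ei]]]].
  apply: (HN i0 m w i0k); first by apply: le_trans wt (le_trans ts sr).
  by apply: (memn_eql (opair_congr ei (eqn_refl _ _))); apply: reg_mono mi.
elim: j => [|j IH] jk; first by move=> r rq; exists r; split=> //; exists 0.
have IH' := IH (ltnW jk); apply: (dense_bind IH') => r rq2 [N HN].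
have jn : memn (nnat j) n r.
  by apply: (memn_eqr (eqn_sym (reg_mono rq2 ek2))); apply: nat_lt_mem.
have gn' : s_isfun g n r by apply: reg_mono gn.
apply: dense_bind (isfun_total gn' jn) _ => s sr [y my].
have sq2 : le s q2 by apply: le_trans rq2.
have yF : memn y F s.
  have /siffP /(_ s sq2) [_] := gF y; apply; apply: (bexI (x := nnat j)).
    exact: reg_mono jn.
  exact/mapsP.
have sp : le s p by apply: le_trans sq2 q2p.
have /memn_omega yw := Fw y s sp yF.
apply: dense_imp yw => t ts [m0 e0]; exists (maxn N m0.+1) => i m w.
rewrite ltnS leq_eqVlt => /orP [/eqP -> wt mi|ij wt mi]; last first.
  by rewrite leq_max (HN i m w ij) //; apply: le_trans wt (le_trans ts sr).
have wr : le w r by apply: le_trans wt (le_trans ts sr).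
suff -> : m = m0 by rewrite leq_max leqnn orbT.
apply: (@nat_inj _ _ w); apply: eqn_trans (reg_mono wt e0).
apply: (isfun_uniq (reg_mono wr gn') (reg_mono wr jn) mi).
by apply: reg_mono my; apply: le_trans wt ts.
Qed.

Lemma nat_finite n p : s_finite (nnat n) p.
Proof.
pose g : name := nfun (fun i => i < n) nnat.
apply: (bexI (x := nnat n)); first exact: nat_omega.
apply: (sexI (t := g)); apply/sandP; split; first by apply: nfun_isfun => u q; apply: memn_nat.
move=> x; apply/siffP => q qp; rewrite bexP; split=> [/memn_nat H|H].
  apply: dense_imp H => r rq [m [mn e]]; exists (nnat m); split; first exact: nat_lt_mem.
  apply/mapsP; apply: (memn_eql (x := opair (nnat m) (nnat m))); last exact: nfun_at.
  by apply: opair_congr; [apply: eqn_refl | apply: eqn_sym].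
apply: (denseE (B := memn x (nnat n))) H _ => r rq [i [/memn_nat iN /mapsP mi]].
apply: (denseE (B := memn x (nnat n))) iN _ => s sr [m [mn e]].
apply: (memn_eql (x := nnat m)); last exact: nat_lt_mem.
apply: eqn_sym; apply: (@nfun_inv (fun i => i < n) nnat m).
by apply: (memn_eql (opair_congr e (eqn_refl _ _))); apply: reg_mono mi.
Qed.

Lemma open_T U z p : memn U nT p -> memn z U p -> dense (fun r => exists s,
  [/\ stem s, starts z s r & forall y q, le q r -> memn y nR q -> starts y s q -> memn y U q]) p.
Proof.
move=> /memn_T [UR oU] zU; have zR : memn z nR p by apply: UR.
have pp : le p p by [].
have /sexP Hz := oU z p pp zU.
apply: dense_bind Hz _ => q qp [F /sandP [Fw /sandP [Ff HU]]].
apply: dense_bind (finite_bound Fw Ff) _ => r rq [N HN].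
have rp : le r p by apply: le_trans qp.
have zr : memn z nR r by apply: reg_mono zR.
apply: dense_imp (decide_R N zr) => t tr [s [sN ss hs]]; exists s; split=> // y w wt yR hy.
have wr : le w r by apply: le_trans tr.
have wq : le w q by apply: le_trans wr rq.
apply: (HU y w wq yR w (le_refl w)) => m w1 w1w mF k w2 w21 /mapsP mk; apply/mapsP.
have w2w : le w2 w by apply: le_trans w1w.
have w1q : le w1 q by apply: le_trans wq.
have /memn_omega mw := Fw m w1 w1q mF.
apply: (denseE (B := memn (opair m k) y)) (dense_mono w21 mw) _ => w3 w32 [i ei].
have w3r : le w3 r by apply: le_trans w32 (le_trans w2w wr).
have w3w1 : le w3 w1 by apply: le_trans w21.
have iN : i < N by apply: (HN i w3) => //; apply: (memn_eql ei); apply: reg_mono mF.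
have Rz : Rcond z w3 by apply/memn_R; apply: reg_mono zr.
have mk' : memn (opair (nnat i) k) z w3.
  by apply: (memn_eql (opair_congr ei (eqn_refl _ _))); apply: reg_mono mk.
apply: (denseE (B := memn (opair m k) y)) (Rcond_val Rz mk') _ => w4 w43 [v [_ ek hv]].
have w4r : le w4 r by apply: le_trans w43 w3r.
have w4t : le w4 t by apply: le_trans w43 (le_trans w32 (le_trans w2w wt)).
have Ev : v = nth 0 s i.
  by apply: (starts_uniq (z := z) (p := w4)); [apply: reg_mono zr | apply: starts_mono hs | rewrite sN |].
apply: (memn_eql (x := opair (nnat i) (nnat v))).
  by apply: opair_congr; apply: eqn_sym => //; apply: reg_mono ei.
rewrite Ev; apply: (takes_mono _ (hy i _)); last by rewrite sN.
exact: le_trans w43 (le_trans w32 w2w).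
Qed.

Definition nball s : name := nsep nR (fun z => starts z s).

Lemma memn_ball z s p : memn z (nball s) p <-> memn z nR p /\ starts z s p.
Proof. exact: memn_sep. Qed.

Lemma ball_T s p : memn (nball s) nT p.
Proof.
apply/memn_T; split; first by move=> z q qp /memn_ball [].
move=> z q qp /memn_ball [zR hz]; apply: (sexI (t := nnat (size s))).
apply/sandP; split.
  move=> u r rq /memn_nat H; apply/memn_omega; apply: dense_imp H => t _ [m [_ e]].
  by exists m.
apply/sandP; split; first exact: nat_finite.
move=> y r rq yR t tr H; apply/memn_ball; split; first exact: reg_mono yR.
move=> m ms; apply/mapsP; have tt : le t t by [].
have mm : memn (nnat m) (nnat (size s)) t by exact: nat_lt_mem.
apply: (H _ t tt mm _ t tt).
by apply/mapsP; apply: takes_mono (hz m ms); apply: le_trans rq.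
Qed.

Definition nS : name := nsep (npow nC) (fun V => s_bex nT (fun U => s_inter V U nC)).

Global Instance Cong_inter a b : Cong (fun c => s_inter c a b).
Proof. by rewrite /s_inter; exact _. Qed.
Global Instance Cong_bexf a (F : name -> name -> Om) :
  (forall x, Cong (fun z => F z x)) -> Cong (fun z => s_bex a (F z)).
Proof. by move=> cF; rewrite /s_bex; exact _. Qed.

Lemma memn_S V p : memn V nS p <-> s_bex nT (fun U => s_inter V U nC) p.
Proof.
rewrite /nS memn_sep memn_pow; split=> [[] //|H]; split=> // u q qp uV.
apply: (bexE (B := memn u nC)) (reg_mono qp H) _ => r U rq _ K.
have rr : le r r by []. have /siffP /(_ r rr) [K1 _] := K u.
have uV' : memn u V r by apply: reg_mono uV.
by have /sandP [] := K1 uV'.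
Qed.

Definition nballC s : name := nsep nC (fun z => starts z s).

Lemma memn_ballC z s p : memn z (nballC s) p <-> memn z nC p /\ starts z s p.
Proof. exact: memn_sep. Qed.

Lemma ball_S s p : memn (nballC s) nS p.
Proof.
apply/memn_S; apply: (bexI (x := nball s)); first exact: ball_T.
move=> u; apply/siffP => q qp; rewrite sandP memn_ball memn_ballC memn_C.
by split=> [[[]]|[[]]].
Qed.

Lemma open_S V z p : memn V nS p -> memn z V p -> dense (fun r => exists s,
  [/\ stem s, starts z s r & forall y q, le q r -> memn y nC q -> starts y s q -> memn y V q]) p.
Proof.
move=> /memn_S /bexP H zV; apply: dense_bind H _ => q qp [U [UT K]].
have qq : le q q by []. have /siffP /(_ q qq) [K1 _] := K z.
have zV' : memn z V q by apply: reg_mono zV.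
have /sandP [zU zC] := K1 zV'.
apply: dense_imp (open_T UT zU) => r rq [s [ss hs Hs]]; exists s; split=> // y t tr yC hy.
have tq : le t q by apply: le_trans rq.
have /siffP /(_ t tq) [_ K2] := K y; apply: K2; apply/sandP; split=> //.
by apply: Hs => //; have /memn_C [] := yC.
Qed.

(** The ground model real continuing [s] by zeros. As 0 is never the excluded value m+2, it lies in
    [C_EK] as soon as [s] permits. *)
Definition cst s : rname := fun m v _ => v = nth 0 s m.

Lemma dec_cst s r m v : dec (cst s) r m v <-> v = nth 0 s m.
Proof. by split=> [[q []]|E] //; exists r. Qed.

Lemma cst_real s p : stem s -> isreal p (cst s).
Proof.
move=> ss; split=> [m q qp|r m v w _ /dec_cst -> /dec_cst -> //].
exists q; split=> //; exists (nth 0 s m); split; last exact/dec_cst.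
by case: (ltnP m (size s)) => [/ss //|l]; rewrite nth_default.
Qed.

Lemma cst_R s p : stem s -> memn (nm (cst s)) nR p.
Proof. by move=> ss; apply/memn_R/nm_Rcond/cst_real. Qed.

Lemma cst_starts s p : starts (nm (cst s)) s p.
Proof. by move=> m ms; apply/takes_nm => q qp; exists q; split=> //; apply/dec_cst. Qed.

Lemma cst_C s p : stem s -> (forall m, m < size s -> nth 0 s m <> m.+2) -> memn (nm (cst s)) nC p.
Proof.
move=> ss H; apply/memn_C; split; first exact: cst_R.
move=> m q qp /takes_nm /(_ q (le_refl q)) [r [_ /dec_cst E]].
case: (ltnP m (size s)) => [/H|l]; first by rewrite -E.
by rewrite nth_default in E.
Qed.

End Spaces.

(** * What a failure of the statement means for conditions *)

Section Failure.

Implicit Types (u t X Y T N : name) (f : rname) (s : seq nat).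

Local Typeclasses Opaque s_bex s_ball s_disjoint s_subset s_inter s_empty
  s_isfun s_maps s_plus3 s_modsum starts.

Definition s_closure Y T B A : Om := sall (fun x => siff (memn x B) (sand (memn x Y)
  (s_ball T (fun U => simp (memn x U) (snot (s_disjoint U A)))))).
Definition s_nowhere Y T A : Om := sand (s_subset A Y) (sex (fun B =>
  sand (s_closure Y T B A) (s_ball T (fun U => simp (s_subset U B) (s_empty U))))).
Definition s_meagre w Y T A : Om := sex (fun N => sand (s_isfun N w)
  (sand (s_ball w (fun i => sall (fun B => simp (s_maps N i B) (s_nowhere Y T B))))
    (sall (fun x => siff (memn x A)
      (s_bex w (fun i => sex (fun B => sand (s_maps N i B) (memn x B)))))))).
Definition s_sum z x y : Om := sand (memn z nR) (s_ball nomega (fun m => sall (fun n =>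
  sall (fun a => sall (fun b => sall (fun c => simp (s_plus3 n m) (simp (s_maps x m a)
    (simp (s_maps y m b) (simp (s_maps z m c) (s_modsum n c a b)))))))))).
Definition s_translate Y X t : Om :=
  sall (fun z => siff (memn z Y) (s_bex X (fun x => s_sum z x t))).

Local Typeclasses Opaque s_closure s_nowhere s_meagre s_sum s_translate.
Global Instance Reg_closure Y T B A : Reg (s_closure Y T B A).
Proof. by rewrite /s_closure; exact _. Qed.
Global Instance Reg_nowhere Y T A : Reg (s_nowhere Y T A).
Proof. by rewrite /s_nowhere; exact _. Qed.
Global Instance Reg_meagre w Y T A : Reg (s_meagre w Y T A).
Proof. by rewrite /s_meagre; exact _. Qed.
Global Instance Reg_sum z x y : Reg (s_sum z x y).
Proof. by rewrite /s_sum; exact _. Qed.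
Global Instance Reg_translate Y X t : Reg (s_translate Y X t).
Proof. by rewrite /s_translate; exact _. Qed.
Global Instance Cong_sum x y : Cong (fun z => s_sum z x y).
Proof. by rewrite /s_sum /s_ball; exact _. Qed.
Global Instance Cong_nowhere Y T : Cong (fun A => s_nowhere Y T A).
Proof.
by rewrite /s_nowhere /s_closure /s_ball /s_subset /s_disjoint /s_bex; exact _.
Qed.

Lemma omega_least a p : s_ind a p -> s_subset nomega a p.
Proof.
move=> /sandP [H0 HS]; suff K n q : le q p -> memn (nnat n) a q.
  move=> u q qp uw; apply: (omega_case (B := memn u a)) uw _ => r n rq e.
  apply: (memn_eql (eqn_sym e)); apply: K; exact: le_trans qp.
elim: n q => [|n IH] q qp.
  apply: (bexE (B := memn (nnat 0) a)) (reg_mono qp H0) _ => r x rq xa /emptyP e.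
  exact: memn_eql e xa.
apply: (bexE (B := memn (nnat n.+1) a)) (HS (nnat n) q qp (IH q qp)) _ => r x rq xa /succP e.
exact: memn_eql e xa.
Qed.

Local Typeclasses Opaque s_closure s_nowhere s_meagre s_sum s_translate.

Lemma force_ex rho F n : force rho (fex F n) = sex (fun a => force (scons a rho) (F n n.+1)).
Proof. reflexivity. Qed.

Lemma force_conj rho (A B : fm) n :
  force rho (fconj A B n) = sand (force rho (A n)) (force rho (B n)).
Proof. reflexivity. Qed.

Definition Psi X : Om := simp (s_subset X nR) (simp (snot (s_meagre nomega nR nT X))
  (s_bex nR (fun t => sex (fun Y => sex (fun D => sand (s_translate Y X t)
    (sand (s_inter D nC Y) (snot (s_meagre nomega nC nS D)))))))).

Lemma force_phi rho p : (forall X, Psi X p) -> force rho (phi 0) p.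
Proof.
move=> H; rewrite /phi force_ex; apply: (sexI (t := nomega)); cbv beta.
rewrite force_ex; apply: (sexI (t := nR)); cbv beta.
rewrite force_ex; apply: (sexI (t := nC)); cbv beta.
rewrite force_ex; apply: (sexI (t := nT)); cbv beta.
rewrite force_ex; apply: (sexI (t := nS)); cbv beta.
rewrite force_conj; apply/sandP; split.
  rewrite -[force _ _]/(sand (s_ind nomega) (sall (fun a => simp (s_ind a) (s_subset nomega a)))).
  by apply/sandP; split; [apply: omega_ind | move=> a q _; apply: omega_least].
rewrite force_conj; apply/sandP; split.
  rewrite -[force _ _]/(sall (fun f : name => siff (memn f nR) (Rcond f))) => f.
  by apply/siffP => q _; apply: memn_R.
rewrite force_conj; apply/sandP; split.
  rewrite -[force _ _]/(sall (fun f : name => siff (memn f nC) (Ccond f))) => f.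
  by apply/siffP => q _; apply: Ccond_C.
rewrite force_conj; apply/sandP; split.
  rewrite -[force _ _]/(sall (fun U => siff (memn U nT) (sand (s_subset U nR) (Topen U)))) => U.
  by apply/siffP => q _; rewrite sandP; apply: memn_T.
rewrite force_conj; apply/sandP; split; last exact: H.
rewrite -[force _ _]/(sall (fun V => siff (memn V nS) (s_bex nT (fun U => s_inter V U nC)))) => V.
by apply/siffP => q _; apply: memn_S.
Qed.

Definition s_counter X p := [/\ s_subset X nR p, snot (s_meagre nomega nR nT X) p &
  forall t Y D r, le r p -> memn t nR r -> s_translate Y X t r -> s_inter D nC Y r ->
    s_meagre nomega nC nS D r].

Lemma not_phi rho p : force rho (fnot phi 0) p -> exists q X, le q p /\ s_counter X q.
Proof.
move=> H; have pp : le p p by [].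
have [X nX] : exists X, ~ Psi X p.
  apply: contrapT => n; apply: (H p pp); apply: force_phi => X.
  by apply: contrapT => nX; apply: n; exists X.
apply: contrapT => n; apply: nX => q qp XR r rq nm.
apply: contrapT => nb; have [q' [q'r nb']] := regular _ nb.
apply: n; exists q', X; split; first exact: le_trans q'r (le_trans rq qp).
split; [exact: reg_mono (reg_mono rq XR) | exact: reg_mono nm |].
move=> t Y D s sq' tR tY tD; apply: snotnot => s' s's nmeag.
apply: (nb' s'); first exact: le_trans sq'.
apply: (bexI (x := t)); first exact: reg_mono tR.
apply: (sexI (t := Y)); apply: (sexI (t := D)); apply/sandP; split; first exact: reg_mono tY.
by apply/sandP; split; first exact: reg_mono tD.
Qed.

End Failure.

(** * Non-meagreness in terms of dense open sets of conditions *)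

Section Counterexample.

Implicit Types (u t X Y T N : name) (f : rname) (s : seq nat).

Local Typeclasses Opaque s_bex s_ball s_disjoint s_subset s_inter s_empty
  s_isfun s_maps s_plus3 s_modsum starts.
Local Typeclasses Opaque s_closure s_nowhere s_meagre s_sum s_translate.

Lemma nowhereI Y T A p : s_subset A Y p ->
  (forall W u q, le q p -> memn W T q -> memn u W q -> exists r y V, [/\ le r q,
     memn V T r, memn y V r, memn y W r & forall z r', le r' r -> memn z V r' -> ~ memn z A r']) ->
  s_nowhere Y T A p.
Proof.
move=> AY H; pose F x := s_ball T (fun U => simp (memn x U) (snot (s_disjoint U A))).
have rF x : Reg (F x) by rewrite /F; exact _.
have cF : Cong F by rewrite /F /s_ball; exact _.
apply/sandP; split=> //; apply: (sexI (t := nsep Y F)); apply/sandP; split.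
  by move=> x; apply/siffP => q qp; rewrite memn_sep sandP.
move=> W q qp WT r rq WC u s sr uW.
have sp : le s p by apply: le_trans sr (le_trans rq qp).
have WTs : memn W T s by apply: reg_mono WT; apply: le_trans rq.
have [s1 [y [V [s1s VT yV yW HV]]]] := H W u s sp WTs uW.
have s1r : le s1 r by apply: le_trans sr.
have /memn_sep [_ Fy] := WC y s1 s1r yW.
have s11 : le s1 s1 by [].
apply: (Fy V s1 s11 VT s1 s11 yV s1 s11) => s2 s21 /bexP K.
have [s3 [s32 [z [zV zA]]]] := K s2 (le_refl s2).
exact: (HV z s3 (le_trans s32 s21) zV zA).
Qed.

Lemma nowhereE Y T A V v p : s_nowhere Y T A p -> memn V T p -> memn v V p ->
  s_subset V Y p -> exists r W y, [/\ le r p, memn W T r, memn y W r, memn y V r &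
    forall z r', le r' r -> memn z W r' -> ~ memn z A r'].
Proof.
move=> /sandP [_ /sexP H] VT vV VY; have pp : le p p by [].
have [q [qp [B /sandP [CB HB]]]] := H p pp.
have qq : le q q by [].
have nVB : ~ s_subset V B q.
  move=> VB; apply: (HB V q qq _ q qq VB v q qq); first exact: reg_mono VT.
  exact: reg_mono vV.
have [y [q1 [q1q [yV nyB]]]] : exists y q1, le q1 q /\ memn y V q1 /\ ~ memn y B q1.
  apply: contrapT => n; apply: nVB => y q1 q1q yV; apply: contrapT => nyB; apply: n.
  by exists y, q1.
have q1p : le q1 p by apply: le_trans qp.
have yY : memn y Y q1 by apply: (VY y q1 q1p yV).
have /siffP /(_ q1 q1q) [_ K] := CB y.
have [W [q2 [q2q1 [WT nW]]]] : exists W q2, le q2 q1 /\ memn W T q2 /\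
    ~ simp (memn y W) (snot (s_disjoint W A)) q2.
  apply: contrapT => n; apply: nyB; apply: K; apply/sandP; split=> //.
  move=> W q2 q2q1 WT; apply: contrapT => nW; apply: n; by exists W, q2.
have [q3 [q32 [yW nd]]] : exists q3, le q3 q2 /\ memn y W q3 /\ ~ snot (s_disjoint W A) q3.
  apply: contrapT => n; apply: nW => q3 q32 yW; apply: contrapT => nd; apply: n.
  by exists q3.
have [q4 [q43 d]] := not_snot nd.
have q42 : le q4 q2 by apply: le_trans q32.
exists q4, W, y; split.
- exact: le_trans q42 (le_trans q2q1 q1p).
- exact: reg_mono WT.
- exact: reg_mono yW.
- by apply: reg_mono yV; apply: le_trans q2q1.
- move=> z r' r'q4 zW zA; apply: (d r' r'q4); exact: bexI zW zA.
Qed.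

Definition inX X p f := exists x, memn x X p /\
  forall r m v, le r p -> (dec f r m v <-> takes x m v r).

Lemma inX_mono X q q' f : le q' q -> inX X q f -> inX X q' f.
Proof.
move=> q'q [x [xX H]]; exists x; split; first exact: reg_mono xX.
by move=> r m v rq'; apply: H; apply: le_trans q'q.
Qed.

Section Category.

Variables (U : nat -> P -> seq nat -> Prop) (X : name) (q : P).
Hypotheses (oU : opens U) (dU : dense_past U q [::]) (XR : s_subset X nR q).

Let E i x : Om := dense (fun r => exists s, starts x s r /\ U i r s).
Let B i := nsep X (fun x => snot (E i x)).

Local Instance Reg_E i x : Reg (E i x).
Proof. by rewrite /E; exact _. Qed.
Local Instance Cong_E i : Cong (E i).
Proof.
move=> x y p e; apply: dense_imp => r rp [s [h u]]; exists s; split=> //.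
by apply: Cong_starts h; apply: reg_mono e.
Qed.

Local Typeclasses Opaque E.

Lemma memn_B i x p : memn x (B i) p <-> memn x X p /\ snot (E i x) p.
Proof. exact: memn_sep. Qed.

Lemma nowhere_B i r : le r q -> s_nowhere nR nT (B i) r.
Proof.
move=> rq; apply: nowhereI.
  move=> u s sr /memn_B [uX _]; apply: (XR _ uX); exact: le_trans rq.
move=> W u s sr WT uW; have ss : le s s by [].
have [s1 [s1s [s0 [st0 hu HW]]]] := open_T WT uW ss.
have s1q : le s1 q by apply: le_trans s1s (le_trans sr rq).
have [r' [s' [r's1 s0s' st' Us']]] := dU i s1q st0 (conj (leq0n _) (fun m (h : m < 0) => False_ind _ (notF h))).
exists r', (nm (cst s')), (nball s'); split.
- exact: le_trans r's1 s1s.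
- exact: ball_T.
- by apply/memn_ball; split; [apply: cst_R | apply: cst_starts].
- apply: HW => //; first exact: cst_R.
  by apply: starts_spref s0s' _; apply: cst_starts.
- move=> z r2 r2r' /memn_ball [zR hz] /memn_B [_ nE].
  apply: (nE r2) => //; move=> r3 r32; exists r3; split=> //; exists s'.
  split; first exact: starts_mono hz.
  by apply: oU Us'; apply: le_trans r2r'.
Qed.

(** The Baire category argument inside forcing: [B i] collects the points of [X] that never enter
    the [i]-th open set and is nowhere dense by density of that set. If no point enters all of them,
    the [B i] cover [X]. *)
Lemma category : s_meagre nomega nR nT X q \/
  exists q' f, [/\ le q' q, isreal q' f, inX X q' f & enters U q' f].
Proof.
have [n|C] := lem (exists q' f, [/\ le q' q, isreal q' f, inX X q' f & enters U q' f]).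
  by right.
left; pose N : name := nfun (fun=> True) B.
apply: (sexI (t := N)); apply/sandP; split.
  by apply: nfun_isfun; apply: omega_dom.
apply/sandP; split.
  move=> i r rq iw B' r2 r2r mB.
  have iw' : memn i nomega r2 by apply: reg_mono iw.
  apply: (omega_case (B := s_nowhere nR nT B')) iw' _ => r3 k r32 ek.
  have mB' : memn (opair i B') N r3 by apply/mapsP; apply: reg_mono mB.
  have e : eqn B' (B k) r3.
    apply: (@nfun_inv (fun=> True) B k).
    exact: (memn_eql (opair_congr ek (eqn_refl _ _)) mB').
  apply: (Cong_nowhere (eqn_sym e)); apply: nowhere_B.
  by apply: le_trans r32 (le_trans r2r rq).
move=> x; apply/siffP => r rq; split=> [xX|].
  apply: contrapT => ng; have [r1 [r1r n1]] := regular _ ng.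
  have r1q : le r1 q by apply: le_trans rq.
  have xX1 : memn x X r1 by apply: reg_mono xX.
  have Ex i : E i x r1.
    apply: snotnot => r2 r21 nE; apply: (n1 r2 r21); apply: (bexI (x := nnat i)).
      exact: nat_omega.
    apply: (sexI (t := B i)); apply/sandP; split.
      by apply/mapsP; apply: nfun_at.
    by apply/memn_B; split=> //; apply: reg_mono xX1.
  apply: C; exists r1, (real_of x); split=> //.
  - have xR : memn x nR r1 := XR r1q xX1.
    by apply: real_of_real; move/memn_R: xR.
  - by exists x; split=> // r2 m v _; apply: dec_real_of.
  - move=> i; apply: dense_imp (Ex i) => r2 r21 [s [hs us]]; exists s; split=> //.
    by move=> m ms; apply/dec_real_of; apply: hs.
move=> /bexP H; apply: (denseE (B := memn x X)) H _ => r1 r1r [i [iw /sexP H]].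
apply: (denseE (B := memn x X)) H _ => r2 r21 [B' /sandP [/mapsP mB xB]].
have iw' : memn i nomega r2 by apply: reg_mono iw.
apply: (omega_case (B := memn x X)) iw' _ => r3 k r32 ek.
have mB' : memn (opair i B') N r3 by apply: reg_mono mB.
have e : eqn B' (B k) r3.
  apply: (@nfun_inv (fun=> True) B k).
  exact: (memn_eql (opair_congr ek (eqn_refl _ _)) mB').
have xB' : memn x B' r3 by apply: reg_mono xB.
have xBk : memn x (B k) r3 by exact: (memn_eqr e xB').
by have [] := proj1 (memn_B k x r3) xBk.
Qed.

End Category.

Lemma counter_nonmeagre X q0 : s_counter X q0 -> nonmeagre_at (inX X) q0.
Proof.
move=> [XR nm _] q U qq0 oU dU.
have XRq : s_subset X nR q by apply: reg_mono XR.
by have [m|//] := category oU dU XRq; case: (nm q qq0 m).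
Qed.

End Counterexample.

(** * Addition modulo m+3 and the trace of a translate on C_EK *)

Definition madd m a b := if a + b < m.+3 then a + b else a + b - m.+3.
Definition mdif m c b := if b <= c then c - b else c + m.+3 - b.

Lemma madd_lt m a b : a < m.+3 -> b < m.+3 -> madd m a b < m.+3.
Proof. by rewrite /madd; case: ifP; lia. Qed.
Lemma madd_top m a b : a < m.+3 -> b < m.+3 -> a + b <> m.+2 -> madd m a b <> m.+2.
Proof. by rewrite /madd; case: ifP; lia. Qed.
Lemma mdif_lt m c b : c < m.+3 -> b < m.+3 -> mdif m c b < m.+3.
Proof. by rewrite /mdif; case: ifP; lia. Qed.
Lemma maddK m a b : a < m.+3 -> b < m.+3 -> mdif m (madd m a b) b = a.
Proof. by rewrite /mdif /madd; case: ifP; case: ifP; lia. Qed.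
Lemma mdifK m c b : c < m.+3 -> b < m.+3 -> madd m (mdif m c b) b = c.
Proof. by rewrite /mdif /madd; case: ifP; case: ifP; lia. Qed.
Lemma mdif_avoid m c b : c < m.+3 -> b < m.+3 -> c <> m.+2 -> mdif m c b + b <> m.+2.
Proof. by rewrite /mdif; case: ifP; lia. Qed.

Definition mwise (op : nat -> nat -> nat -> nat) s s' :=
  mkseq (fun m => op m (nth 0 s m) (nth 0 s' m)) (size s).

Lemma size_mwise op s s' : size (mwise op s s') = size s.
Proof. exact: size_mkseq. Qed.
Lemma nth_mwise op s s' m : m < size s ->
  nth 0 (mwise op s s') m = op m (nth 0 s m) (nth 0 s' m).
Proof. exact: nth_mkseq. Qed.

Section Counterexample.

Implicit Types (u t X Y T N : name) (f : rname) (s : seq nat).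

Local Typeclasses Opaque s_bex s_ball s_disjoint s_subset s_inter s_empty
  s_isfun s_maps s_plus3 s_modsum starts.
Local Typeclasses Opaque s_closure s_nowhere s_meagre s_sum s_translate.

Section Trace.

Variables (X N : name) (t : rname) (q : P).
Hypotheses (rt : isreal q t) (XR : s_subset X nR q) (fN : s_isfun N nomega q).
Hypothesis ndN : s_ball nomega (fun i => sall (fun B =>
  simp (s_maps N i B) (s_nowhere nC nS B))) q.

(** A set of reals to be entered: once [t] is decided as far as [s] reaches, the ball around the sum
    of [s] and [t] misses the [k]-th nowhere dense set. A real entering all these sets is moved by
    [t] outside their union. *)
Definition Bad k r s := exists sg, [/\ size sg = size s, decs t r sg &
  forall B y r', le r' r -> memn (opair (nnat k) B) N r' -> memn y B r' ->
    ~ starts y (mwise madd s sg) r'].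

Lemma opens_Bad : opens Bad.
Proof.
move=> i r r' s r'r [sg [e d H]]; exists sg; split=> //; first exact: decs_mono d.
by move=> B y r2 r2r'; apply: H; apply: le_trans r'r.
Qed.

(** Adding the decided part of [t] to [s] gives a ball of [C_EK]. Nowhere density provides an open
    set inside it that misses the [k]-th set; a point there and [t] are decided far enough, and
    their difference is the extension of [s]. *)
Lemma dense_Bad k r s : le r q -> stem s -> avoids r t s ->
  exists r' s', [/\ le r' r, spref s s', stem s', avoids r' t s' & Bad k r' s'].
Proof.
move=> rq ss av; have rr : le r r by [].
have rtr : isreal r t by apply: isreal_mono rt.
have [r1 [r1r [sg [es ssg dsg]]]] := decide_upto (size s) rtr rr.
have r1q : le r1 q by apply: le_trans rq.
pose rho := mwise madd s sg.
have srho : stem rho.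
  move=> m; rewrite size_mwise => ms; rewrite nth_mwise //; apply: madd_lt; first exact: ss.
  by apply: ssg; rewrite es.
have toprho m : m < size rho -> nth 0 rho m <> m.+2.
  rewrite size_mwise => ms; rewrite nth_mwise //; apply: madd_top; first exact: ss.
    by apply: ssg; rewrite es.
  by apply: (av r1 m _ r1r ms); apply: dsg; rewrite es.
have kw : memn (nnat k) nomega r1 by apply: nat_omega.
have fN1 : s_isfun N nomega r1 by apply: reg_mono fN.
have [r2 [r21 [B mB]]] := isfun_total fN1 kw (le_refl r1).
have r2q : le r2 q by apply: le_trans r1q.
have r22 : le r2 r2 by [].
have kw2 : memn (nnat k) nomega r2 by apply: nat_omega.
have mB' : s_maps N (nnat k) B r2 by apply/mapsP.
have ndB : s_nowhere nC nS B r2 by exact: (ndN r2q kw2 r22 mB').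
have BC : s_subset B nC r2 by move/sandP: (ndB) => [].
have vV : memn (nm (cst rho)) (nballC rho) r2.
  by apply/memn_ballC; split; [apply: cst_C | apply: cst_starts].
have VS : memn (nballC rho) nS r2 by apply: ball_S.
have VC : s_subset (nballC rho) nC r2 by move=> u s2 _ /memn_ballC [].
have [r3 [W [y [r32 WS yW /memn_ballC [yC yrho] dis]]]] := nowhereE ndB VS vV VC.
have [r4 [r43 [sW [ssW ysW HW]]]] := open_S WS yW (le_refl r3).
have yC4 : memn y nC r4 by apply: reg_mono yC.
have [yR4 off4] := proj1 (memn_C y r4) yC4.
pose n := maxn (size s) (size sW).
have [r5 [r54 [rho' [en srho' yrho']]]] := decide_R n yR4 (le_refl r4).
have r5q : le r5 q by apply: le_trans r54 (le_trans r43 (le_trans r32 r2q)).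
have rt5 : isreal r5 t by apply: isreal_mono rt.
have [r6 [r65 [sg' [en' ssg' dsg']]]] := decide_upto n rt5 (le_refl r5).
have r6q : le r6 q by apply: le_trans r5q.
have r61 : le r6 r1.
  by apply: le_trans r65 (le_trans r54 (le_trans r43 (le_trans r32 r21))).
have yR5 : memn y nR r5 by apply: reg_mono yR4.
have sn : size s <= n by rewrite leq_maxl.
have Wn : size sW <= n by rewrite leq_maxr.
have rho_rho' : forall m, m < size s -> nth 0 rho m = nth 0 rho' m.
  move=> m ms; apply: (starts_uniq yR5 yrho'); first by rewrite en; apply: leq_trans sn.
  have h : takes y m (nth 0 rho m) r3 by apply: yrho; rewrite size_mwise.
  by apply: takes_mono h; apply: le_trans r54 r43.
have sg_sg' : forall m, m < size s -> nth 0 sg m = nth 0 sg' m.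
  move=> m ms; apply: (proj2 rt r6 m) => //.
    by apply: dec_mono r61 _; apply: dsg; rewrite es.
  by apply: dsg'; rewrite en'; apply: leq_trans sn.
have sW_rho' : forall m, m < size sW -> nth 0 sW m = nth 0 rho' m.
  move=> m ms; apply: (starts_uniq yR5 yrho'); first by rewrite en; apply: leq_trans Wn.
  by apply: takes_mono r54 _; apply: ysW.
have toprho' : forall m, m < n -> nth 0 rho' m <> m.+2.
  move=> m mn e; apply: (off4 m r5 r54); rewrite -e; apply: yrho'; by rewrite en.
pose s' := mwise mdif rho' sg'.
have es' : size s' = n by rewrite size_mwise.
have lt_rho' : forall m, m < n -> nth 0 rho' m < m.+3 by move=> m mn; apply: srho'; rewrite en.
have lt_sg' : forall m, m < n -> nth 0 sg' m < m.+3 by move=> m mn; apply: ssg'; rewrite en'.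
have add_s' : mwise madd s' sg' = rho'.
  apply: (@eq_from_nth _ 0); rewrite size_mwise es' ?en // => m mn.
  by rewrite nth_mwise ?es' // nth_mwise ?en // mdifK //; [apply: lt_rho' | apply: lt_sg'].
exists r6, s'; split.
- exact: le_trans r61 r1r.
- split; rewrite ?es' // => m ms; have mn : m < n by apply: leq_trans sn.
  rewrite nth_mwise ?en // -rho_rho' // -sg_sg' // nth_mwise // maddK //; first exact: ss.
  by apply: ssg; rewrite es.
- move=> m; rewrite es' => mn; rewrite nth_mwise ?en //.
  by apply: mdif_lt; [apply: lt_rho' | apply: lt_sg'].
- move=> r7 m v r76; rewrite es' => mn dv.
  have -> : v = nth 0 sg' m.
    apply: (proj2 rt r7 m) => //; first exact: le_trans r6q.
    by apply: dec_mono r76 _; apply: dsg'; rewrite en'.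
  rewrite nth_mwise ?en //; apply: mdif_avoid; [exact: lt_rho' | exact: lt_sg' | exact: toprho'].
- exists sg'; split=> //; first by rewrite es'.
  rewrite add_s' => B2 y2 r7 r76 mB2 yB2 hy2.
  have r72 : le r7 r2.
    exact: le_trans r76 (le_trans r65 (le_trans r54 (le_trans r43 r32))).
  have r7q : le r7 q by apply: le_trans r2q.
  have fN7 : s_isfun N nomega r7 by apply: reg_mono fN.
  have kw7 : memn (nnat k) nomega r7 by apply: nat_omega.
  have mB7 : memn (opair (nnat k) B) N r7 by apply: reg_mono mB.
  have e : eqn B2 B r7 by exact: (isfun_uniq fN7 kw7 mB2 mB7).
  have yB : memn y2 B r7 by exact: (memn_eqr e yB2).
  have y2C : memn y2 nC r7 by exact: (BC y2 r7 r72 yB).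
  have r74 : le r7 r4 by exact: le_trans r76 (le_trans r65 r54).
  have hW : starts y2 sW r7.
    by move=> m ms; rewrite sW_rho' //; apply: hy2; rewrite en; apply: leq_trans Wn.
  have y2W : memn y2 W r7 by exact: (HW y2 r7 r74 y2C hW).
  have r73 : le r7 r3 by apply: le_trans r43.
  exact: (dis y2 r7 r73 y2W yB).
Qed.

Definition fsum f : rname := fun m v r =>
  exists a b, [/\ dec f r m a, dec t r m b & v = madd m a b].

Lemma dec_fsum f r m v : dec (fsum f) r m v <-> fsum f m v r.
Proof.
split=> [[r' [rr' [a [b [da db e]]]]]|H]; last by exists r.
by exists a, b; split=> //; apply: dec_mono rr' _.
Qed.

Lemma real_fsum f r : le r q -> isreal r f -> isreal r (fsum f).
Proof.
move=> rq rf; have rtr : isreal r t by apply: isreal_mono rt.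
split=> [m|r' m v w r'r /dec_fsum [a [b [da db ->]]] /dec_fsum [a' [b' [da' db' ->]]]].
  apply: dense_bind (proj1 rf m) _ => r1 r1r [a [am da]].
  apply: dense_imp (dense_mono r1r (proj1 rtr m)) => r2 r21 [b [bm db]].
  exists (madd m a b); split; first exact: madd_lt.
  by apply/dec_fsum; exists a, b; split=> //; apply: dec_mono r21 _.
by rewrite (proj2 rf r' m a a' r'r da da') (proj2 rtr r' m b b' r'r db db').
Qed.

Lemma sum_fsum f x r : le r q -> isreal r f -> memn x nR r ->
  (forall r' m v, le r' r -> (dec f r' m v <-> takes x m v r')) ->
  s_sum (nm (fsum f)) x (nm t) r.
Proof.
move=> rq rf /memn_R Rx fx; have rtr : isreal r t by apply: isreal_mono rt.
have rz := real_fsum rq rf.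
apply/sandP; split; first by apply/memn_R; apply: nm_Rcond.
move=> u r1 r1r uw n a b c r2 r21 /plus3P en r3 r32 /mapsP ma r4 r43 /mapsP mb r5 r54 /mapsP mc.
have uw5 : memn u nomega r5.
  by apply: reg_mono uw; apply: le_trans r54 (le_trans r43 (le_trans r32 r21)).
apply: (omega_case (B := s_modsum n c a b)) uw5 _ => r6 m r65 eu.
have r6r : le r6 r.
  exact: le_trans r65 (le_trans r54 (le_trans r43 (le_trans r32 (le_trans r21 r1r)))).
have eo v : eqn (opair u v) (opair (nnat m) v) r6 by exact: opair_congr eu (eqn_refl _ _).
have ma6 : memn (opair (nnat m) a) x r6.
  apply: (memn_eql (eo a)); apply: reg_mono ma.
  exact: le_trans r65 (le_trans r54 r43).
have mb6 : memn (opair (nnat m) b) (nm t) r6.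
  apply: (memn_eql (eo b)); apply: reg_mono mb; exact: le_trans r65 r54.
have mc6 : memn (opair (nnat m) c) (nm (fsum f)) r6.
  apply: (memn_eql (eo c)); exact: reg_mono mc.
have Rx6 : Rcond x r6 by apply: reg_mono Rx.
have Rt6 : Rcond (nm t) r6 by apply: nm_Rcond; apply: isreal_mono rtr.
have Rz6 : Rcond (nm (fsum f)) r6 by apply: nm_Rcond; apply: isreal_mono rz.
apply: (denseE (B := s_modsum n c a b)) (Rcond_val Rx6 ma6) _ => r7 r76 [va [am ea ha]].
apply: (denseE (B := s_modsum n c a b)) (dense_mono r76 (Rcond_val Rt6 mb6)) _ => r8 r87 [vb [bm eb hb]].
have r86 : le r8 r6 by apply: le_trans r76.
apply: (denseE (B := s_modsum n c a b)) (dense_mono r86 (Rcond_val Rz6 mc6)) _ => r9 r98 [vc [cm ec hc]].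
move/takes_nm: hc => hc; move/takes_nm: hb => hb.
apply: (denseE (B := s_modsum n c a b)) hc _ => s1 s19 /dec_fsum [a' [b' [da db evc]]].
have s18 : le s1 r8 by apply: le_trans r98.
apply: (denseE (B := s_modsum n c a b)) (dense_mono s18 hb) _ => s2 s21 db'.
have s27 : le s2 r7 by apply: le_trans s21 (le_trans s18 r87).
have s2r : le s2 r by apply: le_trans s27 (le_trans r76 r6r).
have Ea : a' = va.
  apply: (proj2 rf s2 m) => //; first exact: dec_mono da.
  by apply/fx => //; apply: takes_mono ha.
have Eb : b' = vb by apply: (proj2 rtr s2 m) => //; exact: dec_mono db.
apply: (modsum_nat am bm).
- apply: (eqn_trans (y := nsucc (nsucc (nsucc u)))).
    apply: reg_mono en; apply: le_trans s27 (le_trans r76 (le_trans r65 (le_trans r54 (le_trans r43 r32)))).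
  by do !apply: succ_congr; apply: reg_mono eu; apply: le_trans r76.
- exact: reg_mono ea.
- by apply: reg_mono eb; apply: le_trans s18.
- rewrite -/(madd m va vb) -Ea -Eb -evc; apply: reg_mono ec; exact: le_trans s19.
Qed.

Lemma fsum_C f r : le r q -> isreal r f ->
  (forall r' m v w, le r' r -> dec f r' m v -> dec t r' m w -> v + w <> m.+2) ->
  memn (nm (fsum f)) nC r.
Proof.
move=> rq rf notop; have rtr : isreal r t by apply: isreal_mono rt.
apply/memn_C; split; first by apply/memn_R; apply: nm_Rcond; apply: real_fsum.
move=> m r' r'r /takes_nm H; have [r2 [r2r' /dec_fsum [a [b [da db e]]]]] := H r' (le_refl r').
have r2r : le r2 r by apply: le_trans r'r.
move: (esym e); apply: madd_top; last exact: (notop r2).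
- exact: isreal_bound (isreal_mono r2r rf) da.
- exact: isreal_bound (isreal_mono r2r rtr) db.
Qed.

End Trace.

(** The sum of [t] with a real of [X] that enters all the sets [Bad] and avoids the excluded values
    would belong to the trace, but to none of the nowhere dense sets covering it. *)
Lemma counter_trace X q0 : s_counter X q0 -> meagre_trace_at (inX X) q0.
Proof.
move=> [XR _ H] q t qq0 rt; have qq : le q q by [].
pose F z := s_bex X (fun x => s_sum z x (nm t)).
have cF : Cong F by rewrite /F; exact _.
have rF z : Reg (F z) by rewrite /F; exact _.
pose Y : name := nsep nR F; pose D : name := nsep nC (fun z => memn z Y).
have tR : memn (nm t) nR q by apply/memn_R; apply: nm_Rcond.
have tY : s_translate Y X (nm t) q.
  move=> z; apply/siffP => r rq; rewrite memn_sep; split=> [[]//|Fz]; split=> //.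
  by apply: (bexE (B := memn z nR)) Fz _ => r1 x r1r _ /sandP [].
have iD : s_inter D nC Y q by move=> z; apply/siffP => r rq; rewrite memn_sep sandP.
have /sexP meag : s_meagre nomega nC nS D q by exact: (H (nm t) Y D q qq0 tR tY iD).
have [q' [q'q [N /sandP [fN /sandP [ndN cov]]]]] := meag q qq.
have XR' : s_subset X nR q' by apply: reg_mono XR; apply: le_trans qq0.
have rt' : isreal q' t by apply: isreal_mono rt.
exists q', (Bad N t); split=> //; first exact: opens_Bad.
  by move=> k r s; apply: dense_Bad.
move=> [r [f [rq' rf [x [xX fx]] notop ent]]]; have rr : le r r by [].
have xR : memn x nR r by exact: (XR' x r rq' xX).
have zC := fsum_C rt' rq' rf notop.
have zD : memn (nm (fsum t f)) D r.
  apply/memn_sep; split=> //; apply/memn_sep; split; first by have [] := proj1 (memn_C _ _) zC.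
  by apply: (bexI (x := x)) => //; exact: (sum_fsum rt' rq' rf xR fx).
have /siffP /(_ r rq') [/(_ zD) /bexP K _] := cov (nm (fsum t f)).
have [r1 [r1r [i [/memn_omega iw /sexP K1]]]] := K r rr.
have [r2 [r21 [k ek]]] := iw r1 (le_refl r1).
have [r3 [r32 [B /sandP [/mapsP mB zB]]]] := K1 r2 r21.
have r3r : le r3 r by apply: le_trans r32 (le_trans r21 r1r).
have [r4 [r43 [s [ds [sg [es dsg bad]]]]]] := ent k r3 r3r.
have r4r : le r4 r by apply: le_trans r3r.
apply: (bad B (nm (fsum t f)) r4 (le_refl r4)).
- apply: (memn_eql (opair_congr _ (eqn_refl _ _))); last exact: reg_mono mB.
  by apply: reg_mono ek; apply: le_trans r32.
- exact: reg_mono zB.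
- move=> m; rewrite size_mwise => ms; rewrite nth_mwise //; apply/takes_nm => r5 r54; exists r5; split=> //.
  apply/dec_fsum; exists (nth 0 s m), (nth 0 sg m); split=> //.
    by apply: dec_mono r54 _; apply: ds.
  by apply: dec_mono r54 _; apply: dsg; rewrite es.
Qed.

Theorem failure rho p0 : force rho (fnot phi 0) p0 -> exists q (inX : P -> rname -> Prop),
  [/\ le q p0, forall q1 q2 f, le q2 q1 -> inX q1 f -> inX q2 f,
      nonmeagre_at inX q & meagre_trace_at inX q].
Proof.
move=> H; have [q [X [qp0 cX]]] := not_phi H; exists q, (inX X); split=> //.
- exact: inX_mono.
- exact: counter_nonmeagre.
- exact: counter_trace.
Qed.

End Counterexample.

End Forcing.

(** * Systems of trees *)

Class WO (K : Type) (lt : K -> K -> Prop) : Prop := {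
  lt_wf : well_founded lt;
  lt_trans : forall a b c, lt a b -> lt b c -> lt a c;
  lt_total : forall a b, lt a b \/ a = b \/ lt b a }.

Section Conditions.

Context {K : Type} {lt : K -> K -> Prop} {W : WO lt}.

Lemma lt_irr a : ~ lt a a.
Proof. by elim: a / (lt_wf a) => a _ IH aa; apply: (IH a). Qed.

Definition pt := K -> nat -> nat.
Definition nodes := seq (K * seq nat).

(* At each coordinate [be] of the countable set [sup p] a condition [p] of the
   iteration has the tree with nodes [lab p be x a]; it depends only on the
   coordinates of [x] below [be], and locally only on finitely many of their nodes
   (see [wfc]). *)
Record pre := Pre { sup : K -> Prop; lab : K -> pt -> seq nat -> seq nat }.

Implicit Types (p q r : pre) (x y : pt) (J : K -> Prop) (e : nodes) (a : seq nat).
Implicit Types (al be ga : K).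

Definition initial J := forall be ga, lt ga be -> J be -> J ga.
Definition below be : K -> Prop := fun ga => lt ga be.
Definition upto be : K -> Prop := fun ga => lt ga be \/ ga = be.
Definition allK : K -> Prop := fun=> True.

Lemma initial_below be : initial (below be).
Proof. by move=> a b ba; apply: lt_trans ba. Qed.
Lemma initial_upto be : initial (upto be).
Proof. by move=> a b ba [H|E]; left; [apply: lt_trans H | rewrite -E]. Qed.
Lemma initial_all : initial allK.
Proof. by []. Qed.

Definition on p J x := forall be, sup p be -> J be -> Br (lab p be x) (x be).

Lemma on_sub p J J' x : (forall be, J be -> J' be) -> on p J' x -> on p J x.
Proof. by move=> H px be pb Jb; apply: px (H _ Jb). Qed.

Fixpoint nb p e x : Prop :=
  if e is ga :: e' then pref (lab p ga.1 x ga.2) (x ga.1) /\ nb p e' x else True.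
Fixpoint within p J e : Prop :=
  if e is ga :: e' then [/\ sup p ga.1, J ga.1 & within p J e'] else True.

Lemma nb_cat p e e' x : nb p (e ++ e') x <-> nb p e x /\ nb p e' x.
Proof. by elim: e => [|ga e IH] /=; [split=> // -[] | rewrite IH; split; [case=> ? []| case=> [[]]]]. Qed.
Lemma within_cat p J e e' : within p J (e ++ e') <-> within p J e /\ within p J e'.
Proof.
elim: e => [|ga e IH] /=; first by split=> // -[].
by split=> [[? ? /IH []]|[[? ? ?] ?]]; split=> //; apply/IH.
Qed.
Lemma within_sub p J J' e : (forall be, J be -> J' be) -> within p J e -> within p J' e.
Proof. by move=> H; elim: e => //= ga e IH [? /H ? /IH]. Qed.

(* [Q] holds on a neighbourhood of [x] in the space of branches of [p] on [J]. *)
Definition near p J x (Q : pt -> Prop) := exists e,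
  [/\ within p J e, nb p e x & forall x', on p J x' -> nb p e x' -> Q x'].

Lemma near_and p J x Q Q' : near p J x Q -> near p J x Q' ->
  near p J x (fun x' => Q x' /\ Q' x').
Proof.
move=> [e [we ne H]] [e' [we' ne' H']]; exists (e ++ e'); split.
- exact/within_cat.
- exact/nb_cat.
- by move=> x' ox /nb_cat [n n']; split; [apply: H | apply: H'].
Qed.

Lemma near_imp p J x (Q Q' : pt -> Prop) :
  near p J x Q -> (forall x', on p J x' -> Q x' -> Q' x') -> near p J x Q'.
Proof.
by move=> [e [we ne H]] QQ; exists e; split=> // x' ox n; apply: QQ (H _ ox n).
Qed.

Lemma near_all p J x (Q : pt -> Prop) : (forall x', on p J x' -> Q x') -> near p J x Q.
Proof. by move=> H; exists [::]; split=> // x' ox _; apply: H. Qed.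

Lemma near_self p J x Q : on p J x -> near p J x Q -> Q x.
Proof. by move=> ox [e [_ n H]]; apply: H. Qed.

Lemma near_sub p J J' x Q : (forall be, J be -> J' be) -> near p J x Q -> near p J' x Q.
Proof.
move=> JJ [e [we ne H]]; exists e; split=> //; first exact: within_sub we.
by move=> x' ox; apply: H; apply: on_sub ox.
Qed.

Lemma near_node p J x be a : sup p be -> J be -> pref (lab p be x a) (x be) ->
  near p J x (fun x' => pref (lab p be x' a) (x' be)).
Proof. by move=> sb Jb px; exists [:: (be, a)]; split=> //= x' _ []. Qed.

(** The last two fields constrain the labels only at points that are branches of [p] below [be];
    elsewhere the labels are arbitrary. Continuity is with respect to the topology given by the
    nodes of [p] itself. *)
Record wfc p : Prop := {
  wf_count : exists en : nat -> K, forall be, sup p be -> exists n, en n = be;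
  wf_dep : forall be x x', (forall ga, lt ga be -> sup p ga -> x ga = x' ga) ->
    lab p be x = lab p be x';
  wf_OK : forall be x, sup p be -> on p (below be) x -> OK (lab p be x);
  wf_loc : forall be x a, sup p be -> on p (below be) x ->
    near p (below be) x (fun x' => lab p be x' a = lab p be x a) }.

Definition leJ J q p := (forall be, sup p be -> J be -> sup q be) /\
  forall x, on q J x -> on p J x.

Lemma leJ_refl J p : leJ J p p.
Proof. by []. Qed.
Lemma leJ_trans J p q r : leJ J p q -> leJ J q r -> leJ J p r.
Proof.
by move=> [s H] [s' H']; split=> [be rb Jb|x /H/H' //]; apply: s => //; apply: s'.
Qed.

Lemma on_agree p J x y : wfc p -> initial J -> (forall be, J be -> x be = y be) ->
  on p J x -> on p J y.
Proof.
move=> wp iJ E px be pb Jb; rewrite -E // -(wf_dep wp (x := x)); first exact: px.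
by move=> ga gb _; apply: E; apply: iJ Jb.
Qed.

Lemma wf_recursion (F : K -> pt -> nat -> nat) : exists f : pt, forall be,
  f be = F be (fun ga => if pselect (lt ga be) then f ga else fun=> 0).
Proof.
pose G be (rec : forall ga, lt ga be -> nat -> nat) :=
  F be (fun ga => if pselect (lt ga be) is left h then rec ga h else fun=> 0).
have ext be f g : (forall ga h, f ga h = g ga h) -> G be f = G be g.
  by move=> H; congr (G be); apply: functional_extensionality_dep => ga; apply: funext => h; rewrite H.
exists (Fix lt_wf (fun=> nat -> nat) G) => be.
rewrite [LHS](Fix_eq lt_wf (fun=> nat -> nat) G ext be) /G.
by f_equal; apply: funext => ga; case: pselect.
Qed.

(** By recursion along the order the leftmost branch is taken at every coordinate outside [J]; its
    tree is good because the coordinates already chosen form a branch. *)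
Lemma extend_branch p J x : wfc p -> initial J -> on p J x ->
  exists y, on p allK y /\ forall be, J be -> y be = x be.
Proof.
move=> wp iJ px.
have [y E] := wf_recursion (fun be y => if pselect (J be) then x be
  else lbranch (lab p be y)).
have Ey be : J be -> y be = x be by move=> Jb; rewrite E; case: (pselect (J be)).
exists y; split=> // be pb _; elim: be / (lt_wf be) pb => be _ IH pb.
have ob : on p (below be) y by move=> ga pg gb; apply: IH.
have [Jb|nJ] := lem (J be).
  rewrite Ey // -(wf_dep wp (x := x)); first exact: px.
  by move=> ga gb _; rewrite Ey //; apply: iJ Jb.
have dep : lab p be (fun ga => if pselect (lt ga be) then y ga else fun=> 0) = lab p be y.
  by apply: (wf_dep wp) => ga gb _; case: pselect.
rewrite E; case: (pselect (J be)) => [//|b] /=; rewrite dep; apply: lbranch_Br.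
exact: (wf_OK wp).
Qed.

Lemma leJ_le p q J : wfc p -> wfc q -> initial J -> leJ allK q p -> leJ J q p.
Proof.
move=> wp wq iJ [s H]; split=> [be pb _|x ox]; first exact: s.
have [y [oy E]] := extend_branch wq iJ ox.
apply: (on_agree (x := y) wp iJ E); apply: on_sub (H _ oy) => //.
Qed.

Lemma near_near p J x Q : near p J x Q -> near p J x (fun x' => near p J x' Q).
Proof. by move=> [e [we ne H]]; exists e; split=> // x' _ n; exists e. Qed.

(** Passing a node of [p] has to be an open condition in the topology of [r]. By induction on the
    coordinate the label of that node is locally constant for [r]; a node of [r] through [x] whose
    label is at least as long then decides that the node of [p] is passed. *)
Lemma near_trans p r J x Q : wfc p -> wfc r -> initial J ->
  (forall be, sup p be -> J be -> sup r be) -> on r J x -> near r J x (on p J) ->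
  near p J x Q -> near r J x Q.
Proof.
move=> wp wr iJ srp rx rp [e [we ne H]].
suff S : near r J x (fun x' => nb p e x').
  by apply: near_imp (near_and S rp) _ => x' ox [n px]; apply: H.
have one be a : sup p be -> J be -> pref (lab p be x a) (x be) ->
    near r J x (fun x' => pref (lab p be x' a) (x' be)).
  elim: be / (lt_wf be) a => be _ IH a pb Jb pa.
  have JB ga : below be ga -> J ga by move=> gb; apply: iJ Jb.
  have px : on p (below be) x by apply: on_sub (near_self rx rp).
  have [e1 [w1 n1 H1]] := wf_loc wp a pb px.
  have {}n1 : near r J x (fun x' => nb p e1 x').
    elim: e1 w1 n1 {H1} => [|[ga c] e1 IH1] /=; first by move=> _ _; apply: near_all.
    move=> [pg gb w1] [pc n1]; apply: near_and (IH1 w1 n1).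
    by apply: IH => //; apply: JB.
  have rb := srp _ pb Jb.
  have rx' : on r (below be) x by apply: on_sub rx.
  have okr := wf_OK wr rb rx'.
  have [c cH] := rx be rb Jb.
  pose b := mkseq c (size (lab p be x a)).
  have sb : size (lab p be x a) <= size (lab r be x b).
    by have := OK_size b okr; rewrite size_mkseq.
  have n2 := near_sub JB (wf_loc wr b rb rx').
  have n3 := near_node rb Jb (cH (size (lab p be x a))).
  apply: near_imp (near_and rp (near_and n1 (near_and n2 n3))) _ => x' ox [px' [nx' [E2 n3']]].
  rewrite H1 //; last by apply: on_sub px'.
  rewrite -/b E2 in n3'.
  apply: (pref_spref _ n3'); apply: (pref_le sb pa); exact: cH.
elim: e we ne {H} => [|[ga c] e IH] /=; first by move=> _ _; apply: near_all.
by move=> [pg Jg w] [pc n]; apply: near_and (IH w n); apply: one.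
Qed.

Lemma near_leJ p r J x Q : wfc p -> wfc r -> initial J -> leJ J r p -> on r J x ->
  near p J x Q -> near r J x Q.
Proof.
move=> wp wr iJ [srp rp] rx; apply: near_trans => //; exact: near_all.
Qed.

Definition restr p (h : K -> seq nat) := Pre (sup p) (fun be x => shift_tree (h be) (lab p be x)).

Lemma on_restr p h J x : wfc p -> initial J -> on (restr p h) J x <->
  on p J x /\ forall be, sup p be -> J be -> pref (lab p be x (h be)) (x be).
Proof.
move=> wp iJ; split=> H.
  suff S be : sup p be -> J be ->
      Br (lab p be x) (x be) /\ pref (lab p be x (h be)) (x be).
    by split=> be pb Jb; case: (S be pb Jb).
  elim: be / (lt_wf be) => be _ IH pb Jb; apply/Br_shift; last exact: H.
  by apply: (wf_OK wp) => // ga pg gb; case: (IH ga gb pg (iJ _ _ gb Jb)).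
move=> be pb Jb; apply/Br_shift; last by case: H => [H /(_ be pb Jb)]; split=> //; apply: H.
by apply: (wf_OK wp) => // ga pg gb; case: H => H _; apply: H => //; apply: iJ Jb.
Qed.

Lemma wfc_restr p h : wfc p -> wfc (restr p h).
Proof.
move=> wp; split=> /=.
- exact: wf_count wp.
- by move=> be x x' E; rewrite /shift_tree (wf_dep wp E).
- move=> be x pb /(on_restr _ _ wp (@initial_below be)) [ox _].
  by apply: OK_shift; apply: (wf_OK wp).
- move=> be x a pb ox; have [px hx] := proj1 (on_restr _ _ wp (@initial_below be)) ox.
  have [e [we ne H]] := wf_loc wp (h be ++ a) pb px.
  suff S : near (restr p h) (below be) x (fun x' => nb p e x').
    apply: near_imp S _ => x' /(on_restr _ _ wp (@initial_below be)) [ox' _] n.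
    by rewrite /shift_tree /= H.
  elim: e we ne {H} => [|[ga c] e IH] /=; first by move=> _ _; apply: near_all.
  move=> [pg gb we] [pc ne]; apply: near_and (IH we ne).
  have okg y : on (restr p h) (below be) y -> OK (lab p ga y).
    move=> /(on_restr _ _ wp (@initial_below be)) [oy _].
    by apply: (wf_OK wp) => //; apply: on_sub oy => de dg; exact: (lt_trans (lt := lt) dg gb).
  have [d dH] := ox ga pg gb.
  have n : near (restr p h) (below be) x (fun x' =>
      pref (lab p ga x' (h ga ++ mkseq d (size c))) (x' ga)).
    by apply: (near_node (p := restr p h)).
  apply: near_imp n _ => x' ox' n; apply: pref_spref n.
  have [d' d'H] := proj1 (proj1 (Br_shift _ _ (okg x ox)) (ox ga pg gb)).
  have E1 := Br_node (okg x ox) d'H pc.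
  have E2 := Br_node (okg x ox) d'H (dH (size c)).
  rewrite E2 {1}E1 size_cat size_mkseq (mkseq_prefix _ (leq_addl (size (h ga)) (size c))).
  exact/OK_cat/okg.
Qed.

Lemma le_restr p h J : wfc p -> initial J -> leJ J (restr p h) p.
Proof. by move=> wp iJ; split=> // x /(on_restr _ _ wp iJ) []. Qed.

Lemma leJ_restr p h J : initial J -> wfc p -> (forall be, J be -> h be = [::]) ->
  leJ J p (restr p h).
Proof.
move=> iJ wp E; split=> // x ox; apply/on_restr => //; split=> // be pb Jb.
by rewrite E //; have [c /(_ 0)] := ox be pb Jb.
Qed.

Definition at1 al a : K -> seq nat := fun be => if pselect (be = al) then a else [::].

Lemma at1E al a : at1 al a al = a.
Proof. by rewrite /at1; case: pselect. Qed.
Lemma at1_ne al a be : be <> al -> at1 al a be = [::].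
Proof. by rewrite /at1; case: pselect. Qed.

Definition mix J r p := Pre (fun be => J be /\ sup r be \/ ~ J be /\ sup p be)
  (fun be => if pselect (J be) then lab r be else lab p be).

Section Mix.

Variables (J : K -> Prop) (r p : pre).
Hypotheses (wr : wfc r) (wp : wfc p) (iJ : initial J) (rp : leJ J r p).

Lemma mix_in be : J be -> lab (mix J r p) be = lab r be.
Proof. by rewrite /=; case: pselect. Qed.
Lemma mix_out be : ~ J be -> lab (mix J r p) be = lab p be.
Proof. by rewrite /=; case: pselect. Qed.

Lemma on_mix_in J' x : (forall be, J' be -> J be) -> on (mix J r p) J' x <-> on r J' x.
Proof.
move=> JJ; split=> H be sb Jb; have Jb' := JJ _ Jb.
  by have := H be (or_introl (conj Jb' sb)) Jb; rewrite mix_in.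
by rewrite mix_in //; apply: H => //; case: sb => -[].
Qed.

Lemma on_mix_out J' x : (forall be, J be -> J' be) ->
  on (mix J r p) J' x -> on p J' x.
Proof.
move=> JJ H be pb Jb; have [iJb|nJ] := lem (J be).
  apply: (proj2 rp) => //; apply/on_mix_in => //; exact: on_sub H.
by have := H be (or_intror (conj nJ pb)) Jb; rewrite mix_out.
Qed.

Lemma out_below be ga : ~ J be -> J ga -> lt ga be.
Proof.
move=> nJ Jg; have [//|[E|bg]] := lt_total ga be; case: nJ; first by rewrite -E.
exact: iJ Jg.
Qed.

Lemma near_mix J' x Q : (forall be, J be -> J' be) ->
  near r J x Q -> near (mix J r p) J' x Q.
Proof.
move=> JJ [e [we ne H]]; have nbE y : nb (mix J r p) e y <-> nb r e y.
  elim: e we {ne H} => //= ga e IH [_ Jg /IH E]; rewrite E.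
  by case: pselect.
exists e; split; last 2 first.
- exact/nbE.
- by move=> y oy /nbE; apply: H; apply/(on_mix_in _ (fun _ => id)); apply: on_sub oy.
elim: e we {ne H nbE} => //= ga e IH [rg Jg /IH we]; split=> //; last exact: JJ.
by left.
Qed.

(** Outside [J] the trees of [p] still make sense, since on [J] every branch of [r] is one of [p];
    their continuity is transferred from the topology of [p] to that of [r] by [near_leJ]. *)
Lemma wfc_mix : wfc (mix J r p).
Proof.
split.
- have [en H] := wf_count wr; have [en' H'] := wf_count wp.
  exists (fun n => if odd n then en n./2 else en' n./2) => be [[_ /H]|[_ /H']] [n <-].
    by exists n.*2.+1; rewrite /= odd_double /= uphalf_double.
  by exists n.*2; rewrite odd_double doubleK.
- move=> be x x' E; have [Jb|nJ] := lem (J be).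
    rewrite mix_in //; apply: (wf_dep wr) => ga gb rg; apply: E => //.
    by left; split=> //; apply: iJ Jb.
  rewrite mix_out //; apply: (wf_dep wp) => ga gb pg; apply: E => //.
  by have [Jg|] := lem (J ga); [left; split=> //; apply: (proj1 rp) | right].
- move=> be x sb ox; have [Jb|nJ] := lem (J be).
    rewrite mix_in //; apply: (wf_OK wr); first by case: sb => -[].
    by apply: (proj1 (on_mix_in _ _) ox) => ga gb; apply: iJ Jb.
  rewrite mix_out //; apply: (wf_OK wp); first by case: sb => -[].
  by apply: on_mix_out ox => ga; apply: out_below.
- move=> be x a sb ox; have [Jb|nJ] := lem (J be).
    rewrite mix_in //; have rb : sup r be by case: sb => -[].
    have JB ga : below be ga -> J ga by move=> gb; apply: iJ Jb.
    have [e [we ne H]] := wf_loc wr a rb (proj1 (on_mix_in _ JB) ox).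
    have nbE y : nb (mix J r p) e y <-> nb r e y.
      elim: e we {ne H} => //= ga e IH [_ /JB Jg /IH E]; rewrite E.
      by case: pselect.
    exists e; split; [|exact/nbE|].
    + elim: e we {ne H nbE} => //= ga e IH [rg gb /IH we]; split=> //.
      by left; split=> //; apply: JB.
    + by move=> x' ox' /nbE; apply: H; apply/(on_mix_in _ JB).
  rewrite mix_out //; have pb : sup p be by case: sb => -[].
  have JB ga : J ga -> below be ga by apply: out_below.
  have ox' := on_mix_out JB ox.
  have [e [we ne H]] := wf_loc wp a pb ox'.
  have rx : on r J x by apply/(on_mix_in _ (fun _ => id)); apply: on_sub ox.
  suff S : near (mix J r p) (below be) x (fun x' => nb p e x').
    by apply: near_imp S _ => y oy n; apply: H => //; apply: on_mix_out oy.
  elim: e we ne {H} => [|[ga c] e IH] /=; first by move=> _ _; apply: near_all.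
  move=> [pg gb we] [pc ne]; apply: near_and (IH we ne).
  have [Jg|nJg] := lem (J ga); last first.
    rewrite -(mix_out nJg) in pc *; apply: near_node pc => //.
    by right.
  by apply: (near_mix JB); apply: (near_leJ wp wr iJ rp rx); apply: near_node.
Qed.

Lemma mix_leJ : leJ J (mix J r p) r.
Proof. by split=> [be rb Jb|x /on_mix_in H]; [left | apply: H]. Qed.

Lemma mix_le : leJ allK (mix J r p) p.
Proof.
split=> [be pb _|x H]; last exact: on_mix_out H.
by have [Jb|nJ] := lem (J be); [left; split=> //; apply: (proj1 rp) | right].
Qed.

End Mix.

End Conditions.

(** * A tree with the required room *)

Section DefaultTree.

(** The [i]-th child of a node answers the [i]-th request, a list of functions to dodge and a length
    up to which to dodge them. Finite sequences padded with zeros suffice as functions, so requests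
    are countable. *)
Definition challenge (i : nat) : seq (seq nat) * nat := odflt ([::], 0) (unpickle i).

Lemma challengeK c : challenge (pickle c) = c.
Proof. by rewrite /challenge pickleK. Qed.

(** At least the requested length, and strictly increasing so that siblings stop dodging at
    different places. *)
Fixpoint gap i := if i is j.+1 then (gap j + (challenge i).2).+1 else (challenge i).2.

Lemma gap_ge i : (challenge i).2 <= gap i.
Proof. by case: i => [|i] //=; rewrite ltnW // ltnS leq_addl. Qed.

Lemma gap_ltn i j : i < j -> gap i < gap j.
Proof.
elim: j => // j IH; rewrite ltnS leq_eqVlt => /orP [/eqP ->|/IH H].
  by rewrite /= ltnS leq_addr.
by apply: leq_trans H _; rewrite /= ltnW // ltnS leq_addr.
Qed.

(* Among 1, .., m + 2 at most [size F] values are excluded. *)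
Definition dodge (F : seq (seq nat)) m :=
  (find (fun w => all (fun g => w.+1 + nth 0 g m != m.+2) F) (iota 0 m.+2)).+1.

Lemma dodgeP F m : size F <= m.+1 ->
  dodge F m < m.+3 /\ forall g, g \in F -> dodge F m + nth 0 g m <> m.+2.
Proof.
move=> sF; pose a w := all (fun g => w.+1 + nth 0 g m != m.+2) F.
have : has a (iota 0 m.+2).
  apply: contraT => nh.
  suff : size (iota 0 m.+2) <= size [seq m.+1 - nth 0 g m | g <- F].
    by rewrite size_iota size_map => H; have := leq_trans H sF; rewrite ltnn.
  apply: uniq_leq_size; first exact: iota_uniq.
  move=> w wi; move/hasPn: nh => /(_ _ wi) /allPn [g gF /negPn/eqP E].
  by apply/mapP; exists g => //; apply/eqP; rewrite -(eqn_add2r (nth 0 g m)) subnK; rewrite addSn in E; case: E => <-; rewrite ?leq_addl.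
move=> h; split; first by move: h; rewrite has_find size_iota /dodge -/a.
have := nth_find 0 h; rewrite nth_iota; last by move: h; rewrite has_find size_iota.
by rewrite add0n => /allP H g gF; apply/eqP/(H _ gF).
Qed.

(** The final 0 distinguishes siblings: where the earlier child ends with 0, the later one still
    dodges, and [dodge] is positive. *)
Definition child d (s : seq nat) i :=
  mkseq (fun m => if m < size s then nth 0 s m else
    if m < size s + gap i then dodge (take d.+1 (challenge i).1) m else 0)
    (size s + gap i).+1.

Fixpoint tree0_rev b := if b is i :: b' then child (size b') (tree0_rev b') i else [::].
Definition tree0 a := tree0_rev (rev a).

Lemma tree0_rcons a i : tree0 (rcons a i) = child (size a) (tree0 a) i.
Proof. by rewrite /tree0 rev_rcons /= size_rev. Qed.

Lemma tree0_size a : size a <= size (tree0 a).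
Proof.
elim/last_ind: a => // a i IH; rewrite tree0_rcons size_rcons size_mkseq ltnS.
by rewrite (leq_trans IH) // leq_addr.
Qed.

Lemma OK_tree0 : OK tree0.
Proof.
split=> [a i|a i j ij|a|a F n sF]; rewrite ?tree0_rcons.
- split; first by rewrite size_mkseq ltnW // ltnS leq_addr.
  move=> m ma; rewrite nth_mkseq ?ma // ltnS.
  by rewrite (leq_trans (ltnW ma)) // leq_addr.
- have main k l : k < l -> exists m, [/\ m < size (child (size a) (tree0 a) k),
    m < size (child (size a) (tree0 a) l) &
    nth 0 (child (size a) (tree0 a) k) m <> nth 0 (child (size a) (tree0 a) l) m].
    move=> /gap_ltn g; exists (size (tree0 a) + gap k).
    rewrite !size_mkseq !nth_mkseq ?ltnS ?leq_add2l ?(ltnW g) //; split=> //.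
    by rewrite ltnNge leq_addr /= ltnn ltn_add2l g.
  case: (ltngtP i j) => [/main //|/main [m [mi mj E]]|//].
  by exists m; split=> //; apply: nesym.
- elim/last_ind: a => [|a i IH] m //; rewrite tree0_rcons size_mkseq => mi.
  rewrite nth_mkseq //; case: (ltnP m (size _)) => [/IH //|am]; case: (ltnP m (size _ + _)) => // _.
  (* A node of level d has a label of length at least d, so a new place [m] is at least d and the
     d+1 functions number at most [m.+1]. *)
  apply: (proj1 (dodgeP _)); rewrite size_take_min (leq_trans (geq_minl _ _)) // ltnS.
  by apply: leq_trans am; apply: tree0_size.
- exists (pickle (F, n)); rewrite tree0_rcons size_mkseq.
  have G := gap_ge (pickle (F, n)); rewrite challengeK /= in G.
  split; first by rewrite (leq_trans G) // ltnW // ltnS leq_addl.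
  move=> g gF m /andP [am mn]; have mg : m < size (tree0 a) + gap (pickle (F, n)).
    by rewrite (leq_trans mn) // (leq_trans G) // leq_addl.
  rewrite nth_mkseq ?ltnS ?(ltnW mg) // ltnNge am /= mg challengeK /= take_oversize //.
  apply: (proj2 (dodgeP _)) => //.
  by rewrite (leq_trans sF) // ltnS (leq_trans _ am) // tree0_size.
Qed.

End DefaultTree.

(** * The poset of conditions *)

Section Cond.

Context {K : Type} {lt : K -> K -> Prop} {W : WO lt}.
Local Notation pre := (@pre K).
Local Notation wfc := (@wfc K lt).

Record cond := Cond { pc :> pre; wfcP : wfc pc }.
Hint Resolve wfcP : core.
Local Notation initial := (@initial K lt).
Implicit Types (p q r : cond) (x y : @pt K) (J : K -> Prop) (al be ga : K).
Implicit Types (e : @nodes K) (a s : seq nat).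

Definition le q p := leJ allK q p.

Global Instance PreOrd_le : PreOrd le.
Proof. by split=> [p|p q r]; [apply: leJ_refl | apply: leJ_trans]. Qed.

Lemma le_leJ J q p : initial J -> le q p -> leJ J q p.
Proof. by move=> iJ; apply: leJ_le. Qed.

Definition crestr p h := Cond (wfc_restr h (wfcP p)).

Lemma crestr_le p h : le (crestr p h) p.
Proof. exact: le_restr. Qed.

Lemma on_none p x : on p (fun=> False) x.
Proof. by []. Qed.

Lemma on_crestr p h J x : initial J -> on (crestr p h) J x <->
  on p J x /\ forall be, sup p be -> J be -> pref (lab p be x (h be)) (x be).
Proof. by move=> iJ; apply: on_restr. Qed.

Definition cmix J r p (iJ : initial J) (rp : leJ J r p) : cond :=
  Cond (wfc_mix (wfcP r) (wfcP p) iJ rp).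

Lemma cmix_le J r p (iJ : initial J) (rp : leJ J r p) : le (cmix iJ rp) p.
Proof. exact: mix_le. Qed.

Lemma cmix_leJ J r p (iJ : initial J) (rp : leJ J r p) : leJ J (cmix iJ rp) r.
Proof. exact: mix_leJ. Qed.

Lemma OK_on p J be x : initial J -> sup p be -> J be -> on p J x -> OK (lab p be x).
Proof.
move=> iJ pb Jb ox; apply: (wf_OK (wfcP p)) => //; apply: on_sub ox => ga gb.
exact: iJ Jb.
Qed.

Lemma on_extend p J x : initial J -> on p J x ->
  exists y, on p allK y /\ forall be, J be -> y be = x be.
Proof. by move=> iJ; apply: extend_branch. Qed.

Lemma on_inh p : exists x, on p allK x.
Proof.
have iF : initial (fun=> False) by [].
have [y [oy _]] := on_extend iF (@on_none p (fun _ _ => 0)).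
by exists y.
Qed.

(** Basic neighbourhoods are clopen: a branch that misses a node passes another node of the same
    level, and no branch passes both. *)
Lemma near_not q J e x : initial J -> within q J e -> on q J x -> ~ nb q e x ->
  near q J x (fun x' => ~ nb q e x').
Proof.
move=> iJ; elim: e => [|[ga a] e IH] /=; first by move=> _ _ n; case: n.
move=> [qg Jg we] ox n.
have [ax|nax] := lem (pref (lab q ga x a) (x ga)).
  by apply: near_imp (IH we ox _) _ => [nx|x' _ nx' []]; first exact: n.
have [c cH] := ox ga qg Jg.
apply: near_imp (near_node qg Jg (cH (size a))) _ => x' ox' cx' [ax' _].
apply: nax; suff -> : a = mkseq c (size a) by apply: cH.
by apply: (node_unique (OK_on iJ qg Jg ox') ax' cx'); rewrite size_mkseq.
Qed.

Fixpoint touches e be := if e is g :: e' then g.1 = be \/ touches e' be else False.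

(** The nodes of the neighbourhood are prolonged along [x] to one common level [n], which leaves a
    single node at each coordinate; restricting to these finitely many nodes is again a
    neighbourhood of [x]. *)
Lemma near_restr q J x Q : initial J -> on q J x -> near q J x Q ->
  exists h, [/\ near q J x (on (crestr q h) J), forall y, on (crestr q h) J y -> on q J y /\ Q y &
    forall be, ~ J be -> h be = [::]].
Proof.
move=> iJ ox [e [we ne H]].
have /choice [c cH] : forall be, exists c : nat -> nat, sup q be -> J be ->
    forall n, pref (lab q be x (mkseq c n)) (x be).
  move=> be; have [[qb Jb]|n] := lem (sup q be /\ J be).
    by have [c cH] := ox be qb Jb; exists c.
  by exists (fun=> 0) => qb Jb; case: n.
pose sz (e' : @nodes K) := foldr (fun g m => maxn (size g.2) m) 0 e'.
have [n sn] : exists n, sz e <= n by exists (sz e).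
have wm h' : within q J [seq (g.1, h' g.1) | g <- e].
  by elim: e we {ne H sn} => //= g e IH [qg Jg /IH].
have nm (h' : K -> seq nat) : (forall be, sup q be -> J be -> pref (lab q be x (h' be)) (x be)) ->
    nb q [seq (g.1, h' g.1) | g <- e] x.
  move=> hx; elim: e we {ne H sn wm} => //= g e IH [qg Jg we].
  by split; [apply: hx | apply: IH].
have tm (h' : K -> seq nat) y be : touches e be -> nb q [seq (g.1, h' g.1) | g <- e] y ->
    pref (lab q be y (h' be)) (y be).
  by elim: e {we ne H sn wm nm} => //= g e IH [<- []|/IH {}IH [_ /IH]].
pose h be := if pselect (J be /\ touches e be) then mkseq (c be) n else [::].
have hJ be : J be -> touches e be -> h be = mkseq (c be) n.
  by rewrite /h; case: pselect => // C Jb tb; case: C.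
exists h; split.
- exists [seq (g.1, h g.1) | g <- e]; split.
  + exact: wm.
  + apply: nm => be qb Jb; rewrite /h; case: pselect => [C|C]; first exact: cH.
    by have [d /(_ 0)] := ox be qb Jb.
  + move=> y oy n'; apply/on_crestr => //; split=> // be qb Jb.
    have [tb|nt] := lem (touches e be); last first.
      rewrite /h; case: pselect => [[_ /nt] //|C] /=.
      by have [d /(_ 0)] := oy be qb Jb.
    exact: tm n'.
- move=> y /(on_crestr _ _ _ iJ) [oy hy]; split=> //; apply: H => //.
  suff G e' : within q J e' -> nb q e' x -> sz e' <= n ->
      (forall be, touches e' be -> touches e be) -> nb q e' y by apply: (G e).
  elim: e' => [|[ga a] e' IH] //= [qg Jg we'] [ax ne'].
  rewrite geq_max => /andP [an en] te; split; last by apply: IH => // be tb; apply: te; right.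
  have E := Br_node (OK_on iJ qg Jg ox) (cH ga qg Jg) ax.
  have := hy ga qg Jg; rewrite hJ //; last by apply: te; left.
  rewrite (mkseq_prefix _ an) -E; apply: pref_spref.
  exact/OK_cat/(OK_on iJ qg Jg oy).
- by move=> be nJ; rewrite /h; case: pselect => [[]|].
Qed.

Lemma near_le q p J x : initial J -> (forall be, sup p be -> J be -> sup q be) ->
  on q J x -> near q J x (on p J) ->
  exists h, near q J x (on (crestr q h) J) /\ leJ J (crestr q h) p.
Proof.
move=> iJ pq ox /(near_restr iJ ox) [h [oh H _]]; exists h; split=> //.
by split=> // y /H [].
Qed.

Definition lc q J T (f : @pt K -> T) :=
  forall x, on q J x -> near q J x (fun x' => f x' = f x).

Lemma least_exists : exists pf : (nat -> Prop) -> nat, forall P, (exists k, P k) ->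
  P (pf P) /\ forall j, j < pf P -> ~ P j.
Proof.
suff : forall P : nat -> Prop, exists k, (exists k, P k) -> P k /\ forall j, j < k -> ~ P j.
  by move=> /choice [pf H]; exists pf.
move=> P.
have [[k Pk]|n] := lem (exists k, P k); last by exists 0 => H; case: n.
have ex : exists k, `[<P k>] by exists k; apply/asboolP.
exists (ex_minn ex) => _; case: ex_minnP => m /asboolP Pm H; split=> // j jm Pj.
have := H j; rewrite leqNgt jm => E; suff : false by []; apply: E; exact/asboolP.
Qed.

Lemma near_forall q J x (Q : nat -> @pt K -> Prop) n :
  (forall j, j < n -> near q J x (Q j)) -> near q J x (fun x' => forall j, j < n -> Q j x').
Proof.
elim: n => [|n IH] H; first exact: near_all.
apply: near_imp (near_and (H n (ltnSn n)) (IH (fun j jn => H j (ltnW jn)))) _.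
move=> x' _ [Qn Q'] j; rewrite ltnS leq_eqVlt => /orP [/eqP -> //|]; exact: Q'.
Qed.

Lemma nb_agree q J e x x' : initial J -> within q J e ->
  (forall ga, sup q ga -> J ga -> x ga = x' ga) -> nb q e x -> nb q e x'.
Proof.
move=> iJ we E; elim: e we => //= ga e IH [qg Jg we] [ax ne]; split; last exact: IH.
rewrite -E // -(wf_dep (wfcP q) (x := x)) // => de dg qd; apply: E => //.
exact: iJ Jg.
Qed.

(** Continuous selection. Supports are countable, so pairs of a basic neighbourhood and a value
    number can be enumerated; the value of the first pair that is valid around [x] is taken. Being
    first is locally constant because neighbourhoods are clopen. The choice looks only at supported
    coordinates in [J], as later labels must. *)
Lemma choose_lc q J T (en : nat -> T) (Q : @pt K -> T -> Prop) : initial J ->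
  (forall x, on q J x -> exists n, near q J x (fun x' => Q x' (en n))) ->
  exists f : @pt K -> T, [/\ lc q J f, forall x, on q J x -> Q x (f x),
    forall x, exists n, f x = en n &
    forall x x', (forall ga, sup q ga -> J ga -> x ga = x' ga) -> f x = f x'].
Proof.
move=> iJ H; have [enq enqP] := wf_count (wfcP q).
pose dec k : @nodes K * nat :=
  let c : seq (nat * seq nat) * nat := odflt ([::], 0) (unpickle k) in
  ([seq (enq ia.1, ia.2) | ia <- c.1], c.2).
have decP e n : within q J e -> exists k, dec k = (e, n).
  move=> we; suff [c E] : exists c : seq (nat * seq nat), [seq (enq ia.1, ia.2) | ia <- c] = e.
    by exists (pickle (c, n)); rewrite /dec pickleK /= E.
  elim: e we => [|[ga a] e IH] /= [] ; first by exists [::].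
  move=> /enqP [i ei] _ /IH [c E]; exists ((i, a) :: c); by rewrite /= ei E.
pose cert k := within q J (dec k).1 /\
  forall x', on q J x' -> nb q (dec k).1 x' -> Q x' (en (dec k).2).
have [pf pfP] := least_exists.
pose ok x k := cert k /\ nb q (dec k).1 x.
have ex x : on q J x -> exists k, ok x k.
  move=> ox; have [n [e [we ne He]]] := H x ox.
  by have [k E] := decP e n we; exists k; rewrite /ok /cert E.
exists (fun x => en (dec (pf (ok x))).2); split.
- move=> x ox; have [[ck nk] lk] := pfP _ (ex x ox).
  have n1 : near q J x (fun x' => nb q (dec (pf (ok x))).1 x').
    by exists (dec (pf (ok x))).1; split=> //; case: ck.
  have n2 : near q J x (fun x' => forall j, j < pf (ok x) -> ~ ok x' j).
    apply: near_forall => j /lk nj; have [cj|ncj] := lem (cert j).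
      have := near_not iJ (proj1 cj) ox (fun n => nj (conj cj n)).
      by move=> nn; apply: near_imp nn _ => x' _ nn' [_ /nn'].
    by apply: near_all => x' _ [].
  apply: near_imp (near_and n1 n2) _ => x' ox' [nk' lk'].
  have [o' l'] := pfP _ (ex x' ox').
  suff -> : pf (ok x') = pf (ok x) by [].
  by case: (ltngtP (pf (ok x')) (pf (ok x))) => // [/lk' /(_ o')|/l' []].
- by move=> x ox; have [[[_ ck] nk] _] := pfP _ (ex x ox); apply: ck.
- by move=> x; eexists.
- move=> x x' E; suff -> : ok x = ok x' by [].
  apply: funext => k; apply: propext; split=> -[ck nk]; split=> //.
    by apply: (nb_agree (J := J)) nk => //; case: ck.
  apply: (nb_agree (J := J)) nk => //; first by case: ck.
  by move=> ga qg Jg; rewrite E.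
Qed.

Lemma lc_lab q J p be a : initial J -> sup p be -> (forall ga, lt ga be -> J ga) ->
  (forall ga, sup p ga -> J ga -> sup q ga) ->
  forall x, on q J x -> near q J x (on p J) ->
  near q J x (fun x' => lab p be x' a = lab p be x a).
Proof.
move=> iJ pb bJ pq x ox np.
apply: (near_trans (wfcP p) (wfcP q) iJ pq ox np).
have opx := near_self ox np.
apply: (near_sub bJ (wf_loc (wfcP p) a pb _)).
by apply: on_sub opx.
Qed.

Definition addp p al := Pre (fun be => sup p be \/ be = al)
  (fun be x => if pselect (be = al) then tree0 else lab p be x).

Lemma addp_al p al x : lab (addp p al) al x = tree0.
Proof. by rewrite /=; case: pselect. Qed.
Lemma addp_ne p al be x : be <> al -> lab (addp p al) be x = lab p be x.
Proof. by rewrite /=; case: pselect. Qed.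

Section Add.

Variables (p : cond) (al : K).
Hypothesis np : ~ sup p al.

Let ne be : sup p be -> be <> al.
Proof. by move=> pb E; apply: np; rewrite -E. Qed.

Lemma on_addp J x : on (addp p al) J x -> on p J x.
Proof. by move=> H be pb Jb; rewrite -(addp_ne p x (ne pb)); apply: H => //; left. Qed.

Lemma wfc_addp : wfc (addp p al).
Proof.
split.
- have [en H] := wf_count (wfcP p); exists (fun n => if n is m.+1 then en m else al).
  by move=> be [/H [n <-]|->]; [exists n.+1 | exists 0].
- move=> be x x' E; have [->|be_al] := lem (be = al); first by rewrite !addp_al.
  by rewrite !addp_ne //; apply: (wf_dep (wfcP p)) => ga gb pg; apply: E => //; left.
- move=> be x sb ox; have [->|be_al] := lem (be = al).
    by rewrite !addp_al; apply: OK_tree0.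
  rewrite addp_ne //; apply: (wf_OK (wfcP p)); last exact: on_addp.
  by case: sb.
- move=> be x a sb ox; have [->|be_al] := lem (be = al).
    by apply: near_all => x' _; rewrite !addp_al.
  have pb : sup p be by case: sb.
  have [e [we n H]] := wf_loc (wfcP p) a pb (on_addp ox).
  have nbE y : nb (addp p al) e y <-> nb p e y.
    elim: e we {n H} => //= ga e IH [/ne ne' _ /IH ->]; by case: pselect.
  exists e; split; [|exact/nbE|].
    by elim: e we {n H nbE} => //= ga e IH [pg gb /IH]; split=> //; left.
  by move=> x' ox' /nbE n'; rewrite !addp_ne //; apply: H => //; apply: on_addp.
Qed.

Lemma addp_le : leJ allK (addp p al) p.
Proof. by split=> [be pb _|x]; [left | apply: on_addp]. Qed.

End Add.

Lemma add_exists p al : exists q, le q p /\ sup q al.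
Proof.
have [pal|np] := lem (sup p al); first by exists p; split=> //; apply: le_refl.
by exists (Cond (wfc_addp np)); split; [apply: addp_le | right].
Qed.

Lemma decide p al n : exists q s, [/\ le q p, sup q al, n <= size s &
  forall x, on q allK x -> pref s (x al)].
Proof.
have [p' [p'p p'al]] := add_exists p al.
have [x ox] := on_inh p'; have [c cH] := ox al p'al I.
have n1 := near_node p'al I (cH n).
have n2 : near p' allK x (fun x' => lab p' al x' (mkseq c n) = lab p' al x (mkseq c n)).
  by apply: lc_lab => //; apply: near_all.
have [h [oh H _]] := near_restr (initial_all (lt := lt)) ox (near_and n1 n2).
exists (crestr p' h), (lab p' al x (mkseq c n)); split=> //.
- exact: le_trans (crestr_le _ _) p'p.
- have := OK_size (mkseq c n) (OK_on (initial_all (lt := lt)) p'al I ox).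
  by rewrite size_mkseq.
- by move=> y /H [oy [ay <-]].
Qed.

End Cond.

Arguments cond {K} lt.

(** * Generic conditions over a countable set of names *)

Section Generic.

Context {K : Type} {lt : K -> K -> Prop} {W : WO lt}.
Local Notation cond := (@cond K lt).
Local Notation pt := (@pt K).
Local Notation initial := (@initial K lt).
Local Notation below := (@below K lt).
Local Notation upto := (@upto K lt).
Local Notation wfc := (@wfc K lt).
Hint Resolve wfcP : core.
Local Hint Extern 0 (le _ _) => exact: le_refl : core.
Definition rel := cond -> seq nat -> Prop.
Implicit Types (p q r u : cond) (x y : pt) (J : K -> Prop) (al be ga : K).
Implicit Types (a s : seq nat) (R : rel).

(* [r] forces: if [p] belongs to the generic filter restricted to [J], then so
   does an extension of [p] meeting [R]. *)
Definition refine p R J : rel := fun r s =>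
  (exists p', [/\ le p' p, R p' s & leJ J r p']) \/ ~ exists r', le r' r /\ leJ J r' p.

Definition has_sup be : rel := fun r _ => sup r be.
(** If [u] is in the filter, the filter decides a node of level at least [m] that the generic real
    passes in the tree of [u] at [be]. This makes the branches of a fused tree branches of the trees
    used in building it. *)
Definition passes u be m : rel := fun r _ => forall r', le r' r -> le r' u -> sup u be ->
  exists b, m <= size b /\ forall x, on r' allK x -> pref (lab u be x b) (x be).

Variables (enN : nat -> cond) (enK : nat -> K) (enR : nat -> rel).
Variables (okJ : (K -> Prop) -> Prop) (fh : pt -> nat -> nat).

Definition N p := exists n, enN n = p.
Definition NK be := exists n, enK n = be.
Definition RR R := exists n, enR n = R.

(** The enumerated conditions, coordinates and relations stand for a countable elementary submodel;
    these are the instances of elementarity used. [okJ] selects the initial segments at which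
    genericity is considered. *)
Record closed : Prop := {
  cl_N_sup : forall p be, N p -> sup p be -> NK be;
  cl_N_restr : forall p be a, N p -> NK be -> N (crestr p (at1 be a));
  cl_RR_refine : forall p R J, okJ J -> N p -> RR R -> RR (refine p R J);
  cl_N_refine : forall p R J r s, okJ J -> N p -> RR R -> N r ->
    (exists p', [/\ le p' p, R p' s & leJ J r p']) ->
    exists p', N p' /\ [/\ le p' p, R p' s & leJ J r p'];
  cl_RR_open : forall R r r' s, RR R -> le r' r -> R r s -> R r' s;
  cl_RR_sup : forall be, NK be -> RR (has_sup be);
  cl_RR_passes : forall u be m, N u -> NK be -> RR (passes u be m);
  cl_okJ_init : forall J, okJ J -> initial J;
  cl_okJ_cut : forall J be, okJ J -> NK be -> ~ J be -> okJ (below be) /\ okJ (upto be);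
  cl_okJ_all : okJ allK }.

Hypothesis cl : closed.
Let N_sup := cl_N_sup cl.
Let N_restr := cl_N_restr cl.
Let RR_refine := cl_RR_refine cl.
Let N_refine := cl_N_refine cl.
Let RR_open := cl_RR_open cl.
Let RR_sup := cl_RR_sup cl.
Let RR_passes := cl_RR_passes cl.
Let okJ_init := cl_okJ_init cl.
Let okJ_cut := cl_okJ_cut cl.
Let okJ_all := cl_okJ_all cl.

(** The generic filter that the branch [x] of [q] determines on [J]: [near] says that membership is
    already forced by a finite part of [x]. *)
Definition G q J x p := N p /\ near q J x (on p J).

(** A relation speaks of a condition and of an initial segment of the real [fh x] read from the
    branch, so that genericity also covers the open sets this real has to enter. *)
Definition meets x p R := exists j, R p (mkseq (fh x) j).

Record pregen J q : Prop := {
  gen_sup : forall be, NK be -> J be -> sup q be;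
  gen_sub : forall be, sup q be -> J be;
  gen_fh : forall n, lc q J (fun x => fh x n) }.

(** Genericity is demanded at every branch of [q], the analogue of an (N,P)-generic condition. *)
Record gen J q : Prop := {
  gen_pre :> pregen J q;
  gen_ok : okJ J;
  gen_meet : forall x R, on q J x -> RR R -> exists p, G q J x p /\ meets x p R }.

Lemma G_on q J x p : G q J x p -> on q J x -> on p J x.
Proof. by move=> [_ n] ox; apply: near_self n. Qed.

Lemma G_near q J x p : G q J x p -> near q J x (fun x' => G q J x' p).
Proof. by move=> [Np /near_near n]; apply: near_imp n _. Qed.

Lemma G_leJ q J x p p' : G q J x p -> N p' -> leJ J p p' -> G q J x p'.
Proof. by move=> [Np n] Np' [_ pp']; split=> //; apply: near_imp n _ => x' _ /pp'. Qed.

Lemma G_restr q J x p be a : okJ J -> G q J x p -> NK be -> ~ J be ->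
  G q J x (crestr p (at1 be a)).
Proof.
move=> oJ Gp kb nJ; apply: (G_leJ Gp); first by apply: N_restr => //; case: Gp.
apply: leJ_restr; [exact: okJ_init | exact: wfcP |].
by move=> ga Jg; apply: at1_ne => E; apply: nJ; rewrite -E.
Qed.

Lemma meets_near q J x p R : pregen J q -> on q J x -> meets x p R ->
  near q J x (fun x' => meets x' p R).
Proof.
move=> g ox [j H]; have n : near q J x (fun x' => forall i, i < j -> fh x' i = fh x i).
  by apply: near_forall => i _; apply: (gen_fh g).
apply: near_imp n _ => x' _ E; exists j; suff -> : mkseq (fh x') j = mkseq (fh x) j by [].
apply: (@eq_from_nth _ 0); rewrite !size_mkseq // => i ij.
by rewrite !nth_mkseq // E.
Qed.

(** The filter meets [refine p R J]. The alternative that no extension of the condition found is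
    below [p] on [J] cannot occur: near [x] a restriction of [q] lies below both and can be mixed
    into it. *)
Lemma gen_ext J q x p R : gen J q -> on q J x -> G q J x p -> RR R ->
  exists p', [/\ le p' p, G q J x p' & meets x p' R].
Proof.
move=> g ox [Np np] RRR; have oJ := gen_ok g; have iJ := okJ_init oJ.
have [r [[Nr nr] [j [H|H]]]] := gen_meet g ox (RR_refine oJ Np RRR).
  have [p' [Np' [p'p Rp' rp']]] := N_refine oJ Np RRR Nr H.
  by exists p'; split=> //; [apply: (G_leJ (p := r)) | exists j].
case: H; have [h [oh hH _]] := near_restr iJ ox (near_and np nr).
have sub u : N u -> (forall y, on (crestr q h) J y -> on u J y) -> leJ J (crestr q h) u.
  by move=> Nu H; split=> // be ub Jb; apply: (gen_sup g) => //; apply: N_sup ub.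
have qr : leJ J (crestr q h) r by apply: sub => // y /hH [_ []].
have qp : leJ J (crestr q h) p by apply: sub => // y /hH [_ []].
by exists (cmix iJ qr); split; [apply: mix_le | apply: leJ_trans (mix_leJ _ _ _) qp].
Qed.

Record ext J (q q' : @pre K) : Prop := {
  ext_sup : forall be, J be -> (sup q' be <-> sup q be);
  ext_lab : forall be, J be -> lab q' be = lab q be }.

Lemma ext_on J (q q' : @pre K) x : ext J q q' -> on q' J x <-> on q J x.
Proof.
move=> [es el]; split=> H be sb Jb.
  by have := H be (proj2 (es be Jb) sb) Jb; rewrite el.
by have := H be (proj1 (es be Jb) sb) Jb; rewrite el.
Qed.

Lemma ext_nb J (q q' : @pre K) e x : ext J q q' -> within q J e -> nb q' e x <-> nb q e x.
Proof.
move=> [es el]; elim: e => //= g e IH [qg Jg /IH E].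
by rewrite el // E.
Qed.

Lemma ext_near J J' (q q' : @pre K) x Q : ext J q q' -> (forall be, J be -> J' be) ->
  near q J x Q -> near q' J' x Q.
Proof.
move=> E JJ [e [we ne H]]; exists e; split.
- elim: e we {ne H} => //= g e IH [qg Jg /IH we]; split=> //; last exact: JJ.
  by apply/(ext_sup E).
- exact/(ext_nb _ E we).
- move=> x' ox' /(ext_nb _ E we); apply: H; apply/(ext_on _ E).
  exact: on_sub ox'.
Qed.

Lemma ext_on_sub J J' (q q' : @pre K) x : ext J q q' -> (forall be, J be -> J' be) ->
  on q' J' x -> on q J x.
Proof. by move=> E JJ ox; apply/(ext_on _ E); apply: on_sub ox. Qed.

Lemma ext_sub J J' (q q' : @pre K) : (forall be, J be -> J' be) -> ext J' q q' -> ext J q q'.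
Proof. by move=> JJ [s l]; split=> be /JJ; [apply: s | apply: l]. Qed.

Lemma ext_trans J J' (q q' q'' : @pre K) : (forall be, J be -> J' be) ->
  ext J q q' -> ext J' q' q'' -> ext J q q''.
Proof.
move=> JJ [s l] [s' l']; split=> be Jb; first by rewrite s' ?s //; apply: JJ.
by rewrite l' ?l //; apply: JJ.
Qed.

Lemma ext_refl J (q : @pre K) : ext J q q.
Proof. by []. Qed.

Lemma ext_lc J J' q q' T (f : pt -> T) : ext J q q' -> (forall be, J be -> J' be) ->
  lc q J f -> lc q' J' f.
Proof.
by move=> E JJ H x ox; apply: (ext_near E JJ); apply: H; apply: ext_on_sub ox.
Qed.

(* A name for a condition in the generic filter. *)
Definition named J q (pi : pt -> cond) :=
  lc q J pi /\ forall x, on q J x -> G q J x (pi x).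

(** * Adding one coordinate to a generic condition by fusion *)

Section Step.

Variables (be : K) (q : cond).
Hypotheses (kbe : NK be) (gq : pregen (below be) q) (ok' : okJ (upto be)).
Local Notation J := (below be).
Local Notation rl p x := (lab p be x [::]).
Local Notation ch p x i := (lab p be x [:: i]).

Let iJ : initial J := @initial_below K lt W be.
Let iJ' : initial (upto be) := @initial_upto K lt W be.
Let JJ' ga : J ga -> upto be ga. Proof. by left. Qed.

Definition upd x (z : nat -> nat) : pt := fun ga => if pselect (ga = be) then z else x ga.

Lemma upd_eq x z : upd x z be = z.
Proof. by rewrite /upd; case: pselect. Qed.
Lemma upd_below x z ga : J ga -> upd x z ga = x ga.
Proof. by rewrite /upd; case: pselect => // E gb; case: (lt_irr (a := be)); rewrite -{1}E. Qed.

Lemma lab_upd p x z : lab p be (upd x z) = lab p be x.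
Proof. by apply: (wf_dep (wfcP p)) => ga gb _; apply: upd_below. Qed.

Lemma on_upto p x : sup p be -> on p (upto be) x <-> on p J x /\ Br (lab p be x) (x be).
Proof.
move=> pb; split=> [ox|[ox bx] ga pg [gb|->//]]; last exact: ox.
by split; [apply: on_sub ox | apply: ox => //; right].
Qed.

Lemma on_upd p x z : sup p be -> on p J x -> Br (lab p be x) z -> on p (upto be) (upd x z).
Proof.
move=> pb ox bz; apply/(on_upto _ pb); rewrite lab_upd upd_eq; split=> //.
by apply: (on_agree (x := x) (wfcP p) iJ _ ox) => ga /upd_below ->.
Qed.

Lemma Br_le p p' x z : sup p be -> le p' p -> on p' J x ->
  Br (lab p' be x) z -> Br (lab p be x) z.
Proof.
move=> pb p'p ox bz; have p'b : sup p' be by apply: (proj1 p'p).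
have [_] := proj1 (on_upto _ pb) (proj2 (le_leJ iJ' p'p) _ (on_upd p'b ox bz)).
by rewrite lab_upd upd_eq.
Qed.

Lemma rl_le p p' x : sup p be -> le p' p -> on p' J x ->
  size (rl p x) <= size (rl p' x) -> spref (rl p x) (rl p' x).
Proof.
move=> pb p'p ox sz; have p'b : sup p' be by apply: (proj1 p'p).
have bz := lbranch_Br (wf_OK (wfcP p') p'b ox).
apply: (pref_le (z := lbranch (lab p' be x)) sz).
  by have [c /(_ 0)] := Br_le pb p'p ox bz.
by have [c /(_ 0)] := bz.
Qed.

Lemma rl_restr p x i : lab (crestr p (at1 be [:: i])) be x [::] = ch p x i.
Proof. by rewrite /= /shift_tree at1E. Qed.

Variable Inv : nat -> pt -> cond -> Prop.
Hypothesis Inv_sup : forall d x p, Inv d x p -> sup p be.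

Definition trans d x p (F : seq (seq nat)) n R p' i :=
  [/\ le p' (crestr p (at1 be [:: i])), n <= size (ch p x i),
    forall g, g \in F -> avo (ch p x i) (nth 0 g) (size (rl p x)) n,
    size (ch p x i) <= size (rl p' x) & meets x p' R /\ Inv d.+1 x p'].

Hypothesis next : forall d x p F n R, on q J x -> G q J x p -> Inv d x p ->
  size F <= d.+1 -> RR R ->
  exists i p', G q J x p' /\ near q J x (fun x' => trans d x' p F n R p' i).

(** A node of the fused tree carries a condition chosen continuously in the branch below [be], and
    the number of the child through which it was reached from its predecessor. *)
Definition state := pt -> cond * nat.
Implicit Types st : state.

Definition good d st := [/\ lc q J st, forall x, N (st x).1,
  forall x x', (forall ga, sup q ga -> J ga -> x ga = x' ga) -> st x = st x' &
  forall x, on q J x -> G q J x (st x).1 /\ Inv d x (st x).1].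

Lemma good_next d st (b : pt -> nat) F n : good d st -> lc q J b -> size F <= d.+1 ->
  exists st', good d.+1 st' /\
    forall x, on q J x -> trans d x (st x).1 F (maxn n (b x)) (enR d) (st' x).1 (st' x).2.
Proof.
move=> [l Nst dst H] lb sF.
pose en k : cond * nat := let c : nat * nat := odflt (0, 0) (unpickle k) in (enN c.1, c.2).
have [|st' [l' H' en' d']] := choose_lc (q := q) (J := J) (en := en) (Q := fun x t => G q J x t.1 /\
    trans d x (st x).1 F (maxn n (b x)) (enR d) t.1 t.2) iJ.
  move=> x ox; have [Gx Ix] := H x ox.
  have [|i [p' [Gp' tp']]] := next (maxn n (b x)) (R := enR d) ox Gx Ix sF; first by exists d.
  have [[k ek] _] := Gp'; exists (pickle (k, i)); rewrite /en pickleK /= ek.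
  apply: near_imp (near_and (G_near Gp') (near_and tp' (near_and (l x ox) (lb x ox)))) _.
  by move=> x' _ [G' [t' [-> ->]]].
exists st'; split; last by move=> x /H' [].
split=> //; first by move=> x; have [k ->] := en' x; rewrite /en /=; eexists.
by move=> x /H' [Gx [_ _ _ _ []]].
Qed.

Lemma lc_ch d st (f : pt -> nat) : good d st -> lc q J f ->
  lc q J (fun x => (size (ch (st x).1 x (f x))).+1).
Proof.
move=> [l Nst _ H] lf x ox; have [[Np np] Ix] := H x ox.
have n1 := lc_lab (W := W) [:: f x] iJ (Inv_sup Ix) (fun _ => id)
  (fun ga pg Jg => gen_sup gq (N_sup Np pg) Jg) ox np.
apply: (near_imp (near_and n1 (near_and (l x ox) (lf x ox)))) => x' _ [E [El Ef]].
 by rewrite El Ef E.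
Qed.

Section Tree.

Variables (st0 : state) (good0 : good 0 st0).
Variable nx : nat -> state -> (pt -> nat) -> seq (seq nat) * nat -> state.
Hypothesis nxP : forall d st b F n, good d st -> lc q J b -> size F <= d.+1 ->
  good d.+1 (nx d st b (F, n)) /\
  forall x, on q J x -> trans d x (st x).1 F (maxn n (b x)) (enR d)
    (nx d st b (F, n) x).1 (nx d st b (F, n) x).2.

Definition request d j := (take d.+1 (challenge j).1, (challenge j).2).

(** Each sibling must use a child label longer than that of the sibling before it. Hence siblings
    use different children, and their incompatibility is inherited from the tree of the parent
    condition. *)
Fixpoint kid d st j : state :=
  nx d st (if j is k.+1 then fun x => (size (ch (st x).1 x (kid d st k x).2)).+1
           else fun=> 0) (request d j).

Fixpoint st_rev b := if b is j :: b' then kid (size b') (st_rev b') j else st0.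
Definition stt a := st_rev (rev a).

Lemma stt_rcons a j : stt (rcons a j) = kid (size a) (stt a) j.
Proof. by rewrite /stt rev_rcons /= size_rev. Qed.

Lemma request_size d j : size (request d j).1 <= d.+1.
Proof. by rewrite size_take_min geq_minl. Qed.

Lemma kid_ok d st j : good d st -> good d.+1 (kid d st j) /\
  forall x, on q J x -> trans d x (st x).1 (request d j).1
    (maxn (request d j).2 (if j is k.+1 then (size (ch (st x).1 x (kid d st k x).2)).+1 else 0))
    (enR d) (kid d st j x).1 (kid d st j x).2.
Proof.
move=> gst; elim: j => [|j [IH _]] /=.
  apply: (nxP (b := fun=> 0)) => //.
  by move=> x _; apply: near_all.
apply: (nxP (b := fun x => (size (ch (st x).1 x (kid d st j x).2)).+1)) => //.
  apply: (lc_ch gst); have [l _ _ _] := IH.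
  by move=> x ox; apply: near_imp (l x ox) _ => x' _ ->.
exact: (request_size d j.+1).
Qed.

Lemma stt_good a : good (size a) (stt a).
Proof.
elim/last_ind: a => // a j IH; rewrite stt_rcons size_rcons.
by case: (kid_ok j IH).
Qed.

Lemma stt_G a x : on q J x -> G q J x (stt a x).1 /\ Inv (size a) x (stt a x).1.
Proof. by have [_ _ _ H] := stt_good a; apply: H. Qed.

Lemma stt_sup a x : on q J x -> sup (stt a x).1 be.
Proof. by move=> /(stt_G a) [_ /Inv_sup]. Qed.

Lemma stt_trans a j x : on q J x -> exists n, (request (size a) j).2 <= n /\
  trans (size a) x (stt a x).1 (request (size a) j).1 n (enR (size a))
    (stt (rcons a j) x).1 (stt (rcons a j) x).2.
Proof.
move=> ox; have [_ /(_ x ox) T] := kid_ok j (stt_good a).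
by eexists; split; [|rewrite stt_rcons; apply: T]; rewrite leq_maxl.
Qed.

Lemma stt_ltn a j k x : on q J x -> j < k ->
  size (ch (stt a x).1 x (stt (rcons a j) x).2) < size (ch (stt a x).1 x (stt (rcons a k) x).2).
Proof.
move=> ox; elim: k => // k IH; rewrite ltnS leq_eqVlt => jk.
have {}IH : size (ch (stt a x).1 x (stt (rcons a j) x).2) <=
    size (ch (stt a x).1 x (stt (rcons a k) x).2).
  by case/orP: jk => [/eqP ->|/IH /ltnW].
apply: leq_ltn_trans IH _.
have [_ /(_ x ox) [_ sz _ _ _]] := kid_ok k.+1 (stt_good a).
by rewrite !stt_rcons; apply: leq_trans sz; rewrite leq_maxr.
Qed.

Definition tr x a := rl (stt a x).1 x.

Lemma tr_ch a j x : on q J x ->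
  spref (ch (stt a x).1 x (stt (rcons a j) x).2) (tr x (rcons a j)).
Proof.
move=> ox; have [n [_ [l _ _ sz _]]] := stt_trans a j ox.
rewrite -rl_restr; apply: rl_le => //; last by rewrite rl_restr.
  exact: stt_sup.
by have [Gx _] := stt_G (rcons a j) ox; apply: G_on ox.
Qed.

Lemma stt_OK a x : on q J x -> OK (lab (stt a x).1 be x).
Proof.
move=> ox; apply: (wf_OK (wfcP _)); first exact: stt_sup.
by have [Gx _] := stt_G a ox; apply: G_on ox.
Qed.

Lemma OK_tr x : on q J x -> OK (tr x).
Proof.
move=> ox; split=> [a j|a j k jk|a|a F n sF].
- apply: spref_trans (tr_ch a j ox); exact: (OK_pref (stt_OK a ox) [::]).
- have ne : (stt (rcons a j) x).2 <> (stt (rcons a k) x).2.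
    move=> E; case: (ltngtP j k) => // /(stt_ltn a ox); rewrite E ltnn //.
  have [m [mj mk H]] := OK_inc (stt_OK a ox) [::] ne.
  have [[sj pj] [sk pk]] := (tr_ch a j ox, tr_ch a k ox).
  exists m; rewrite !(leq_trans _ sj) ?(leq_trans _ sk) //; split=> //.
  by rewrite -pj // -pk.
- exact: (OK_stem (stt_OK a ox)).
- exists (pickle (F, n)); have [m [nm [_ sz av _ _]]] := stt_trans a (pickle (F, n)) ox.
  rewrite /request challengeK /= take_oversize // in nm av.
  have [sj pj] := tr_ch a (pickle (F, n)) ox; split; first by rewrite (leq_trans nm) // (leq_trans sz).
  move=> g gF i /andP [ai im]; have im' := leq_trans im nm.
  rewrite -pj; last exact: leq_trans im' sz.
  by apply: av => //; rewrite ai.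
Qed.

Lemma stt_le a b x : on q J x -> le (stt (a ++ b) x).1 (stt a x).1.
Proof.
move=> ox; elim/last_ind: b => [|b j IH]; first by rewrite cats0.
rewrite -rcons_cat; apply: le_trans IH; have [n [_ [l _ _ _ _]]] := stt_trans (a ++ b) j ox.
exact: le_trans l (crestr_le _ _).
Qed.

Lemma tr_loc a x : on q J x -> near q J x (fun x' => tr x' a = tr x a).
Proof.
move=> ox; have [[Np np] Ix] := stt_G a ox; have [l _ _ _] := stt_good a.
have n1 := lc_lab (W := W) [::] iJ (Inv_sup Ix) (fun _ => id)
  (fun ga pg Jg => gen_sup gq (N_sup Np pg) Jg) ox np.
by apply: near_imp (near_and n1 (l x ox)) _ => x' _ [E El]; rewrite /tr El E.
Qed.

Definition step_pre := Pre (fun ga => sup q ga \/ ga = be)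
  (fun ga x => if pselect (ga = be) then tr x else lab q ga x).

Lemma step_ext : ext J q step_pre.
Proof.
split=> ga /= gb; last by case: pselect => // E; case: (lt_irr (a := be)); rewrite -{1}E.
by split=> [[//|E]|]; [case: (lt_irr (a := be)); rewrite -{1}E | left].
Qed.

Lemma step_be x : lab step_pre be x = tr x.
Proof. by rewrite /=; case: pselect. Qed.

Lemma wfc_step : wfc step_pre.
Proof.
have sub ga : sup step_pre ga -> ga <> be -> J ga /\ sup q ga.
  by move=> [qg|//] _; split=> //; apply: (gen_sub gq).
have eb ga : J ga -> ext (below ga) q step_pre.
  by move=> gb; apply: ext_sub step_ext => de dg; apply: (iJ dg gb).
split.
- have [en H] := wf_count (wfcP q); exists (fun n => if n is m.+1 then en m else be).
  by move=> ga [/H [n <-]|->]; [exists n.+1 | exists 0].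
- move=> ga x x' E; have [Eg|ne] := lem (ga = be).
    subst ga; rewrite !step_be; apply: funext => a; rewrite /tr.
    have [_ Nst dst _] := stt_good a; rewrite (dst x x'); last first.
      by move=> de qd Jd; apply: E => //; left.
    congr (_ _); apply: (wf_dep (wfcP _)) => de db sd; apply: E => //.
    by left; apply: (gen_sup gq) => //; apply: N_sup sd.
  rewrite /=; case: pselect => [//|b] /=; apply: (wf_dep (wfcP q)) => de dg qd.
  by apply: E => //; left.
- move=> ga x sg ox; have [Eg|ne] := lem (ga = be).
    by subst ga; rewrite step_be; apply: OK_tr; apply/(ext_on _ step_ext).
  have [gb qg] := sub ga sg ne; rewrite (ext_lab step_ext) //; apply: (wf_OK (wfcP q)) => //.
  exact/(ext_on _ (eb _ gb)).
- move=> ga x a sg ox; have [Eg|ne] := lem (ga = be).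
    subst ga; have oq : on q J x by apply/(ext_on _ step_ext).
    apply: (near_imp (ext_near step_ext (fun _ => id) (tr_loc a oq))) => x' _ E.
    by rewrite !step_be.
  have [gb qg] := sub ga sg ne; rewrite (ext_lab step_ext) //.
  apply: (ext_near (eb _ gb) (fun _ => id)); apply: (wf_loc (wfcP q)) => //.
  exact/(ext_on _ (eb _ gb)).
Qed.

Definition stepq := Cond wfc_step.

(** Further along the branch some condition meets [passes], so it decides a node of high level in
    the tree of the condition at [a]. A still later label of the fused tree is longer than the label
    of that node and compatible with it, so the real passes the node as well. *)
Lemma step_branch a x : on stepq (upto be) x -> pref (tr x a) (x be) ->
  Br (lab (stt a x).1 be x) (x be).
Proof.
move=> ox ax; have oq : on q J x by apply: ext_on_sub step_ext JJ' ox.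
have okx := OK_tr oq; set p := (stt a x).1.
have [c cH] : Br (tr x) (x be) by rewrite -step_be; apply: ox; right.
have [[Np np] _] := stt_G a oq.
have pb : sup p be by apply: stt_sup.
apply: (Br_of (stt_OK a oq)) => m; have [n0 En0] := RR_passes m Np kbe.
have seg n : exists b, mkseq c (maxn n (size a)) = a ++ b.
  by rewrite (mkseq_prefix c (leq_maxr n (size a))) -(Br_node okx cH ax); eexists.
have lp n : le (stt (mkseq c (maxn n (size a))) x).1 p.
  by have [b ->] := seg n; apply: stt_le.
pose n1 := maxn n0.+1 (size a).
have mono i j : i <= j -> le (stt (mkseq c j) x).1 (stt (mkseq c i) x).1.
  by move=> ij; rewrite (mkseq_prefix c ij); apply: stt_le.
have pa : passes p be m (stt (mkseq c n1) x).1 [::].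
  have [j Hj] : meets x (stt (mkseq c n0.+1) x).1 (enR n0).
    have [k [_ [_ _ _ _ [H _]]]] := stt_trans (mkseq c n0) (c n0) oq.
    by move: H; rewrite -mkseqS size_mkseq.
  have := RR_open (ex_intro _ n0 erefl) (mono _ _ (leq_maxl n0.+1 (size a))) Hj.
  by rewrite En0.
have [b [mb bH]] := pa _ (le_refl _) (lp _) pb; exists b; split=> //.
pose n2 := maxn n1 (size (lab p be x b)).
have [G2 I2] := stt_G (mkseq c n2) oq.
have o2 := G_on G2 oq.
have [y [oy Ey]] := on_extend iJ o2.
have Ep u : lab u be y = lab u be x by apply: (wf_dep (wfcP u)) => ga gb _; apply: Ey.
have y1 : pref (lab p be x b) (y be).
  rewrite -(Ep p); apply: bH; apply: (proj2 (mono _ _ (leq_maxl _ _))) oy.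
have y2 : pref (tr x (mkseq c n2)) (y be).
  rewrite /tr -(Ep (stt (mkseq c n2) x).1); have [c' /(_ 0) //] := oy be (stt_sup _ oq) I.
apply: pref_spref (cH n2); apply: pref_le y1 y2.
apply: leq_trans (leq_maxr n1 _) _; rewrite -/n2 -[n2 in n2 <= _](size_mkseq c).
exact: OK_size.
Qed.

Lemma step_G a x : on stepq (upto be) x -> pref (tr x a) (x be) ->
  G stepq (upto be) x (stt a x).1.
Proof.
move=> ox ax; have oq : on q J x by apply: ext_on_sub step_ext JJ' ox.
have [[Np np] _] := stt_G a oq; split=> //.
have [l _ _ _] := stt_good a.
have n1 := ext_near step_ext JJ' (near_and np (l x oq)).
have sb : sup stepq be by right.
have n2 : near stepq (upto be) x (fun x' => pref (lab stepq be x' a) (x' be)).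
  by apply: near_node => //; [right | rewrite step_be].
apply: near_imp (near_and n1 n2) _ => x' ox' [[op E] ax'].
apply/on_upto; first exact: stt_sup.
split=> //; rewrite -E; apply: step_branch => //.
by rewrite -step_be.
Qed.

Lemma step_nodes x n : on stepq (upto be) x -> exists a,
  [/\ size a = n, pref (tr x a) (x be) & G stepq (upto be) x (stt a x).1].
Proof.
move=> ox; have [c cH] : Br (tr x) (x be) by rewrite -step_be; apply: ox; right.
exists (mkseq c n); split; [by rewrite size_mkseq | exact: cH |].
by apply: step_G.
Qed.

Lemma step_gen : gen (upto be) stepq.
Proof.
split=> //.
- split.
  + by move=> ga kg [gb|->]; [left; apply: (gen_sup gq) | right].
  + by move=> ga [/(gen_sub gq)|->]; [left | right].
  + by move=> n; apply: (ext_lc (q' := stepq) step_ext JJ'); apply: (gen_fh gq).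
- move=> x _ ox [n <-]; have oq : on q J x by apply: ext_on_sub step_ext JJ' ox.
  have [a [sa _ Ga]] := step_nodes n.+1 ox; exists (stt a x).1; split=> //.
  case/lastP: a sa {Ga} => // a j; rewrite size_rcons => -[<-].
  by have [k [_ [_ _ _ _ []]]] := stt_trans a j oq.
Qed.

End Tree.

Lemma step (st0 : state) : good 0 st0 -> exists q', [/\ gen (upto be) q', ext J q q',
  forall x, on q' (upto be) x -> G q' (upto be) x (st0 x).1 &
  forall x n, on q' (upto be) x -> exists p, [/\ G q' (upto be) x p, Inv n x p,
    n <= size (rl p x) & pref (rl p x) (x be)]].
Proof.
move=> g0.
have /choice [nx nxP] : forall t : nat * state * (pt -> nat) * (seq (seq nat) * nat),
    exists st', good t.1.1.1 t.1.1.2 -> lc q J t.1.2 -> size t.2.1 <= t.1.1.1.+1 ->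
    good t.1.1.1.+1 st' /\ forall x, on q J x -> trans t.1.1.1 x (t.1.1.2 x).1 t.2.1
      (maxn t.2.2 (t.1.2 x)) (enR t.1.1.1) (st' x).1 (st' x).2.
  move=> [[[d st] b] [F n]] /=.
  have [[g [l sF]]|H] := lem (good d st /\ lc q J b /\ size F <= d.+1).
    by have [st' H] := good_next n g l sF; exists st'.
  by exists st => g l sF; case: H.
pose nx' d st b c := nx (d, st, b, c).
have P d st b F n : good d st -> lc q J b -> size F <= d.+1 ->
  good d.+1 (nx' d st b (F, n)) /\
  forall x, on q J x -> trans d x (st x).1 F (maxn n (b x)) (enR d)
    (nx' d st b (F, n) x).1 (nx' d st b (F, n) x).2 by apply: (nxP (d, st, b, (F, n))).
exists (stepq g0 P); split.
- exact: step_gen.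
- exact: step_ext.
- move=> x ox; have [a [/size0nil -> _ //]] := step_nodes 0 ox.
- move=> x n ox; have oq : on q J x by apply: (ext_on_sub _ JJ' ox); apply: step_ext.
  have [a [sa ax Ga]] := step_nodes n ox; exists (stt st0 nx' a x).1; split=> //.
  + by have [_] := stt_G g0 P a oq; rewrite sa.
  + by rewrite -sa; apply: (OK_size (L := tr st0 nx' x)); apply: OK_tr.
Qed.

End Step.

End Generic.

(** * Generic conditions along countable supports *)

Section Limit.

Context {K : Type} {lt : K -> K -> Prop} {W : WO lt}.
Local Notation cond := (@cond K lt).
Local Notation pt := (@pt K).
Local Notation initial := (@initial K lt).
Local Notation below := (@below K lt).
Local Notation upto := (@upto K lt).
Local Notation wfc := (@wfc K lt).
Hint Resolve wfcP : core.
Local Hint Extern 0 (le _ _) => exact: le_refl : core.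
Implicit Types (p q r u : cond) (x y : pt) (J : K -> Prop) (al be ga : K).
Implicit Types (a s : seq nat) (R : @rel K lt).

Definition roomy be d p := forall x, on p (below be) x -> forall (F : seq (seq nat)) n,
  size F <= d -> exists i, n <= size (lab p be x [:: i]) /\
    forall g, g \in F -> avo (lab p be x [:: i]) (nth 0 g) (size (lab p be x [::])) n.

(** A node of level [k] dodges [k.+1] functions, so room can be increased at will by descending,
    here along the leftmost path. *)
Lemma roomy_restr be p k : sup p be -> roomy be k.+1 (crestr p (at1 be (nseq k 0))).
Proof.
move=> pb x /(proj2 (le_leJ (@initial_below _ _ _ _) (crestr_le p (at1 be (nseq k 0))))) ox F n sF.
have [|i H] := OK_avo (wf_OK (wfcP p) pb ox) (a := nseq k 0) (F := F) n.
  by rewrite size_nseq.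
by exists i; rewrite /= /shift_tree at1E cats0 cats1.
Qed.

Lemma lab_restr be p a x : lab (crestr p (at1 be a)) be x [::] = lab p be x a.
Proof. by rewrite /= /shift_tree at1E cats0. Qed.

Variables (enN : nat -> cond) (enK : nat -> K) (enR : nat -> @rel K lt).
Variables (okJ : (K -> Prop) -> Prop) (fh : pt -> nat -> nat).
Hypothesis cl : closed enN enK enR okJ.
Local Notation NK := (NK enK).
Local Notation RR := (RR enR).
Local Notation G := (G enN).
Local Notation meets := (meets fh).
Local Notation gen := (gen enN enK enR okJ fh).
Local Notation named := (named enN).

Definition plain be d x p := sup p be /\ roomy be d.+1 p.

Lemma lab_near J q be p a x : initial J -> pregen enK fh J q -> on q J x -> G q J x p -> sup p be ->
  (forall ga, lt ga be -> J ga) -> near q J x (fun x' => lab p be x' a = lab p be x a).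
Proof.
move=> iJ g ox [Np np] pb bJ; apply: lc_lab => //.
by move=> ga pg Jg; apply: (gen_sup g) => //; apply: (cl_N_sup cl Np).
Qed.

Lemma plain_next be q : NK be -> gen (below be) q ->
  forall d x p F n R, on q (below be) x -> G q (below be) x p -> plain be d x p ->
  size F <= d.+1 -> RR R -> exists i p', G q (below be) x p' /\
    near q (below be) x (fun x' => trans fh be (plain be) d x' p F n R p' i).
Proof.
move=> kb g d x p F n R ox Gp [pb rp] sF RRR; have iJ := @initial_below K lt W be.
have nb : ~ below be be := @lt_irr K lt W be.
have [i [ni av]] := rp x (G_on Gp ox) F n sF.
have [p2 [p2p G2 m2]] := gen_ext cl g ox (G_restr cl [:: i] (gen_ok g) Gp kb nb) RRR.
have p2b : sup p2 be by apply: (proj1 p2p).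
(* Level [k] gives the room [d.+2] of the next invariant and a root label at least as long as the
   label of child [i]. *)
pose k := maxn d.+1 (size (lab p be x [:: i])).
exists i, (crestr p2 (at1 be (nseq k 0))).
have G3 := G_restr cl (nseq k 0) (gen_ok g) G2 kb nb; split=> //.
have n1 := lab_near [:: i] iJ g ox Gp pb (fun _ => id).
have n2 := lab_near [::] iJ g ox Gp pb (fun _ => id).
apply: near_imp (near_and n1 (near_and n2 (near_and (meets_near g ox m2) (proj2 G2)))) _.
move=> x' ox' [E1 [E2 [m2' o2]]]; split; rewrite ?E1 ?E2 //.
- exact: le_trans (crestr_le _ _) p2p.
- rewrite lab_restr (leq_trans _ (OK_size _ (wf_OK (wfcP p2) p2b o2))) //.
  by rewrite size_nseq leq_maxr.
- split; first by have [j Hj] := m2'; exists j; apply: (cl_RR_open cl RRR _ Hj); apply: crestr_le.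
  split=> // y oy F' n' sF'; apply: (roomy_restr (k := k) p2b oy).
  by apply: leq_trans sF' _; rewrite ltnS leq_maxl.
Qed.

Lemma step_named be q pi : NK be -> gen (below be) q -> okJ (upto be) ->
  named (below be) q pi -> exists q', [/\ gen (upto be) q', ext (below be) q q' &
    forall x, on q' (upto be) x -> G q' (upto be) x (pi x)].
Proof.
move=> kb g ok' [lpi Gpi]; have iJ := @initial_below K lt W be.
have nb : ~ below be be := @lt_irr K lt W be.
pose en k : cond * nat := (enN k, 0).
have [|st [l H en' dp]] := choose_lc (q := q) (J := below be) (en := en) (Q := fun x t =>
    [/\ G q (below be) x t.1, le t.1 (pi x) & plain be 0 x t.1]) iJ.
  move=> x ox; have [p [pp Gp [j sp]]] := gen_ext cl g ox (Gpi x ox) (cl_RR_sup cl kb).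
  have Gp' := G_restr cl [::] (gen_ok g) Gp kb nb.
  have [[k ek] _] := Gp'; exists k; rewrite /en /= ek.
  apply: near_imp (near_and (G_near Gp') (lpi x ox)) _ => x' _ [G' E]; split=> //.
    by rewrite E; apply: le_trans pp; apply: crestr_le.
  by split=> //; apply: (@roomy_restr be p 0).
have gd : good enN be q (plain be) 0 st.
  split=> //; first by move=> x; have [k ->] := en' x; exists k.
  by move=> x /H [].
have [q' [g' e' H' _]] := step cl kb g ok' (Inv := plain be) (fun d x p pl => proj1 pl)
  (plain_next kb g) gd.
exists q'; split=> // x ox; have oq : on q (below be) x.
  by apply: (ext_on_sub e' _ ox) => ga; left.
have [_ lst _] := H x oq; apply: (G_leJ (H' x ox)); first by case: (Gpi x oq).
by apply: le_leJ lst; apply: initial_upto.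
Qed.

(** The induction statement of the preservation theorem for countable supports. That the prescribed
    name stays in the filter is what allows descending sequences of names to be threaded through
    limits. *)
Definition GE J' := forall J q pi, (forall be, J be -> J' be) -> gen J q -> named J q pi ->
  exists q', [/\ gen J' q', ext J q q' & forall x, on q' J' x -> G q' J' x (pi x)].

Section Lim.

Variable J' : K -> Prop.
Hypothesis okJ' : okJ J'.
Hypothesis IH : forall ga, NK ga -> J' ga -> okJ (below ga) -> GE (below ga).
Let iJ' : initial J' := cl_okJ_init cl okJ'.

Definition stage := ((K -> Prop) * cond * (pt -> cond))%type.
Definition sJ (t : stage) := t.1.1.
Definition sq (t : stage) := t.1.2.
Definition spi (t : stage) := t.2.
Definition sok (t : stage) := [/\ forall be, sJ t be -> J' be, gen (sJ t) (sq t) &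
  named (sJ t) (sq t) (spi t)].
Definition snext n (t t' : stage) := [/\ forall be, sJ t be -> sJ t' be,
  J' (enK n) -> sJ t' (enK n), ext (sJ t) (sq t) (sq t') &
  forall x, on (sq t') (sJ t') x -> le (spi t' x) (spi t x) /\ meets x (spi t' x) (enR n)].

(** First the name is strengthened to meet the [n]-th relation. If coordinate [enK n] is still
    missing, the domain is then extended to everything below it by the induction hypothesis and
    across it by [step_named]. *)
Lemma stage_next n t : sok t -> exists t', sok t' /\ snext n t t'.
Proof.
case: t => [[J q] pi] [JJ' g [lpi Gpi]]; rewrite /sJ /sq /spi /= in JJ' g lpi Gpi *.
have iJ : initial J := cl_okJ_init cl (gen_ok g).
have [|pi1 [l1 H1 _ _]] := choose_lc (q := q) (J := J) (en := enN) (Q := fun x p =>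
    [/\ G q J x p, le p (pi x) & meets x p (enR n)]) iJ.
  move=> x ox; have [|p [pp Gp mp]] := gen_ext cl (R := enR n) g ox (Gpi x ox); first by exists n.
  have [[k ek] _] := Gp; exists k; rewrite ek.
  apply: near_imp (near_and (G_near Gp) (near_and (meets_near g ox mp) (lpi x ox))) _.
  by move=> x' _ [Gp' [mp' E]]; split=> //; rewrite E.
have nm : named J q pi1 by split=> // x /H1 [].
have [[J'n nJ]|C] := lem (J' (enK n) /\ ~ J (enK n)); last first.
  exists (J, q, pi1); split=> //; split=> //=; last by move=> x /H1 [].
  by move=> J'n; apply: contrapT => nJ; apply: C.
have kn : NK (enK n) by exists n.
have [okb oku] := cl_okJ_cut cl (gen_ok g) kn nJ.
have Jb be : J be -> below (enK n) be.
  move=> Jbe; have [//|[E|nb]] := lt_total be (enK n); case: nJ; first by rewrite -E.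
  exact: iJ nb Jbe.
have [q1 [g1 e1 G1]] := IH kn J'n okb Jb g nm.
have nm1 : named (below (enK n)) q1 pi1.
  by split=> //; apply: (ext_lc e1 Jb).
have [q2 [g2 e2 G2]] := step_named kn g1 oku nm1.
have l2 ga : below (enK n) ga -> upto (enK n) ga by left.
have e3 : ext J q q2 := ext_trans Jb e1 e2.
have J2 ga : J ga -> upto (enK n) ga by move=> /Jb /l2.
exists (upto (enK n), q2, pi1); split; split=> //=.
- by move=> be [nb|->] //; apply: iJ' nb J'n.
- by split=> //; apply: (ext_lc e3 J2).
- by right.
- by move=> x /(ext_on_sub e3 J2) /H1 [].
Qed.

Section Union.

Variable t : nat -> stage.
Hypotheses (tok : forall n, sok (t n)) (tnext : forall n, snext n (t n) (t n.+1)).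
Let Jn n := sJ (t n).
Let qn n := sq (t n).
Let pn n := spi (t n).

Lemma stage_J m n be : m <= n -> Jn m be -> Jn n be.
Proof.
move=> /subnKC <-; elim: (n - m) => [|k IHk]; first by rewrite addn0.
by rewrite addnS => /IHk; have [H _ _ _] := tnext (m + k); apply: H.
Qed.

Lemma stage_ext m n : m <= n -> ext (Jn m) (qn m) (qn n).
Proof.
move=> /subnKC <-; elim: (n - m) => [|k IHk]; first by rewrite addn0; apply: ext_refl.
rewrite addnS; have [_ _ e _] := tnext (m + k); apply: (ext_trans _ IHk e) => be.
by apply: stage_J; apply: leq_addr.
Qed.

Lemma stage_le m n x : m <= n -> on (qn n) (Jn n) x -> le (pn n x) (pn m x).
Proof.
move=> /subnKC <-; elim: (n - m) => [|k IHk]; first by rewrite addn0.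
rewrite addnS => ox; have [s _ e H] := tnext (m + k).
by have [l _] := H x ox; apply: (le_trans l); apply: IHk; apply: ext_on_sub e s ox.
Qed.

Lemma Jn_init n : initial (Jn n).
Proof. by have [_ g _] := tok n; apply: (cl_okJ_init cl (gen_ok g)). Qed.

Lemma index_exists : exists ix : K -> nat, forall n be, Jn n be -> Jn (ix be) be.
Proof.
suff /choice [ix H] : forall be, exists k, forall n, Jn n be -> Jn k be.
  by exists ix => n be; apply: H.
move=> be; have [[k Jk]|C] := lem (exists k, Jn k be); first by exists k.
by exists 0 => n Jb; case: C; exists n.
Qed.

Section Q.

Variable ix : K -> nat.
Hypothesis ixP : forall n be, Jn n be -> Jn (ix be) be.

Definition lim_pre := Pre (fun be => Jn (ix be) be /\ sup (qn (ix be)) be)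
  (fun be => lab (qn (ix be)) be).

Lemma lim_ext n : ext (Jn n) (qn n) lim_pre.
Proof.
have H be : Jn n be -> (sup (qn (ix be)) be <-> sup (qn n) be) /\
    lab (qn (ix be)) be = lab (qn n) be.
  move=> Jb; have Jb' := ixP Jb.
  have [le|le] := leqP n (ix be).
    by have [s l] := stage_ext le; split; [apply: s | apply: l].
  have [s l] := stage_ext (ltnW le); split; last by rewrite l.
  by split=> /s; apply.
by split=> be Jb; have [s l] := H be Jb => //=; rewrite -s; split=> [[]|] //; split=> //; apply: ixP Jb.
Qed.

Lemma lim_in be : sup lim_pre be -> exists n, Jn n be /\ sup (qn n) be.
Proof. by case=> J s; exists (ix be). Qed.

Lemma wfc_lim : wfc lim_pre.
Proof.
have eb n be : Jn n be -> ext (below be) (qn n) lim_pre.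
  by move=> Jb; apply: ext_sub (lim_ext n) => ga gb; apply: (Jn_init gb Jb).
split.
- have /choice [en H] n := wf_count (wfcP (qn n)).
  exists (fun k => let c : nat * nat := odflt (0, 0) (unpickle k) in en c.1 c.2).
  move=> be /lim_in [n [_ /H [k E]]]; exists (pickle (n, k)); by rewrite pickleK.
- move=> be x x' E /=; apply: (wf_dep (wfcP _)) => ga gb sg; apply: E => //.
  have [Jb|nJ] := lem (Jn (ix be) be).
    by apply/(ext_sup (eb _ _ Jb)).
  have [n Jg] : exists n, Jn n ga.
    by exists (ix be); have [_ g _] := tok (ix be); apply: (gen_sub g).
  have Jg' : Jn (ix be) ga by have [_ g _] := tok (ix be); apply: (gen_sub g).
  by apply/(ext_sup (lim_ext (ix be))).
- move=> be x /lim_in [n [Jb sb]] ox; rewrite (ext_lab (lim_ext n)) //.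
  by apply: (wf_OK (wfcP _)) => //; apply/(ext_on _ (eb _ _ Jb)).
- move=> be x a /lim_in [n [Jb sb]] ox; rewrite (ext_lab (lim_ext n)) //.
  apply: (ext_near (eb _ _ Jb) (fun _ => id)); apply: (wf_loc (wfcP _)) => //.
  exact/(ext_on _ (eb _ _ Jb)).
Qed.

Definition limq := Cond wfc_lim.

Let Jsub n be : Jn n be -> J' be.
Proof. by have [H _ _] := tok n; apply: H. Qed.

Let on_n n x : on limq J' x -> on (qn n) (Jn n) x.
Proof. by move=> ox; apply: (ext_on_sub (lim_ext n) (@Jsub n)). Qed.

(** The support of the name lies in the enumerated coordinates. The [k]-th one, if it is in [J'], is
    absorbed by stage [k.+1], whose name is below all earlier ones, so every tree of the name is
    respected in the limit. *)
Lemma lim_G n x : on limq J' x -> G limq J' x (pn n x).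
Proof.
move=> ox; have [_ _ [l Gn]] := tok n; have Gx := Gn x (on_n (n := n) ox).
split; first by case: Gx.
apply: near_imp (ext_near (lim_ext n) (@Jsub n) (l x (on_n (n := n) ox))) _ => x' ox' E be pb Jb.
have [Np _] := Gx; have [k ek] := cl_N_sup cl Np pb; subst be.
have Jm : Jn (maxn n k.+1) (enK k).
  apply: (@stage_J k.+1); first exact: leq_maxr.
  by have [_ H _ _] := tnext k; apply: H.
set m := maxn n k.+1 in Jm; have [_ _ [_ Gm]] := tok m.
have om := on_n (n := m) ox'; have := G_on (Gm x' om) om.
have l' := stage_le (leq_maxl n k.+1) om.
move/(proj2 (le_leJ (@Jn_init m) l')).
have E' : pn n x' = pn n x by []; rewrite -E' in pb *.
by move=> H; apply: H.
Qed.

Lemma lim_gen : gen J' limq.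
Proof.
split=> //; first split.
- move=> be [k <-] Jb; have Jk : Jn k.+1 (enK k) by have [_ H _ _] := tnext k; apply: H.
  have [_ g _] := tok k.+1.
  by apply/(ext_sup (lim_ext k.+1)) => //; apply: (gen_sup g) => //; exists k.
- by move=> be /lim_in [n [/Jsub]].
- move=> n; apply: (ext_lc (q := qn 0) (q' := limq) (lim_ext 0) (@Jsub 0)).
  by have [_ g _] := tok 0; apply: (gen_fh g).
- move=> x _ ox [n <-]; exists (pn n.+1 x); split; first exact: lim_G.
  by have [_ _ _ H] := tnext n; apply: (proj2 (H x _)); apply: (on_n (n := n.+1)).
Qed.

End Q.

End Union.

Lemma limit : GE J'.
Proof.
move=> J q pi JJ g nm.
have ok0 : sok (J, q, pi) by [].
have /choice [nx nxP] : forall c : nat * stage, exists t', sok c.2 -> sok t' /\ snext c.1 c.2 t'.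
  move=> [n t]; have [ok|no] := lem (sok t); last by exists t => /no.
  by have [t' H] := stage_next n ok; exists t'.
pose t := fix t n := if n is m.+1 then nx (m, t m) else (J, q, pi).
have tok n : sok (t n) by elim: n => // n IHn; have [] := nxP (n, t n) IHn.
have tn n : snext n (t n) (t n.+1) by have [] := nxP (n, t n) (tok n).
have [ix ixP] := index_exists t.
exists (limq tok tn ixP); split.
- exact: lim_gen.
- exact: (lim_ext tn ixP 0).
- by move=> x ox; exact: (lim_G 0 ox).
Qed.

End Lim.

Lemma extend_below ga : NK ga -> okJ (below ga) -> GE (below ga).
Proof.
elim: ga / (lt_wf ga) => ga _ IH kg ok.
by apply: limit => // de kd dg okd; apply: IH.
Qed.

Lemma extend_all : GE allK.
Proof. by apply: limit (cl_okJ_all cl) _ => ga kg _; apply: extend_below. Qed.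

End Limit.

(** * Countable hulls under finitary operations *)

Section Skolem.

Variables (U : Type) (F : nat -> seq U -> U).

Fixpoint evalt (t : GenTree.tree nat) : U :=
  match t with
  | GenTree.Leaf i => F i [::]
  | GenTree.Node i l => F i (map evalt l)
  end.

(** Terms over countably many operations are finite trees labelled by numbers, hence can be
    enumerated. *)
Definition closure (k : nat) : U := evalt (odflt (GenTree.Leaf 0) (unpickle k)).

Fixpoint inrange (l : seq U) : Prop :=
  if l is u :: l' then (exists k, closure k = u) /\ inrange l' else True.

Lemma closureP i l : inrange l -> exists k, closure k = F i l.
Proof.
move=> H; have [lt <-] : exists lt, map evalt lt = l.
  elim: l H => [|u l IH] /=; first by exists [::].
  by case=> -[k <-] /IH [lt <-]; exists (odflt (GenTree.Leaf 0) (unpickle k) :: lt).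
by exists (pickle (GenTree.Node i lt)); rewrite /closure pickleK.
Qed.

Lemma closure_ind (Q : U -> Prop) : (forall i l, Q (F i l)) -> forall k, Q (closure k).
Proof. by move=> H k; rewrite /closure; case: (odflt _ _) => [i|i l] /=; apply: H. Qed.

End Skolem.

(** * A countable closed family of conditions, dense sets and relations *)

Section Names.

Context {K : Type} {lt : K -> K -> Prop} {W : WO lt}.
Local Notation cond := (@cond K lt).
Local Notation pt := (@pt K).
Local Notation initial := (@initial K lt).
Local Notation below := (@below K lt).
Local Notation upto := (@upto K lt).
Local Notation wfc := (@wfc K lt).
Local Notation rel := (@rel K lt).
Hint Resolve wfcP : core.
Local Hint Extern 0 (le _ _) => exact: le_refl : core.
Implicit Types (p q r u : cond) (x y : pt) (J : K -> Prop) (be ga : K).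
Implicit Types (a s : seq nat) (R : rel) (D : cond -> Prop).

Definition openD D := forall r r', le r' r -> D r -> D r'.
Definition denseD D := forall r, exists r', le r' r /\ D r'.
Definition goodD D := openD D /\ denseD D.

Variable al : K.

Definition keeps_off r s := sup r al /\ forall x, on r allK x -> avo s (x al) 0 (size s).

Definition openR R := forall r r' s, le r' r -> R r s -> R r' s.
(** Density is asked only for sequences that the generic real at [al] does not move to an excluded
    value, since only these can begin a real whose translate lies in [C_EK]. *)
Definition denseR R := forall r s, stem s -> keeps_off r s ->
  exists r' s', [/\ le r' r, spref s s', stem s', keeps_off r' s' & R r' s'].
Definition goodR R := openR R /\ denseR R.

Definition Drel D : rel := fun r _ => D r.
Definition refineD p D J r := refine p (Drel D) J r [::].

(** A dense set of conditions alone that represents [R] before any real is available: enough of the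
    generic real is decided to see either that [s1] collides with it or that [s1] can be continued
    into [R] without collision. *)
Definition hits (s1 : seq nat) R r := stem s1 -> exists s, [/\ size s1 <= size s,
  forall x, on r allK x -> pref s (x al) &
  ~ avo s1 (nth 0 s) 0 (size s1) \/ exists s2, [/\ spref s1 s2, stem s2,
    size s2 <= size s, avo s2 (nth 0 s) 0 (size s2) & R r s2]].

Lemma keeps_off_leJ J p r s : J al -> initial J -> leJ J r p ->
  keeps_off p s -> keeps_off r s.
Proof.
move=> Jal iJ rp [pal H]; split=> [|x ox]; first exact: (proj1 rp).
have [y [oy E]] := on_extend iJ (proj2 rp x (on_sub (fun _ _ => I) ox)).
by rewrite -E //; apply: H.
Qed.

Lemma keeps_off_le p r s : le r p -> keeps_off p s -> keeps_off r s.
Proof. exact: keeps_off_leJ. Qed.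

Lemma open_refine p R J : initial J -> openR (refine p R J).
Proof.
move=> iJ r r' s r'r [[p' [p'p Rp' rp']]|H]; [left|right].
  by exists p'; split=> //; apply: (leJ_trans (le_leJ iJ r'r) rp').
by move=> [u [ur' up]]; apply: H; exists u; split=> //; apply: (le_trans ur' r'r).
Qed.

(** If an extension of [r] is below [p] on [J], its part on [J] followed by [p] is a condition below
    [p]. That condition is strengthened into [D], and the part of the result on [J] is put in front
    of the extension of [r]. *)
Lemma good_refineD p D J : initial J -> goodD D -> goodD (refineD p D J).
Proof.
move=> iJ [oD dD]; split=> [r r'|r].
  exact: (open_refine (R := Drel D) iJ).
have [[r1 [r1r r1p]]|H] := lem (exists r', le r' r /\ leJ J r' p); last first.
  by exists r; split=> //; right.
have [p' [p'm Dp']] := dD (cmix iJ r1p).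
have p'r1 : leJ J p' r1 by apply: (leJ_trans (le_leJ iJ p'm)); apply: cmix_leJ.
exists (cmix iJ p'r1); split; first exact: (le_trans (cmix_le iJ p'r1) r1r).
left; exists p'; split=> //; last exact: cmix_leJ.
exact: (le_trans p'm (cmix_le iJ r1p)).
Qed.

Lemma good_refine p R J : initial J -> J al -> goodR R -> goodR (refine p R J).
Proof.
move=> iJ Jal [oR dR]; split=> [|r s ss ks]; first exact: open_refine.
have [[r1 [r1r r1p]]|H] := lem (exists r', le r' r /\ leJ J r' p); last first.
  by exists r, s; split=> //; right.
have km : keeps_off (cmix iJ r1p) s.
  by apply: (keeps_off_leJ Jal iJ (cmix_leJ iJ r1p)); apply: keeps_off_le r1r ks.
have [p' [s' [p'm ss' st' k' Rp']]] := dR _ _ ss km.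
have p'r1 : leJ J p' r1 by apply: (leJ_trans (le_leJ iJ p'm)); apply: cmix_leJ.
exists (cmix iJ p'r1), s'; split=> //; first exact: (le_trans (cmix_le iJ p'r1) r1r).
  exact: (keeps_off_leJ Jal iJ (cmix_leJ iJ p'r1)).
left; exists p'; split=> //; last exact: cmix_leJ.
exact: (le_trans p'm (cmix_le iJ r1p)).
Qed.

Lemma good_sup be : goodD (fun r => sup r be).
Proof.
split=> [r r' [s _] rb|r]; first exact: s.
exact: add_exists.
Qed.

Lemma good_passes u be m : goodD (fun r => passes u be m r [::]).
Proof.
split=> [r r' r'r H v vr'|r]; first by apply: H; apply: (le_trans vr' r'r).
have [[v [vr vu ub]]|H] := lem (exists v, [/\ le v r, le v u & sup u be]); last first.
  by exists r; split=> // s sr su ub; case: H; exists s.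
have [x ox] := on_inh v; have [c cH] := proj2 vu x ox be ub I.
have n := near_node ub I (cH m).
have {}n := near_leJ (W := W) (wfcP u) (wfcP v) (@initial_all _ lt) vu ox n.
have [h [_ H _]] := near_restr (@initial_all _ lt) ox n.
exists (crestr v h); split; first exact: (le_trans (crestr_le _ _) vr).
move=> r' r'v _ _; exists (mkseq c m); rewrite size_mkseq; split=> // y oy.
by have [] := H y (proj2 r'v y oy).
Qed.

Lemma good_hits s1 R : goodR R -> goodD (hits s1 R).
Proof.
move=> [oR dR]; split=> [r r' r'r H|r].
  move=> /H [s [sz sx [na|[s2 [a b c d e]]]]]; exists s; split=> //.
  - by move=> x /(proj2 r'r) /sx.
  - by left.
  - by move=> x /(proj2 r'r) /sx.
  - by right; exists s2; split=> //; apply: oR r'r e.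
have [ss1|ns] := lem (stem s1); last by exists r; split=> // /ns.
have [r1 [s [r1r r1al sz sH]]] := decide r al (size s1).
have [av|na] := lem (avo s1 (nth 0 s) 0 (size s1)); last first.
  by exists r1; split=> // _; exists s; split=> //; left.
have k1 : keeps_off r1 s1.
  split=> // x ox m ms; rewrite -(sH x ox); first exact: av.
  by apply: leq_trans sz; case/andP: ms.
have [r2 [s2 [r2r1 s12 ss2 k2 R2]]] := dR _ _ ss1 k1.
have [r3 [s3 [r3r2 r3al sz3 s3H]]] := decide r2 al (maxn (size s1) (size s2)).
exists r3; split; first exact: le_trans r3r2 (le_trans r2r1 r1r).
move=> _; exists s3; split=> //; first exact: leq_trans (leq_maxl _ _) sz3.
right; exists s2; split=> //.
- exact: leq_trans (leq_maxr _ _) sz3.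
- have [x ox] := on_inh r3; move=> m ms; rewrite (s3H x ox).
    exact: (proj2 (keeps_off_le r3r2 k2)).
  apply: leq_trans (leq_trans (leq_maxr _ _) sz3); by case/andP: ms.
- exact: oR r3r2 R2.
Qed.

Lemma good_Drel D : goodD D -> goodR (Drel D).
Proof.
move=> [oD dD]; split=> [r r' s|r s ss ks]; first exact: oD.
have [r' [r'r Dr']] := dD r; exists r', s; split=> //.
exact: keeps_off_le r'r ks.
Qed.

Variables (p1 : cond) (uD : nat -> cond -> Prop) (uR : nat -> rel).
Hypotheses (uDP : forall n, goodD (uD n)) (uRP : forall n, goodR (uR n)).

Definition cut n be : K -> Prop :=
  match n with 0 => below be | 1 => upto be | 2 => allK | _ => fun=> False end.

Lemma initial_cut n be : initial (cut n be).
Proof.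
case: n => [|[|[|n]]] //=; [exact: initial_below | exact: initial_upto].
Qed.

Definition pick (Q : cond -> Prop) : cond :=
  if pselect (ex Q) is left h then sval (cid h) else p1.

Lemma pickP (Q : cond -> Prop) : ex Q -> Q (pick Q).
Proof. by rewrite /pick; case: pselect => // h _; case: cid. Qed.

Definition enum p : nat -> K := sval (cid (wf_count (wfcP p))).

Lemma enumP p be : sup p be -> exists n, enum p n = be.
Proof. by rewrite /enum; case: cid => en H; apply: H. Qed.

Record obj := Obj { oc : cond; ok : K; od : cond -> Prop; orl : rel }.
Definition goodo (u : obj) := goodD (od u) /\ goodR (orl u).

Lemma goodT : goodD (fun=> True).
Proof. by split=> // r; exists r. Qed.

Definition obj0 := Obj p1 al (fun=> True) (Drel (fun=> True)).
Definition objc p := Obj p al (fun=> True) (Drel (fun=> True)).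
Definition objk be := Obj p1 be (fun=> True) (Drel (fun=> True)).
Definition objd D := Obj p1 al D (Drel (fun=> True)).
Definition objr R := Obj p1 al (fun=> True) R.

Definition opcode (tag n : nat) (a : seq nat) : nat :=
  pickle ((tag, (n, a)) : (nat * (nat * seq nat))%type).
Definition decode_op (i : nat) : nat * (nat * seq nat) := odflt (0, (0, [::])) (unpickle i).

Lemma opcodeK tag n a : decode_op (opcode tag n a) = (tag, (n, a)).
Proof. by rewrite /decode_op /opcode pickleK. Qed.

Definition skolem0 (i : nat) (l : seq obj) : obj :=
  let: (tag, (n, a)) := decode_op i in
  let c j := oc (nth obj0 l j) in let k j := ok (nth obj0 l j) in
  let d j := od (nth obj0 l j) in let r j := orl (nth obj0 l j) in
  match tag with
  | 0 => objc (crestr (c 0) (at1 (k 1) a))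
  | 1 => objc (pick (fun p' => [/\ le p' (c 0), d 1 p' & leJ (cut n (k 2)) (c 3) p']))
  | 2 => objc (pick (fun p' => [/\ le p' (c 0), r 1 p' a & leJ (cut n (k 2)) (c 3) p']))
  | 3 => objc (pick (fun p' => le p' (c 0) /\ d 1 p'))
  | 4 => objk (enum (c 0) n)
  | 5 => objd (uD n)
  | 6 => objd (refineD (c 0) (d 1) (cut n (k 2)))
  | 7 => objd (fun q => sup q (k 0))
  | 8 => objd (fun q => passes (c 0) (k 1) n q [::])
  | 9 => objd (hits a (r 0))
  | 10 => objr (uR n)
  | 11 => objr (refine (c 0) (r 1) (cut n (k 2)))
  | 12 => objr (Drel (d 0))
  | _ => obj0
  end.

(** Replacing bad outputs by a default keeps every enumerated dense set and relation good;
    operations applied to enumerated objects are then shown to have good outputs. *)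
Definition skolem i l := if pselect (goodo (skolem0 i l)) then skolem0 i l else obj0.
Definition names := closure skolem.
Definition enN n := oc (names n).
Definition enK n := ok (names n).
Definition enD n := od (names n).
Definition enR n := orl (names n).

Lemma names_good n : goodo (names n).
Proof.
apply: (closure_ind (Q := goodo)) => i l; rewrite /skolem; case: pselect => //= _.
by split; [exact: goodT | exact/good_Drel/goodT].
Qed.

Lemma names_closed tag n a l : inrange skolem l ->
  goodo (skolem0 (opcode tag n a) l) ->
  exists k, names k = skolem0 (opcode tag n a) l.
Proof.
move=> H g; have [k E] := closureP (opcode tag n a) H.
by exists k; rewrite /names E /skolem; case: pselect.
Qed.

Lemma goodo_c p : goodo (objc p).
Proof. by split; [exact: goodT | exact/good_Drel/goodT]. Qed.
Lemma goodo_k be : goodo (objk be).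
Proof. by split; [exact: goodT | exact/good_Drel/goodT]. Qed.
Lemma goodo_d D : goodD D -> goodo (objd D).
Proof. by split=> //; exact/good_Drel/goodT. Qed.
Lemma goodo_r R : goodR R -> goodo (objr R).
Proof. by split=> //; exact: goodT. Qed.

Local Notation N := (N enN).
Local Notation NK := (NK enK).
Local Notation ND D := (exists n, enD n = D).
Local Notation NR R := (exists n, enR n = R).

Lemma N_base : N p1.
Proof.
have [|k E] := @names_closed 13 0 [::] [::] I; last by exists k; rewrite /enN E /skolem0 opcodeK.
by rewrite /skolem0 opcodeK /=; apply: (goodo_c p1).
Qed.

Lemma NK_base : NK al.
Proof.
have [|k E] := @names_closed 13 0 [::] [::] I; last by exists k; rewrite /enK E /skolem0 opcodeK.
by rewrite /skolem0 opcodeK /=; apply: (goodo_c p1).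
Qed.

Lemma N_crestr p be a : N p -> NK be -> N (crestr p (at1 be a)).
Proof.
move=> [i <-] [j <-]; have [||k E] := @names_closed 0 0 a [:: names i; names j].
- by split; [exists i | split; [exists j|]].
- by rewrite /skolem0 opcodeK; apply: goodo_c.
- by exists k; rewrite /enN E /skolem0 opcodeK.
Qed.

Lemma N_refineD p D J r n be : J = cut n be -> N p -> ND D -> NK be -> N r ->
  (exists p', [/\ le p' p, D p' & leJ J r p']) ->
  exists p', N p' /\ [/\ le p' p, D p' & leJ J r p'].
Proof.
move=> -> [i <-] [j <-] [k <-] [l <-] H.
have [||m E] := @names_closed 1 n [::] [:: names i; names j; names k; names l].
- by do !split; eexists.
- by rewrite /skolem0 opcodeK; apply: goodo_c.
- exists (oc (names m)); split; first by exists m.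
  by rewrite E /skolem0 opcodeK /=; exact: (pickP H).
Qed.

Lemma N_refineR p R J r s n be : J = cut n be -> N p -> NR R -> NK be -> N r ->
  (exists p', [/\ le p' p, R p' s & leJ J r p']) ->
  exists p', N p' /\ [/\ le p' p, R p' s & leJ J r p'].
Proof.
move=> -> [i <-] [j <-] [k <-] [l <-] H.
have [||m E] := @names_closed 2 n s [:: names i; names j; names k; names l].
- by do !split; eexists.
- by rewrite /skolem0 opcodeK; apply: goodo_c.
- exists (oc (names m)); split; first by exists m.
  by rewrite E /skolem0 opcodeK /=; exact: (pickP H).
Qed.

Lemma N_ext p D : N p -> ND D -> exists p', [/\ N p', le p' p & D p'].
Proof.
move=> [i <-] [j <-]; have [||m E] := @names_closed 3 0 [::] [:: names i; names j].
- by do !split; eexists.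
- by rewrite /skolem0 opcodeK; apply: goodo_c.
- have [[_ dD] _] := names_good j.
  have := pickP (dD (enN i)); rewrite /enD => -[l d].
  by exists (oc (names m)); split; first (by exists m); rewrite E /skolem0 opcodeK.
Qed.

Lemma N_sup p be : N p -> sup p be -> NK be.
Proof.
move=> [i <-] /enumP [n <-]; have [||m E] := @names_closed 4 n [::] [:: names i].
- by do !split; eexists.
- by rewrite /skolem0 opcodeK; apply: goodo_k.
- by exists m; rewrite /enK E /skolem0 opcodeK.
Qed.

Lemma ND_user n : ND (uD n).
Proof.
have [||m E] := @names_closed 5 n [::] [::] => //.
- by rewrite /skolem0 opcodeK; apply: goodo_d.
- by exists m; rewrite /enD E /skolem0 opcodeK.
Qed.

Lemma ND_refine p D n be : N p -> ND D -> NK be -> ND (refineD p D (cut n be)).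
Proof.
move=> [i <-] [j <-] [k <-].
have [||m E] := @names_closed 6 n [::] [:: names i; names j; names k].
- by do !split; eexists.
- rewrite /skolem0 opcodeK; apply: goodo_d; apply: good_refineD; first exact: initial_cut.
  by case: (names_good j).
- by exists m; rewrite /enD E /skolem0 opcodeK.
Qed.

Lemma ND_sup be : NK be -> ND (fun q => sup q be).
Proof.
move=> [i <-]; have [||m E] := @names_closed 7 0 [::] [:: names i].
- by do !split; eexists.
- by rewrite /skolem0 opcodeK; apply: goodo_d; apply: good_sup.
- by exists m; rewrite /enD E /skolem0 opcodeK.
Qed.

Lemma ND_passes u be n : N u -> NK be -> ND (fun q => passes u be n q [::]).
Proof.
move=> [i <-] [j <-]; have [||m E] := @names_closed 8 n [::] [:: names i; names j].
- by do !split; eexists.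
- by rewrite /skolem0 opcodeK; apply: goodo_d; apply: good_passes.
- by exists m; rewrite /enD E /skolem0 opcodeK.
Qed.

Lemma ND_hits s R : NR R -> ND (hits s R).
Proof.
move=> [i <-]; have [||m E] := @names_closed 9 0 s [:: names i].
- by do !split; eexists.
- by rewrite /skolem0 opcodeK; apply: goodo_d; apply: good_hits; case: (names_good i).
- by exists m; rewrite /enD E /skolem0 opcodeK.
Qed.

Lemma NR_user n : NR (uR n).
Proof.
have [||m E] := @names_closed 10 n [::] [::] => //.
- by rewrite /skolem0 opcodeK; apply: goodo_r.
- by exists m; rewrite /enR E /skolem0 opcodeK.
Qed.

Lemma NR_refine p R n be : cut n be al -> N p -> NR R -> NK be -> NR (refine p R (cut n be)).
Proof.
move=> Jal [i <-] [j <-] [k E0]; subst be.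
have [||m E] := @names_closed 11 n [::] [:: names i; names j; names k].
- by do !split; eexists.
- rewrite /skolem0 opcodeK; apply: goodo_r; apply: good_refine => //; first exact: initial_cut.
  by case: (names_good j).
- by exists m; rewrite /enR E /skolem0 opcodeK.
Qed.

Lemma NR_Drel D : ND D -> NR (Drel D).
Proof.
move=> [i <-]; have [||m E] := @names_closed 12 0 [::] [:: names i].
- by do !split; eexists.
- by rewrite /skolem0 opcodeK; apply: goodo_r; apply: good_Drel; case: (names_good i).
- by exists m; rewrite /enR E /skolem0 opcodeK.
Qed.

Definition okJ1 J := exists n be, NK be /\ J = cut n be.
(** The density of a relation refers to the generic real at [al], so refinements stay dense only on
    segments that contain [al]. *)
Definition okJ2 J := okJ1 J /\ J al.
Definition enR1 n := Drel (enD n).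

Lemma okJ1_init J : okJ1 J -> initial J.
Proof. by move=> [n [be [_ ->]]]; apply: initial_cut. Qed.

Lemma okJ1_cut be : NK be -> okJ1 (below be) /\ okJ1 (upto be).
Proof. by move=> kb; split; [exists 0, be | exists 1, be]. Qed.

Lemma okJ1_all : okJ1 allK.
Proof. by exists 2, al; split=> //; apply: NK_base. Qed.

Lemma closed1 : closed enN enK enR1 okJ1.
Proof.
split.
- exact: N_sup.
- exact: N_crestr.
- move=> p R J [n [be [kb ->]]] Np [i <-].
  have [m E] := ND_refine n Np (ex_intro _ i erefl) kb.
  by exists m; rewrite /enR1 E.
- move=> p R J r s [n [be [kb E]]] Np [i <-] Nr H.
  exact: (N_refineD (D := enD i) E Np (ex_intro _ i erefl) kb Nr H).
- by move=> R r r' s [i <-]; have [[oD _] _] := names_good i; apply: oD.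
- by move=> be /ND_sup [m E]; exists m; rewrite /enR1 E.
- by move=> u be m Nu kb; have [i E] := ND_passes m Nu kb; exists i; rewrite /enR1 E.
- exact: okJ1_init.
- by move=> J be _ kb _; apply: okJ1_cut kb.
- exact: okJ1_all.
Qed.

Lemma closed2 : closed enN enK enR okJ2.
Proof.
split.
- exact: N_sup.
- exact: N_crestr.
- move=> p R J [[n [be [kb ->]]] Jal] Np RR; exact: NR_refine.
- move=> p R J r s [[n [be [kb E]]] _] Np RR Nr H.
  exact: (N_refineR E Np RR kb Nr H).
- by move=> R r r' s [i <-]; have [_ [oR _]] := names_good i; apply: oR.
- by move=> be /ND_sup /NR_Drel.
- by move=> u be m Nu kb; apply: (NR_Drel (ND_passes m Nu kb)).
- by move=> J [/okJ1_init].
- move=> J be [oJ Jal] kb nJ; have [o1 o2] := okJ1_cut kb.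
  have lb : lt al be.
    have [//|[E|ba]] := lt_total al be; first by rewrite -E in nJ.
    by case: nJ; apply: (okJ1_init oJ) Jal.
  by split; split=> //; left.
- by split=> //; apply: okJ1_all.
Qed.

Definition fh0 : pt -> nat -> nat := fun _ _ => 0.

Lemma wfc_empty : wfc (Pre (fun=> False) (fun _ _ _ => [::])).
Proof. by split=> //; exists (fun=> al). Qed.

Lemma gen_empty : gen enN enK enR1 okJ1 fh0 (fun=> False) (Cond wfc_empty).
Proof.
split=> //=.
- by split=> // n x _; apply: near_all.
- by exists 3, al; split=> //; apply: NK_base.
- move=> x _ _ [n <-]; have [p' [Np' _ Dp']] := N_ext N_base (ex_intro _ n erefl : ND (enD n)).
  exists p'; split; last by exists 0.
  by split=> //; apply: near_all => x' _ be _ [].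
Qed.

Lemma generic1 J : J = below al \/ J = allK -> exists q,
  gen enN enK enR1 okJ1 fh0 J q /\ forall x, on q J x -> G enN q J x p1.
Proof.
move=> EJ; have nm : named enN (fun=> False) (Cond wfc_empty) (fun=> p1).
  split=> x _; first exact: near_all.
  by split; [exact: N_base | apply: near_all => x' _ be _ []].
have ge : GE enN enK enR1 okJ1 fh0 J.
  case: EJ => ->; last exact: (extend_all (fh := fh0) closed1).
  exact: (extend_below (fh := fh0) closed1 NK_base (proj1 (okJ1_cut NK_base))).
have [q [g _ H]] := ge (fun=> False) _ _ (fun _ => False_ind _) gen_empty nm.
by exists q.
Qed.

End Names.

(** * Fusion for countably many dense sets *)

Section Fusion.

Context {K : Type} {lt : K -> K -> Prop} {W : WO lt}.
Local Notation cond := (@cond K lt).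
Implicit Types (p q r : cond).

(** A condition generic for the given dense sets, together with [p1], has a member of each set in
    its filter at every branch; near the branch a restriction is below that member. *)
Lemma fusion (al : K) p1 (D : nat -> cond -> Prop) :
  (forall n r r', le r' r -> D n r -> D n r') ->
  (forall n r, le r p1 -> exists r', le r' r /\ D n r') ->
  exists q, le q p1 /\ forall x n, on q allK x ->
    exists h, near q allK x (on (crestr q h) allK) /\ D n (crestr q h).
Proof.
(* [D n] is dense only below [p1]; [D' n] is dense everywhere and implies [D n] below [p1]. *)
move=> oD dD; pose D' n r := forall s, le s r -> le s p1 -> D n s.
have good n : goodD (D' n).
  split=> [r r' r'r H s sr'|r]; first by apply: H; apply: (le_trans _ r'r).
  have [[s [sr sp]]|H] := lem (exists s, le s r /\ le s p1); last first.
    by exists r; split; [apply: le_refl | move=> s sr sp; case: H; exists s].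
  have [r' [r's Dr']] := dD n s sp; exists r'; split; first exact: le_trans r's sr.
  by move=> t tr' _; apply: oD tr' Dr'.
pose uR (n : nat) := Drel (fun _ : cond => True).
have [q [g G1]] := generic1 (al := al) p1 D' uR (or_intror erefl).
have supq p : N (enN al p1 D' uR) p -> forall be, sup p be -> sup q be.
  by move=> Np be pb; apply: (gen_sup g) => //; apply: (cl_N_sup (closed1 al p1 D' uR) Np).
have qp1 : le q p1.
  split=> [be pb _|x ox]; last exact: (G_on (G1 x ox)).
  by have [x ox] := on_inh q; have [Np _] := G1 x ox; apply: (supq _ Np).
exists q; split=> // x n ox.
have [m E] := ND_user al p1 uR good n.
have [p [Gp [j Dp]]] := gen_meet g ox (ex_intro _ m erefl).
rewrite /enR1 E /Drel in Dp; have [Np np] := Gp.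
have [h [oh lp]] := near_le (@initial_all _ lt) (fun be pb _ => supq _ Np be pb) ox np.
exists h; split=> //; apply: Dp => //.
exact: le_trans (crestr_le _ _) qp1.
Qed.

End Fusion.

(** * A well-order closed under small operations *)

Section Reflecting.

Variable X : Type.

(* [S] is closed under countable sequences; the order constructed below plays
   the role of the cardinal successor of [S]. *)
Inductive S := Lf of option X & nat | Nd of (nat -> S).

Theorem reflecting : exists (K : Type) (lt : K -> K -> Prop), [/\ WO lt, inhabited K,
  forall c : nat -> K, exists b, forall n, lt (c n) b \/ c n = b &
  forall (g : (nat -> K) -> X -> K) (k0 : K), exists al, lt k0 al /\
    forall e x, (forall n, lt (e n) al) -> lt (g e x) al].
Proof.
have [ltT [wfT trT totT]] := well_order_exists (S -> Prop).
(* As in Hartogs' construction, [K] consists of the points of a well-order of [S -> Prop] whose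
   predecessors can be indexed by [S]. *)
pose small b := exists h : S -> S -> Prop, forall c, ltT c b -> exists s, h s = c.
pose K := {b | small b}.
pose lt (a b : K) := ltT (sval a) (sval b).
have tot (a b : K) : lt a b \/ a = b \/ lt b a.
  have [|[|]] := totT (sval a) (sval b); [by left | | by right; right].
  case: a b => [a sa] [b sb] /= E; subst b; right; left; congr exist.
  exact: Prop_irrelevance.
have wo : WO lt.
  split=> [|a b c|//]; last exact: trT.
  suff H t : forall b : K, sval b = t -> Acc lt b by move=> b; apply: H erefl.
  elim: t / (wfT t) => t _ IH b E; constructor => c l.
  by apply: (IH (sval c)) => //; rewrite -E.
have cover (b : K) : exists e : S -> K, forall c, lt c b \/ c = b -> exists s, e s = c.
  have [h H] := svalP b.
  exists (fun s => if s is Nd f then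
    if pselect (small (h (f 0))) is left w then exist _ (h (f 0)) w else b else b).
  move=> c [l|->]; last by exists (Lf None 0).
  have [s E] := H _ l; exists (Nd (fun=> s)) => /=.
  case: pselect => [w|]; last by move=> nw; case: nw; rewrite E; apply: (svalP c).
  case: c l E w => c sc /= l E w; subst c; congr exist; exact: Prop_irrelevance.
(* Were [K] an image of [S], induction would make every point small, so that [K] would be all of
   [S -> Prop], against Cantor's diagonal argument. *)
have noK (e : S -> K) : exists b, forall s, e s <> b.
  apply: contrapT => n; have sur b : exists s, e s = b.
    by apply: contrapT => n'; apply: n; exists b => s E; apply: n'; exists s.
  have all b : small b.
    elim: b / (wfT b) => b _ IH; exists (fun s => sval (e s)) => c l.
    by have [s E] := sur (exist _ c (IH c l)); exists s; rewrite E.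
  have [s E] := sur (exist _ (fun s => ~ sval (e s) s) (all _)).
  have : sval (e s) s <-> ~ sval (e s) s by rewrite {1}E.
  by case=> a b; have ns : ~ sval (e s) s; [move=> t; exact: (a t t) | exact: (ns (b ns))].
have [ecov ecovP] := choice cover.
have [b0 sb0] : exists b, small b.
  apply: contrapT => n; suff F : forall b : S -> Prop, False by exact: (F (fun=> True)).
  move=> b.
  elim: b / (wfT b) => b _ IH; apply: n; exists b, (fun=> b) => c l.
  by case: (IH c l).
exists K, lt; split=> //.
- exact: (inhabits (exist _ b0 sb0)).
(* Without a bound, [K] would be the union of countably many segments indexed by [S], and a node of
   [S] encodes both a number and an element of [S]. *)
- move=> c; apply: contrapT => nb.
  have [b H] := noK (fun s => if s is Nd f then
    if f 0 is Lf _ n then ecov (c n) (f 1) else c 0 else c 0).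
  apply: nb; exists b => n; have [l|[E|l]] := tot (c n) b; [by left | by right |].
  have [s E] := ecovP (c n) b (or_introl l).
  by case: (H (Nd (fun k => if k is 0 then Lf None n else s))).
(* The range of [ev] is closed under [g] applied to sequences of its members and contains every
   point up to such a value. Hence the least point outside the range exceeds all values of [g] at
   sequences below it. *)
- move=> g k0; pose ev := fix ev (s : S) : K :=
    if s is Nd f then
      ecov (if f 0 is Lf (Some x) _ then g (fun n => ev (f n.+2)) x else k0) (f 1)
    else k0.
  have [al [H least]] : exists al, (forall s, ev s <> al) /\
      forall b, lt b al -> exists s, ev s = b.
    have [b Hb] := noK ev; apply: contrapT => n.
    suff F c : exists s, ev s = c by have [s E] := F b; apply: Hb E.
    have [wf _ _] := wo; elim: c / (wf c) => c _ IH; apply: contrapT => nc.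
    by apply: n; exists c; split=> // s E; apply: nc; exists s.
  exists al; split.
    have [//|C] := tot k0 al.
    have [|s E] := ecovP k0 al; first by case: C => [->|]; [right | left].
    by case: (H (Nd (fun k => if k is 0 then Lf None 0 else s))).
  move=> e x el.
  have /choice [f fP] : forall n, exists s, ev s = e n.
    by move=> n; apply: least.
  have [//|C] := tot (g e x) al.
  have [|s E] := ecovP (g e x) al; first by case: C => [->|]; [right | left].
  case: (H (Nd (fun k => if k is k'.+1 then if k' is n.+1 then f n else s else Lf (Some x) 0))).
  by rewrite /= -E; congr (ecov (g _ _) _); apply: funext => n; apply: fP.
Qed.

End Reflecting.

(** * Reading a real continuously from the conditions *)

Section Reading.

Context {K : Type} {lt : K -> K -> Prop} {W : WO lt}.
Local Notation cond := (@cond K lt).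
Local Notation pt := (@pt K).
Local Hint Extern 0 (le _ _) => exact: le_refl : core.
Implicit Types (p q r C : cond) (x y : pt) (be ga : K) (s : seq nat).
Implicit Types (f : @rname cond) (fh : pt -> nat -> nat) (A : nat -> pt -> seq nat -> Prop).

(** At each coordinate the two nodes lie on the branch [x], hence are comparable, and the longer one
    is kept. *)
Lemma crestr_join C h h' x : on (crestr C h) allK x -> on (crestr C h') allK x ->
  exists h2, [/\ on (crestr C h2) allK x, le (crestr C h2) (crestr C h) &
    le (crestr C h2) (crestr C h')].
Proof.
have iA := @initial_all K lt.
move=> /(on_crestr _ _ _ iA) [ox hx] /(on_crestr _ _ _ iA) [_ hx'].
pose h2 be := if size (h be) <= size (h' be) then h' be else h be.
have E L a b z : OK L -> pref (L a) z -> pref (L b) z -> size a <= size b -> a = take (size a) b.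
  move=> okL az bz ab; apply: (node_unique okL az); last by rewrite size_takel.
  by apply: pref_spref bz; rewrite -{2}(cat_take_drop (size a) b); apply: OK_cat.
have le2 g : (forall be, sup C be -> exists n, g be = take n (h2 be)) ->
    le (crestr C h2) (crestr C g).
  move=> G; split=> // y /(on_crestr _ _ _ iA) [oy hy]; apply/on_crestr => //.
  split=> // be Cb _; have [n ->] := G be Cb; apply: pref_spref (hy be Cb I).
  by rewrite -{2}(cat_take_drop n (h2 be)); apply/OK_cat/(OK_on iA Cb I oy).
exists h2; split.
- apply/on_crestr => //; split=> // be Cb _; rewrite /h2; case: leqP => _.
    exact: hx'.
  exact: hx.
- apply: le2 => be Cb; rewrite /h2; case: leqP => l.
    exists (size (h be)); exact: (E _ _ _ _ (OK_on iA Cb I ox) (hx be Cb I) (hx' be Cb I)).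
  by exists (size (h be)); rewrite take_size.
- apply: le2 => be Cb; rewrite /h2; case: leqP => l.
    by exists (size (h' be)); rewrite take_size.
  exists (size (h' be)); exact: (E _ _ _ _ (OK_on iA Cb I ox) (hx' be Cb I) (hx be Cb I) (ltnW l)).
Qed.

Variable inX : cond -> @rname cond -> Prop.

Record reads C f fh s1 A : Prop := {
  reads_real : isreal (le := @le K lt) C f;
  reads_inX : inX C f;
  reads_dec : forall x n, on C allK x -> exists h, near C allK x (on (crestr C h) allK) /\
    forall m, m < n -> dec (le := @le K lt) f (crestr C h) m (fh x m);
  reads_pref : forall x, on C allK x -> pref s1 (fh x);
  reads_open : forall x i, on C allK x -> exists n, A i x (mkseq (fh x) n) }.

Variables (p0 : cond) (s0 : seq nat).
Hypothesis everywhere : forall q1 s1 U, le q1 p0 -> stem s1 -> spref s0 s1 ->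
  opens (le := @le K lt) U -> dense_past (le := @le K lt) U q1 s1 ->
  exists q' f, [/\ le q' q1, isreal (le := @le K lt) q' f, inX q' f,
    decs (le := @le K lt) f q' s1 & enters (le := @le K lt) U q' f].
Hypothesis inX_mono : forall q q' f, le q' q -> inX q f -> inX q' f.
Hypothesis inhK : inhabited K.

Definition forces_dense q s1 A := forall i r s, le r q -> stem s -> spref s1 s ->
  exists r' s', [/\ le r' r, spref s s', stem s' & forall x, on r' allK x -> A i x s'].

(** Non-meagreness provides a real entering all the open sets. Fusion with the dense sets that
    decide its first [n] values and its entry into the [n]-th open set makes both readable near
    every branch. *)
Lemma reading q s1 A : le q p0 -> stem s1 -> spref s0 s1 -> forces_dense q s1 A ->
  exists C f fh, le C q /\ reads C f fh s1 A.
Proof.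
move=> qp ss1 s01 dA; pose U i r s := le r q /\ forall x, on r allK x -> A i x s.
have oU : opens (le := @le K lt) U.
  move=> i r r' s r'r [rq H]; split; first exact: le_trans r'r rq.
  by move=> x /(proj2 r'r) /H.
have dU : dense_past (le := @le K lt) U q s1.
  move=> i r s rq ss s1s; have [r' [s' [r'r a b c]]] := dA i r s rq ss s1s.
  by exists r', s'; split=> //; split=> //; apply: le_trans r'r rq.
have [q' [f [q'q rf Xf d1 ef]]] := everywhere qp ss1 s01 oU dU.
pose D n (r : cond) := (exists s, size s = n /\ decs (le := @le K lt) f r s) /\
  exists s, decs (le := @le K lt) f r s /\ U n r s.
have [al] := inhK.
have [|n r rq'|C [Cq' H]] := fusion al (p1 := q') (D := D).
- move=> n r r' r'r [[s [sn ds]] [s' [ds' Us']]]; split; first by exists s; split=> //; apply: decs_mono r'r ds.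
  by exists s'; split; [apply: decs_mono r'r ds' | apply: oU r'r Us'].
- have [r1 [r1r [s [sn _ ds]]]] := decide_upto n rf rq'.
  have [r2 [r2r1 [s' [ds' Us']]]] := ef n r1 (le_trans r1r rq').
  exists r2; split; first exact: le_trans r2r1 r1r.
  by split; [exists s; split=> //; apply: decs_mono r2r1 ds | exists s'].
have uniq x h h' m v w : on C allK x -> near C allK x (on (crestr C h) allK) ->
    near C allK x (on (crestr C h') allK) -> dec (le := @le K lt) f (crestr C h) m v ->
    dec (le := @le K lt) f (crestr C h') m w -> v = w.
  move=> ox /(near_self ox) oh /(near_self ox) oh' dv dw.
  have [h2 [_ l l']] := crestr_join oh oh'.
  apply: (proj2 rf (crestr C h2) m); last exact: dec_mono l' dw.
    exact: le_trans (crestr_le _ _) Cq'.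
  exact: dec_mono l dv.
have /choice [fh fhP] : forall c : pt * nat, exists v, on C allK c.1 ->
    exists h, near C allK c.1 (on (crestr C h) allK) /\ dec (le := @le K lt) f (crestr C h) c.2 v.
  move=> [x m] /=; have [ox|nx] := lem (on C allK x); last by exists 0.
  have [h [nh [[s [sm ds]] _]]] := H x m.+1 ox.
  by exists (nth 0 s m) => _; exists h; split=> //; apply: ds; rewrite sm.
have fhE x h s m : on C allK x -> near C allK x (on (crestr C h) allK) ->
    decs (le := @le K lt) f (crestr C h) s -> m < size s -> nth 0 s m = fh (x, m).
  move=> ox nh ds ms; have [h' [nh' d']] := fhP (x, m) ox.
  exact: uniq ox nh nh' (ds m ms) d'.
exists C, f, (fun x m => fh (x, m)); split; first exact: le_trans Cq' q'q.
split.
- exact: isreal_mono Cq' rf.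
- exact: inX_mono Cq' Xf.
- move=> x n ox; have [h [nh [[s [sn ds]] _]]] := H x n ox.
  by exists h; split=> // m mn; rewrite -(fhE x h s m) ?sn //; apply: ds; rewrite sn.
- move=> x ox m ms; have [h [nh _]] := H x 0 ox; apply: (fhE x h) => //.
  by apply: decs_mono d1; apply: le_trans (crestr_le _ _) Cq'.
- move=> x i ox; have [h [nh [_ [s [ds [_ As]]]]]] := H x i ox.
  exists (size s); suff -> : mkseq (fun m => fh (x, m)) (size s) = s.
    by apply: As; apply: near_self nh.
  apply: (@eq_from_nth _ 0); rewrite size_mkseq // => m ms.
  by rewrite nth_mkseq // (fhE x h s m).
Qed.

Hypothesis bounded : forall c : nat -> K, exists b, forall n, lt (c n) b \/ c n = b.

(** A condition, the open sets and the stem, with coordinates replaced by positions in a sequence.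
    The type does not mention [K], so [K] can be built afterwards with closure under operations that
    take codes as arguments. *)
Definition code := ((nat -> Prop) * (nat -> (nat -> nat -> nat) -> seq nat -> seq nat) *
  (nat -> (nat -> nat -> nat) -> seq nat -> Prop) * seq nat)%type.

Hypothesis closed_ord : forall (g : (nat -> K) -> code -> K) (k0 : K), exists al, lt k0 al /\
  forall e c, (forall n, lt (e n) al) -> lt (g e c) al.

Definition depends q A := forall i x x' s,
  (forall be, sup q be -> x be = x' be) -> A i x s -> A i x' s.

Record coded (e : nat -> K) (c : code) q A : Prop := {
  coded_sup : forall be, sup q be <-> exists n, c.1.1.1 n /\ e n = be;
  coded_lab : forall n x, c.1.1.1 n -> lab q (e n) x = c.1.1.2 n (fun k => x (e k));
  coded_open : forall i x s, A i x s <-> c.1.2 i (fun k => x (e k)) s }.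

Lemma sup_bounded q : exists b, forall be, sup q be -> lt be b \/ be = b.
Proof.
have [en H] := wf_count (wfcP q); have [b bP] := bounded en.
by exists b => be /H [n <-].
Qed.

(** [g] bounds the support of some reading for the data coded by a sequence of coordinates and a
    code, and [al] is closed under [g]. Data living below [al] therefore have a reading below [al]:
    a condition with the same code over the same coordinates has the same branches. *)
Lemma reflection : exists al, (forall be, sup p0 be -> lt be al) /\
  forall q s1 A, le q p0 -> (forall be, sup q be -> lt be al) -> depends q A ->
  stem s1 -> spref s0 s1 -> forces_dense q s1 A ->
  exists C f fh, [/\ le C q, forall be, sup C be -> lt be al & reads C f fh s1 A].
Proof.
pose Q e c b := exists q A C f fh, [/\ coded e c q A, le C q, reads C f fh c.2 A &
  forall be, sup C be -> lt be b \/ be = b].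
have /choice [g gP] : forall t : (nat -> K) * code, exists b, forall b', Q t.1 t.2 b' -> Q t.1 t.2 b.
  move=> t; have [[b Qb]|n] := lem (exists b, Q t.1 t.2 b); first by exists b.
  by have [k] := inhK; exists k => b Qb; case: n; exists b.
have [k0 k0P] := sup_bounded p0.
have [al [k0al alP]] := closed_ord (fun e c => g (e, c)) k0.
have lt_al b be : lt b al -> lt be b \/ be = b -> lt be al.
  by move=> bal [l|->] //; apply: lt_trans l bal.
exists al; split=> [be /k0P|q s1 A qp qal dep ss1 s01 dA]; first exact: lt_al.
have [en enP] := wf_count (wfcP q).
(* Numbers that do not name a supported coordinate are sent to [k0], which lies below [al], so that
   the whole sequence stays below [al]. *)
pose e n := if pselect (sup q (en n)) then en n else k0.
have eal n : lt (e n) al by rewrite /e; case: pselect => //= t; apply: qal.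
have /choice [ix ixP] : forall be, exists n, sup q be -> sup q (en n) /\ e n = be.
  move=> be; have [qb|nq] := lem (sup q be); last by exists 0.
  by have [n E] := enP be qb; exists n => _; rewrite /e E; case: pselect.
pose c : code := (fun n => sup q (en n), fun n z => lab q (e n) (fun be => z (ix be)),
  fun i z s => A i (fun be => z (ix be)) s, s1).
have cq : coded e c q A.
  split=> /=.
  - move=> be; split=> [qb|[n [sn <-]]]; first by exists (ix be); apply: ixP.
    by rewrite /e; case: pselect.
  - move=> n x sn; apply: (wf_dep (wfcP q)) => ga _ qg.
    by have [_ ->] := ixP ga qg.
  - move=> i x s; split; apply: dep => be qb; by have [_ ->] := ixP be qb.
have [C [f [fh [Cq rd]]]] := reading qp ss1 s01 dA.
have [b bP] := sup_bounded C.
have : Q e c (g (e, c)) by apply: (gP (e, c) b); exists q, A, C, f, fh.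
move=> [q' [A' [C' [f' [fh' [cq' C'q' rd' b']]]]]].
have sE be : sup q' be <-> sup q be by rewrite (coded_sup cq') (coded_sup cq).
have lE be x : sup q be -> lab q' be x = lab q be x.
  by move=> /(coded_sup cq) [n [un <-]]; rewrite (coded_lab cq') // (coded_lab cq).
exists C', f', fh'; split.
- split=> [be /sE qb _|x /(proj2 C'q') ox be qb _]; first exact: (proj1 C'q').
  by rewrite -lE //; apply: ox => //; apply/sE.
- by move=> be /b'; apply: lt_al; apply: alP.
- case: rd' => a1 a2 a3 a4 a5; split=> // x i ox.
  by have [n H] := a5 x i ox; exists n; apply/(coded_open cq)/(coded_open cq').
Qed.

End Reading.

(** * The contradiction at the reflecting coordinate *)

Lemma avo_sym s t i j : avo s (nth 0 t) i j -> avo t (nth 0 s) i j.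
Proof. by move=> H m ij; rewrite addnC; apply: H. Qed.

(** At most one value is forbidden at each new place, so 0 or 1 is always possible. *)
Lemma avoid_extend s t n : stem s -> size s <= n -> avo s (nth 0 t) 0 (size s) ->
  exists s', [/\ spref s s', stem s', size s' = n & avo s' (nth 0 t) 0 n].
Proof.
move=> ss sn av.
pose v m := if m < size s then nth 0 s m else if nth 0 t m == m.+2 then 1 else 0.
exists (mkseq v n); split.
- by split=> [|m ms]; rewrite ?size_mkseq // nth_mkseq ?(leq_trans ms) // /v ms.
- move=> m; rewrite size_mkseq => mn; rewrite nth_mkseq // /v.
  by case: ifP => [/ss //|_]; case: ifP.
- by rewrite size_mkseq.
- move=> m /andP [_ mn]; rewrite nth_mkseq // /v; case: ifP => [ms|_]; first exact: av.
  case: eqP => [->|ne]; last by rewrite add0n.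
  by move=> /eqP; rewrite -[X in _ == X]add0n eqn_add2r.
Qed.

Lemma pad s n : stem s -> exists s', [/\ spref s s', stem s' & n <= size s'].
Proof.
move=> ss; exists (s ++ nseq n 0); split; first exact: spref_cat.
  move=> m; rewrite size_cat size_nseq nth_cat => mn; case: ifP => [/ss //|_].
  by rewrite nth_nseq; case: ifP.
by rewrite size_cat size_nseq leq_addl.
Qed.

Section Final.

Context {K : Type} {lt : K -> K -> Prop} {W : WO lt}.
Local Notation cond := (@cond K lt).
Local Notation pt := (@pt K).
Local Notation below := (@below K lt).
Local Notation initial := (@initial K lt).
Local Hint Extern 0 (le _ _) => exact: le_refl : core.
Local Notation dec := (@dec cond (@le K lt)).
Local Notation isreal := (@isreal cond (@le K lt)).
Local Notation avoids := (@avoids cond (@le K lt)).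
Implicit Types (p q r C : cond) (x y : pt) (be ga : K) (s : seq nat).
Implicit Types (f : @rname cond) (A : nat -> pt -> seq nat -> Prop).

Variable al : K.
Local Notation J := (below al).
Let iJ : initial J := @initial_below K lt W al.
Let iA : initial allK := @initial_all K lt.

Definition genreal : @rname cond := fun m v r => sup r al /\ forall x, on r allK x -> x al m = v.

Lemma dec_genreal r m v : dec genreal r m v <-> genreal m v r.
Proof.
split=> [[r' [rr' [s H]]]|H]; last by exists r.
by split=> [|x /(proj2 rr') /H //]; apply: (proj1 rr').
Qed.

Lemma genreal_real p : isreal p genreal.
Proof.
split=> [m q qp|r m v w _ /dec_genreal [_ H] /dec_genreal [_ H']]; last first.
  by have [x ox] := on_inh r; rewrite -(H x ox) -(H' x ox).
have [q' [s [q'q q'al ms H]]] := decide q al m.+1; exists q'; split=> //.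
have [x ox] := on_inh q'; exists (x al m); split.
  by apply: Br_stem (OK_on iA q'al I ox) _; apply: ox.
apply/dec_genreal; split=> // y oy.
by rewrite -(H x ox) // -(H y oy).
Qed.

Lemma keeps_avoids r s : keeps_off al r s -> avoids r genreal s.
Proof.
move=> [ral H] r' m v r'r ms /dec_genreal [_ H'].
by have [x ox] := on_inh r'; rewrite -(H' x ox); apply: H => //; apply: (proj2 r'r).
Qed.

Lemma avoids_keeps r s : sup r al -> avoids r genreal s -> keeps_off al r s.
Proof.
move=> ral H; split=> // x ox m ms; have [c cH] := ox al ral I.
have n1 := near_node ral I (cH m.+1).
have n3 : near r allK x (fun x' => lab r al x' (mkseq c m.+1) = lab r al x (mkseq c m.+1)).
  by apply: lc_lab => //; apply: near_all.
have [h [nh hH _]] := near_restr iA ox (near_and n1 n3).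
have sm : m < size (lab r al x (mkseq c m.+1)).
  by have := OK_size (mkseq c m.+1) (OK_on iA ral I ox); rewrite size_mkseq.
apply: (H (crestr r h)) => //; first exact: crestr_le.
apply/dec_genreal; split=> // y /hH [oy [py E]]; rewrite E in py.
by rewrite -py // -(cH m.+1).
Qed.

Variables (enN : nat -> cond) (enK : nat -> K) (enR : nat -> @rel K lt).
Variables (okJ : (K -> Prop) -> Prop).
Hypothesis cl : closed enN enK enR okJ.

Lemma near_le_on q C J' x Q : initial J' -> leJ J' C q -> on C J' x ->
  near q J' x Q -> near C J' x Q.
Proof. by move=> iJ' Cq ox; apply: near_leJ => //; apply: wfcP. Qed.

Lemma G_leJ_on q C J' x p : initial J' -> leJ J' C q -> on C J' x ->
  G enN q J' x p -> G enN C J' x p.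
Proof. by move=> iJ' Cq ox [Np n]; split=> //; apply: near_le_on n. Qed.

Lemma gen_leJ fh q C J' : gen enN enK enR okJ fh J' q -> leJ J' C q ->
  (forall be, sup C be -> J' be) -> gen enN enK enR okJ fh J' C.
Proof.
move=> g Cq sC; have iJ' := cl_okJ_init cl (gen_ok g); split.
- split=> //.
  + by move=> be kb Jb; apply: (proj1 Cq) => //; apply: (gen_sup g).
  + by move=> n x ox; apply: (near_le_on iJ' Cq ox); apply: (gen_fh g); apply: (proj2 Cq).
- exact: gen_ok g.
- move=> x R ox RRR; have [p [Gp mp]] := gen_meet g (proj2 Cq x ox) RRR.
  by exists p; split=> //; apply: G_leJ_on Gp.
Qed.

(* By genericity a stronger condition adds no names to the filter. *)
Lemma G_back fh q C J' x p : gen enN enK enR okJ fh J' q -> leJ J' C q -> on C J' x ->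
  G enN C J' x p -> G enN q J' x p.
Proof.
move=> g Cq ox [Np np]; have oJ := gen_ok g; have iJ' := cl_okJ_init cl oJ.
have oq := proj2 Cq x ox.
have [r [Gr [j [[p' [p'p _ rp']]|H]]]] := gen_meet g oq (cl_RR_refine cl oJ Np (ex_intro _ 0 erefl)).
  have l : leJ J' r p by apply: (leJ_trans rp' (le_leJ iJ' p'p)).
  by apply: (G_leJ Gr).
case: H; have nr := near_le_on iJ' Cq ox (proj2 Gr).
have [h [_ hH _]] := near_restr iJ' ox (near_and np nr).
have sub u : N enN u -> (forall y, on (crestr C h) J' y -> on u J' y) -> leJ J' (crestr C h) u.
  move=> Nu H; split=> // be ub Jb; apply: (proj1 Cq) => //.
  by apply: (gen_sup g) => //; apply: (cl_N_sup cl Nu).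
have hp : leJ J' (crestr C h) p by apply: sub => // y /hH [_ []].
have hr : leJ J' (crestr C h) r by apply: sub => [|y /hH [_ []] //]; case: Gr.
exists (cmix iJ' hr); split; first exact: cmix_le.
exact: leJ_trans (cmix_leJ _ _) hp.
Qed.

End Final.

(** * The open sets that the real must enter, expressed below al *)

Section Tasks.

Context {K : Type} {lt : K -> K -> Prop} {W : WO lt}.
Local Notation cond := (@cond K lt).
Local Notation pt := (@pt K).
Local Notation below := (@below K lt).
Local Notation initial := (@initial K lt).
Local Hint Extern 0 (le _ _) => exact: le_refl : core.
Implicit Types (p q r C : cond) (x y : pt) (be ga : K) (s : seq nat).

Variable al : K.
Local Notation J := (below al).
Local Notation rl p x := (lab p al x [::]).
Local Notation ch p x i := (lab p al x [:: i]).
Let iJ : initial J := @initial_below K lt W al.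
Let iA : initial allK := @initial_all K lt.
Variables (p1 : cond) (uD : nat -> cond -> Prop) (uR : nat -> @rel K lt).
Local Notation eN := (@enN K lt W al p1 uD uR).
Local Notation eK := (@enK K lt W al p1 uD uR).
Local Notation eR := (@enR K lt W al p1 uD uR).
Local Notation eR1 := (@enR1 K lt W al p1 uD uR).
Local Notation ok1 := (@okJ1 K lt W al p1 uD uR).
Let cl1 := closed1 al p1 uD uR.

Variables (q0 : cond) (fh : pt -> nat -> nat).
Hypothesis g0 : gen eN eK eR1 ok1 fh J q0.

Local Notation G q x p := (G eN q J x p).

Definition dcode i : nat * nat * seq (seq nat) * nat * nat :=
  odflt (0, 0, [::], 0, 0) (unpickle i).

Definition task_done x s p d (F : seq (seq nat)) n R c p' :=
  [/\ [/\ G q0 x p', le p' (crestr p (at1 al [:: c])), n <= size (ch p x c),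
      forall g, g \in F -> avo (ch p x c) (nth 0 g) (size (rl p x)) n &
      size (ch p x c) <= size (rl p' x)],
    size (rl p' x) <= size s, avo (rl p' x) (nth 0 s) 0 (size (rl p' x)),
    roomy al d.+3 p' & exists j, j <= size s /\ R p' (take j s)].

(* All reals extending [s] keep away from some extension of [p] that is suitable as
   the next node of the tree at [al]. *)
Definition task i x s :=
  let: (k, d, F, n, m) := dcode i in let p := eN k in
  G q0 x p -> sup p al -> roomy al d.+2 p -> size F <= d.+1 ->
  size (rl p x) <= size s /\ (avo (rl p x) (nth 0 s) 0 (size (rl p x)) ->
    exists c p', task_done x s p d F n (eR m) c p').

Lemma lab_agree p x x' : N eN p -> (forall be, sup q0 be -> x be = x' be) ->
  lab p al x = lab p al x'.
Proof.
move=> Np E; apply: (wf_dep (wfcP p)) => ga gal pg; apply: E.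
by apply: (gen_sup g0) => //; apply: (cl_N_sup cl1 Np).
Qed.

Lemma G_agree p x x' : (forall be, sup q0 be -> x be = x' be) -> G q0 x p -> G q0 x' p.
Proof.
move=> E [Np [e [we ne H]]]; split=> //; exists e; split=> //.
by apply: (nb_agree (J := J) iJ we _ ne) => be qb _; apply: E.
Qed.

Lemma task_depends : depends q0 task.
Proof.
move=> i x x' s E; rewrite /task; case: (dcode i) => [[[[k d] F] n] m] H Gp pal rp sF.
have E' be : sup q0 be -> x' be = x be by move=> /E.
have Np : N eN (eN k) by exists k.
have [a b] := H (G_agree E' Gp) pal rp sF; rewrite -(lab_agree Np E); split=> // av.
have [c [p' [[G' h1 h2 h3 h4] h5 h6 h7 h8]]] := b av.
have Np' : N eN p' by case: G'.
exists c, p'; split; rewrite -?(lab_agree Np' E) //.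
by split; rewrite -?(lab_agree Np E) -?(lab_agree Np' E) //; apply: G_agree G'.
Qed.

Lemma lab_nearq q x p a : pregen eK fh J q -> on q J x -> G q x p -> sup p al ->
  near q J x (fun x' => lab p al x' a = lab p al x a).
Proof. by move=> g ox Gp pal; apply: (lab_near cl1 a iJ g ox Gp pal (fun _ => id)). Qed.

Lemma eR_open m r r' s : le r' r -> eR m r s -> eR m r' s.
Proof. by have [_ [o _]] := names_good al p1 uD uR m; apply: o. Qed.

Lemma branch_at p x : on p J x -> exists y, on p allK y /\ lab p al y = lab p al x /\
  forall p' : cond, lab p' al y = lab p' al x.
Proof.
move=> ox; have [y [oy E]] := on_extend iJ ox.
have L (u : cond) : lab u al y = lab u al x by apply: (wf_dep (wfcP u)) => ga gal _; apply: E.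
by exists y.
Qed.

Lemma rl_branch p y : sup p al -> on p allK y -> pref (rl p y) (y al).
Proof. by move=> pal oy; have [c /(_ 0)] := oy al pal I. Qed.

(** The finite sequence and the condition at [al] are extended in turn, each avoiding the other: a
    child avoiding the sequence, a longer sequence avoiding the child, an extension of both into the
    relation, a deep node for room, and a last extension of the sequence along its label. *)
Lemma task_dense s1 : forces_dense q0 s1 task.
Proof.
move=> i r s rq ss _; rewrite /task; case: (dcode i) => [[[[k d] F] n] m].
set p := eN k; have Np : N eN p by exists k.
have nal : ~ J al := @lt_irr K lt W al.
have kal : NK eK al := NK_base al p1 uD uR.
have [[x [ox Gp pal rp sF]]|no] := lem (exists x, [/\ on r allK x, G q0 x p, sup p al,
    roomy al d.+2 p & size F <= d.+1]); last first.
  by exists r, s; split=> // x ox Gp pal rp sF; case: no; exists x.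
have oq : on q0 J x by apply: (on_sub (J' := allK)) (proj2 rq x ox).
have op := G_on Gp oq.
have shrink Q : near q0 J x Q -> exists r', le r' r /\ forall y, on r' allK y -> Q y.
  move=> nQ; have nr : near r allK x Q.
    by apply: (near_leJ (wfcP q0) (wfcP r) iA rq ox (near_sub _ nQ)).
  have [h [_ H _]] := near_restr iA ox nr; exists (crestr r h); split; first exact: crestr_le.
  by move=> y /H [].
have nl := lab_nearq [::] g0 oq Gp pal.
have [s2 [ss2 st2 sz2]] := pad (size (rl p x)) ss.
have [av|nav] := lem (avo (rl p x) (nth 0 s2) 0 (size (rl p x))); last first.
  have [r' [r'r H]] := shrink _ nl; exists r', s2; split=> // y /H E _ _ _ _.
  by rewrite E; split=> // /nav.
(* Room for [d.+2] functions covers the at most [d.+1] members of [F] and the sequence [s2]. *)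
have [|c [nc avc]] := rp x op (s2 :: F) (maxn n (size s2)); first by rewrite /= ltnS.
set v := ch p x c in nc avc; have [n_v s2_v] : n <= size v /\ size s2 <= size v.
  by move: nc; rewrite geq_max => /andP.
have lv : spref (rl p x) v by apply: (OK_pref (wf_OK (wfcP p) pal op) [::]).
have av2 : avo s2 (nth 0 v) 0 (size s2).
  apply: avo_sym => a /andP [_ a2]; have [a1|a1] := ltnP a (size (rl p x)).
    by rewrite -(proj2 lv) //; apply: av.
  by apply: (avc s2); [rewrite inE eqxx | rewrite a1 /= (leq_trans a2) // leq_maxr].
have [s3 [s23 st3 sz3 av3]] := avoid_extend st2 s2_v av2.
have Gv := G_restr cl1 [:: c] (gen_ok g0) Gp kal nal.
(* Genericity below [al] concerns conditions only, so the relation is met through [hits s3]. Its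
   collision alternative fails, because the label [v] already determines the real at [al] as far as
   [s3] reaches. *)
have [mh Emh] := ND_hits (al := al) (p1 := p1) (uD := uD) (uR := uR) s3 (ex_intro _ m erefl).
have [p3 [p3v G3 [jh hit3]]] := gen_ext cl1 g0 oq Gv (ex_intro _ mh erefl).
rewrite /enR1 Emh /Drel in hit3; have [sg [sz sgH alt]] := hit3 st3.
have o3 := G_on G3 oq; have p3al : sup p3 al by apply: (proj1 p3v).
have sv a : a < size v -> nth 0 sg a = nth 0 v a.
  move=> a_v; have [y [oy [_ Ly]]] := branch_at o3.
  have := rl_branch (p := crestr p (at1 al [:: c])) pal (proj2 p3v y oy).
  rewrite lab_restr Ly -/v => H; rewrite H // (sgH y oy) //.
  by apply: leq_trans sz; rewrite sz3.
case: alt => [na|[s4 [s34 st4 sz4 av4 R4]]].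
  by case: na => a /andP [_ a3]; rewrite sz3 in a3; rewrite sv //; apply: av3.
(* Level [l] restores room for [d.+3] functions and makes the new root label extend the child label
   [v] and the decided part [sg]. *)
pose l := maxn d.+2 (maxn (size v) (size sg)).
have G' := G_restr cl1 (nseq l 0) (gen_ok g0) G3 kal nal; 
move: G'; set p' := crestr p3 (at1 al (nseq l 0)) => G'.
have o' := G_on G' oq.
have p'al : sup p' al by [].
set mu := rl p' x.
have lmu : l <= size mu.
  by have := OK_size (nseq l 0) (wf_OK (wfcP p3) p3al o3); rewrite size_nseq /mu lab_restr.
have [d_mu [v_mu sg_mu]] : d.+2 <= size mu /\ size v <= size mu /\ size sg <= size mu.
  by move: lmu; rewrite !geq_max => /andP [-> /andP [-> ->]].
have sgmu : spref sg mu.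
  have [y [oy [_ Ly]]] := branch_at o'.
  apply: (pref_le (z := y al)) => //.
    by apply: sgH; apply: (proj2 (crestr_le p3 _)) oy.
  by have := rl_branch p'al oy; rewrite Ly.
have av4' : avo s4 (nth 0 mu) 0 (size s4).
  move=> a a4; have a5 : a < size sg by apply: leq_trans sz4; case/andP: a4.
  by rewrite -(proj2 sgmu) //; apply: av4.
have [s5 [s45 st5 sz5 av5]] := avoid_extend st4 (leq_trans sz4 sg_mu) av4'.
have n1 := lab_nearq [:: c] g0 oq Gp pal.
have n2 := lab_nearq [::] g0 oq G' p'al.
have [r' [r'r H]] := shrink _ (near_and nl (near_and n1 (near_and n2 (G_near G')))).
have s25 : spref s2 s5 by apply: spref_trans s23 (spref_trans s34 s45).
exists r', s5; split=> //; first exact: spref_trans ss2 s25.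
move=> y /H [El [Ec [Em Gy]]] _ _ _ _; rewrite El; split.
  by apply: leq_trans sz2 _; case: s25.
move=> _; exists c, p'; split; rewrite ?Ec ?Em -/mu ?sz5 //.
- split=> //; rewrite ?Ec ?El ?Em //.
  + by apply: le_trans (crestr_le _ _) p3v.
  + move=> g gF a /andP [a1 a2]; apply: (avc g); first by rewrite inE gF orbT.
    by rewrite a1 (leq_trans a2) // leq_maxl.
- exact: avo_sym av5.
- move=> y' oy' F' n' sF'; apply: (roomy_restr (k := l) p3al oy').
  by apply: leq_trans sF' _; rewrite ltnS leq_maxl.
- exists (size s4); split; first by rewrite -sz5; case: s45.
  have -> : take (size s4) s5 = s4.
    apply: (@eq_from_nth _ 0); rewrite size_takel ?(proj1 s45) // => a a4.
    by rewrite nth_take // (proj2 s45).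
  by apply: eR_open R4; apply: crestr_le.
Qed.

End Tasks.

(** * A translate whose trace escapes the nowhere dense sets *)

Section Contradiction.

Context {K : Type} {lt : K -> K -> Prop} {W : WO lt}.
Local Notation cond := (@cond K lt).
Local Notation pt := (@pt K).
Local Notation below := (@below K lt).
Local Notation upto := (@upto K lt).
Local Notation initial := (@initial K lt).
Local Hint Extern 0 (le _ _) => exact: le_refl : core.
Local Notation dec := (@dec cond (@le K lt)).
Local Notation isreal := (@isreal cond (@le K lt)).
Local Notation avoids := (@avoids cond (@le K lt)).
Local Notation enters := (@enters cond (@le K lt)).
Local Notation opens := (@opens cond (@le K lt)).
Implicit Types (p q r C : cond) (x y : pt) (be ga : K) (s : seq nat).
Implicit Types (f : @rname cond) (A : nat -> pt -> seq nat -> Prop).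

Variables (al : K) (inX : cond -> @rname cond -> Prop) (p0 : cond) (s0 : seq nat).
Local Notation J := (below al).
Local Notation rl p x := (lab p al x [::]).
Let iJ : initial J := @initial_below K lt W al.
Let iA : initial allK := @initial_all K lt.
Hypothesis stem0 : stem s0.
Hypothesis inX_mono : forall q q' f, le q' q -> inX q f -> inX q' f.
Hypothesis p0_al : forall be, sup p0 be -> lt be al.
Hypothesis reflect : forall q s1 A, le q p0 -> (forall be, sup q be -> lt be al) ->
  depends q A -> stem s1 -> spref s0 s1 -> forces_dense q s1 A ->
  exists C f fh, [/\ le C q, forall be, sup C be -> lt be al & reads inX C f fh s1 A].
Hypothesis trace : meagre_trace_at (le := @le K lt) inX p0.

(** Coordinate [al] is new to [p0], so a fresh tree can be placed there and cut down to a child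
    whose label avoids [s0]. Translation by its generic real then leaves the reals extending [s0]
    off the excluded values on the length of [s0]. *)
Lemma start : exists p2 (Bad : nat -> cond -> seq nat -> Prop), [/\ le p2 p0, sup p2 al, opens Bad,
   forall x z, on p2 J x -> Br (lab p2 al x) z -> forall m, m < size s0 -> z m + nth 0 s0 m <> m.+2 &
   (forall k r s, le r p2 -> stem s -> avoids r (genreal al) s ->
     exists r' s', [/\ le r' r, spref s s', stem s', avoids r' (genreal al) s' & Bad k r' s']) /\
   ~ exists r f, [/\ le r p2, isreal r f, inX r f,
       forall r' m v w, le r' r -> dec f r' m v -> dec (genreal al) r' m w -> v + w <> m.+2 &
       enters Bad r f]].
Proof.
have [|i [ni av]] := @OK_avo _ OK_tree0 [::] [:: s0] (size s0); first by [].
have nal : ~ sup p0 al by move=> /p0_al; apply: lt_irr.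
pose pa : cond := Cond (wfc_addp nal); pose pb : cond := crestr (W := W) pa (at1 al [:: i]).
have pbp0 : le pb p0.
  by apply: (le_trans (crestr_le (W := W) pa (at1 al [:: i]))); apply: addp_le.
have [p2 [Bad [p2b oB M1 M2]]] := trace pbp0 (genreal_real al pb).
have pbal : sup pb al by right.
exists p2, Bad; split=> //; first exact: le_trans p2b pbp0.
  exact: (proj1 p2b).
move=> x z ox bz m ms; have := Br_le pbal p2b ox bz.
rewrite /= /shift_tree at1E; case: pselect => [a|//]; case=> c /(_ 0) H.
have mi : m < size (tree0 [:: i]) by apply: leq_trans ni.
rewrite -H //; apply: (av s0); first by rewrite inE.
by rewrite ms.
Qed.

Theorem contradiction : False.
Proof.
have [p2 [Bad [p2p0 p2al oB branch0 [M1 M2]]]] := start; apply: M2.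
(* A node of level 1 has room for two functions, as the invariant at depth 0 demands: one to be
   dodged by the pruned tree, and the real itself. *)
pose p1 : cond := crestr (W := W) p2 (at1 al (nseq 1 0)).
have p1p2 : le p1 p2 by apply: crestr_le.
have p1al : sup p1 al by [].
pose uD (n : nat) (r : cond) := True.
(* The sets [Bad] are dense only below [p2]; quantifying over extensions below [p2] gives relations
   dense below every condition. *)
pose uR k : @rel K lt := fun r s => forall v, le v r -> le v p2 -> Bad k v s.
have uRP k : goodR al (uR k).
  split=> [r r' s r'r H v vr'|r s ss ks]; first by apply: H; apply: le_trans vr' r'r.
  have [[v [vr vp]]|n] := lem (exists v, le v r /\ le v p2); last first.
    by exists r, s; split=> // v vr vp; case: n; exists v.
  have [r' [s' [r'v a b c d]]] := M1 k v s vp ss (keeps_avoids (keeps_off_le vr ks)).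
  exists r', s'; split=> //; first exact: le_trans r'v vr.
    by apply: avoids_keeps => //; apply: (proj1 (le_trans r'v vp)).
  by move=> u ur' _; apply: oB ur' d.
have cl1 : closed (@enN K lt W al p1 uD uR) (@enK K lt W al p1 uD uR) (@enR1 K lt W al p1 uD uR) (@okJ1 K lt W al p1 uD uR) := closed1 al p1 uD uR.
have cl2 : closed (@enN K lt W al p1 uD uR) (@enK K lt W al p1 uD uR) (@enR K lt W al p1 uD uR) (@okJ2 K lt W al p1 uD uR) := closed2 al p1 uD uR.
have Np1 : N (@enN K lt W al p1 uD uR) p1 := N_base al p1 uD uR.
have kal : NK (@enK K lt W al p1 uD uR) al := NK_base al p1 uD uR.
have nal : ~ J al := @lt_irr K lt W al.
have [qa [ga G1]] := generic1 p1 uD uR (or_introl erefl : J = J \/ J = allK).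
have [x0 oxa] := on_inh qa.
have ox0 : on qa J x0 by apply: (on_sub (J' := allK)) oxa.
set la := rl p1 x0.
(* The root label of [p1] at [al] is made independent of the branch, since a single stem [s1] has to
   avoid it. *)
have [h [nh hH _]] := near_restr iJ ox0 (lab_nearq (W := W) [::] ga ox0 (G1 x0 ox0) p1al).
set q0 : cond := crestr qa h.
have sub0 be : sup q0 be -> J be by apply: (gen_sub ga).
have q0a : leJ J q0 qa by apply: le_leJ => //; apply: crestr_le.
have g0 : gen (@enN K lt W al p1 uD uR) (@enK K lt W al p1 uD uR) (@enR1 K lt W al p1 uD uR) (@okJ1 K lt W al p1 uD uR) fh0 J q0 by apply: (gen_leJ cl1 ga q0a sub0).
have Gp1 x : on q0 J x -> G (@enN K lt W al p1 uD uR) q0 J x p1.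
  by move=> ox; apply: (G_leJ_on iJ q0a ox); apply: G1; apply: (proj2 q0a).
have rla x : on q0 J x -> rl p1 x = la by move=> /hH [].
have q0p0 : le q0 p0.
  split=> [be pb _|x ox].
    apply: (gen_sup g0); last exact: p0_al.
    by apply: (cl_N_sup cl1 Np1); apply: (proj1 p2p0).
  have ox' : on q0 J x by apply: (on_sub (J' := allK)) ox.
  have := proj2 (le_leJ iJ (le_trans p1p2 p2p0)) x (G_on (Gp1 x ox') ox').
  by move=> H be pb _; apply: H => //; apply: p0_al.
have ox0' : on q0 J x0 by apply: near_self nh.
have la0 m : m < size la -> m < size s0 -> nth 0 s0 m + nth 0 la m <> m.+2.
  move=> ma m0; have o1 := G_on (Gp1 x0 ox0') ox0'.
  have bz := lbranch_Br (wf_OK (wfcP p1) p1al o1).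
  have bz2 : Br (lab p2 al x0) (lbranch (lab p1 al x0)) by apply: (Br_le p2al p1p2 o1 bz).
  rewrite addnC.
  have [c /(_ 0) H] := bz; rewrite (H m) //; apply: (branch0 x0 _ _ bz2 m m0).
  exact: (proj2 (le_leJ iJ p1p2)) o1.
(* With at least the length of [la], this stem forces every real extending it to satisfy the
   invariant at the root. *)
have [s1 [ss1 s01 sz1 av1]] : exists s1, [/\ stem s1, spref s0 s1, size la <= size s1 &
    avo la (nth 0 s1) 0 (size la)].
  have [l|l] := leqP (size s0) (size la).
    have [|s1 [a b c d]] := @avoid_extend s0 la _ stem0 l.
      by move=> m /andP [_ ms]; apply: la0 => //; apply: leq_trans l.
    by exists s1; split=> //; [rewrite c | apply: avo_sym].
  exists s0; split=> //; first exact: ltnW.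
  by apply: avo_sym => m /andP [_ ms]; apply: la0 => //; apply: ltn_trans l.
(* The real [f] does all tasks and is read below [al], so the tree at [al] may still be pruned
   according to it. *)
have [C [f [fh [Cq0 Cal rd]]]] := reflect q0p0 sub0 (task_depends g0) ss1 s01
  (task_dense (s1 := s1) g0).
have CJ : leJ J C q0 by apply: le_leJ.
have onC x : on C J x -> on C allK x by move=> ox be Cb _; apply: ox => //; apply: Cal.
have fhlc n : lc C J (fun x => fh x n).
  move=> x ox; have [h' [nh' dh']] := reads_dec rd n.+1 (onC x ox).
  have {}nh' : near C J x (on (crestr C h') allK).
    have [e [we ne H]] := nh'; exists e; split=> //; last by move=> y /onC; apply: H.
    by elim: e we {ne H} => //= g e IH [Cg _ /IH we]; split=> //; apply: Cal.
  apply: near_imp nh' _ => y oy oy'.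
  have [h2 [nh2 dh2]] := reads_dec rd n.+1 (onC y oy).
  have [h3 [_ l1 l2]] := crestr_join oy' (near_self (onC y oy) nh2).
  apply: (proj2 (reads_real rd) (crestr C h3) n); first exact: crestr_le.
    by apply: dec_mono l2 _; apply: dh2.
  by apply: dec_mono l1 _; apply: dh'.
have pgC : pregen (@enK K lt W al p1 uD uR) fh J C.
  split=> //; move=> be kb Jb; apply: (proj1 CJ) => //; exact: (gen_sup g0).
have fhnear x n : on C J x -> near C J x (fun x' => forall i, i < n -> fh x' i = fh x i).
  by move=> ox; apply: near_forall => i _; apply: fhlc.
(* Besides room, the invariant keeps node labels off the real [fh x]; hence every branch of the
   fused tree avoids [fh x] at all places. *)
pose Inv (d : nat) x (p : cond) :=
  [/\ sup p al, roomy al d.+2 p & avo (rl p x) (fh x) 0 (size (rl p x))].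
have next d x p F n R : on C J x -> G (@enN K lt W al p1 uD uR) C J x p -> Inv d x p -> size F <= d.+1 ->
    RR (@enR K lt W al p1 uD uR) R -> exists i p', G (@enN K lt W al p1 uD uR) C J x p' /\
    near C J x (fun x' => trans fh al Inv d x' p F n R p' i).
  move=> ox Gp [pal rp av] sF [m <-]; have [[k ek] _] := Gp; subst p.
  have [l] := reads_open rd (pickle (k, d, F, n, m)) (onC x ox).
  rewrite /task /dcode pickleK /= size_mkseq => /(_ (G_back cl1 g0 CJ ox Gp) pal rp sF).
  move=> [sz H]; have [|c [p' [[G' h1 h2 h3 h4] h5 h6 h7 [j [jl Rj]]]]] := H.
    by move=> i /andP [_ il]; rewrite nth_mkseq ?(leq_trans il) //; apply: av.
  rewrite size_mkseq in h5 jl; have GC : G (@enN K lt W al p1 uD uR) C J x p' by apply: (G_leJ_on iJ CJ ox G').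
  have p'al : sup p' al by apply: (proj1 h1).
  have mt : meets fh x p' ((@enR K lt W al p1 uD uR) m).
    by exists j; move: Rj; rewrite (mkseq_prefix (fh x) jl) take_size_cat // size_mkseq.
  have n1 := lab_near (W := W) cl1 [:: c] iJ pgC ox Gp pal (fun _ => id).
  have n2 := lab_near (W := W) cl1 [::] iJ pgC ox Gp pal (fun _ => id).
  have n3 := lab_near (W := W) cl1 [::] iJ pgC ox GC p'al (fun _ => id).
  have n4 : near C J x (fun x' => meets fh x' p' (@enR K lt W al p1 uD uR m)).
    exact: (meets_near pgC ox mt).
  exists c, p'; split=> //.
  apply: (near_imp (near_and n1 (near_and n2 (near_and n3 (near_and (fhnear x l ox) n4))))) => x' _ [E1 [E2 [E3 [E4 mt']]]].
  split; rewrite ?E1 ?E2 ?E3 //; split=> //; split; rewrite ?E3 //.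
  move=> i /andP [_ il]; rewrite E4; last exact: leq_trans il h5.
  by have := h6 i il; rewrite nth_mkseq // (leq_trans il h5).
have g00 : good (@enN K lt W al p1 uD uR) al C Inv 0 (fun=> (p1, 0)).
  split=> //; first by move=> x _; apply: near_all.
  move=> x ox; have oq := proj2 CJ x ox; split; first exact: (G_leJ_on iJ CJ ox (Gp1 x oq)).
  split=> //; first exact: (roomy_restr (k := 1) p2al).
  change (avo (rl p1 x) (fh x) 0 (size (rl p1 x))); rewrite (rla x oq) => m /andP [_ ml].
  by rewrite -(reads_pref rd (onC x ox) (leq_trans ml sz1)); apply: av1.
have ok' : okJ2 al p1 uD uR (upto al) by split; [case: (okJ1_cut kal) | right].
have [q1 [g1 e1 Gq1 nodes]] := step cl2 kal pgC ok' (fun d x p (H : Inv d x p) =>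
  let: And3 s _ _ := H in s) next g00.
have nm : named (@enN K lt W al p1 uD uR) (upto al) q1 (fun=> p1) by split=> // x _; apply: near_all.
(* The sets [Bad] may refer to coordinates above [al]; genericity on all of [K], for relations that
   speak of [fh], makes [f] enter them. *)
have [q2 [g2 e2 G2]] := extend_all cl2 (fun _ _ => I) g1 nm.
have q2p1 : le q2 p1.
  split=> [be pb _|x ox]; last exact: (G_on (G2 x ox)).
  by apply: (gen_sup g2) => //; apply: (cl_N_sup cl2 Np1).
have on1 x : on q2 allK x -> on q1 (upto al) x by apply: (ext_on_sub e2).
have on2 x : on q2 allK x -> on C J x.
  by move=> /on1; apply: (ext_on_sub e1) => be; left.
have q2C : le q2 C.
  split=> [be Cb _|x /on2 /onC //]; have Jb := Cal be Cb.
  apply/(ext_sup e2); first by left.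
  exact/(ext_sup e1).
have lower r x Q : le r q2 -> on r allK x -> near q2 allK x Q -> near r allK x Q.
  by move=> rq ox; apply: near_leJ => //; apply: wfcP.
have read r x n : le r q2 -> on r allK x -> exists h', near r allK x (on (crestr r h') allK) /\
    forall m, m < n -> dec f (crestr r h') m (fh x m).
  move=> rq ox; have rC : le r C by apply: (le_trans rq q2C).
  have [h1 [nh1 dh1]] := reads_dec rd n (proj2 rC x ox).
  have nr : near r allK x (on (crestr C h1) allK).
    by apply: (near_leJ (wfcP C) (wfcP r) iA rC ox nh1).
  have [h2 [nh2 l2]] := near_le iA (proj1 rC : forall be, sup (crestr C h1) be -> _) ox nr.
  by exists h2; split=> // m mn; apply: (dec_mono (l2 : le (crestr r h2) (crestr C h1))); apply: dh1.
exists q2, f; split.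
- exact: le_trans q2p1 p1p2.
- exact: isreal_mono q2C (reads_real rd).
- exact: inX_mono q2C (reads_inX rd).
- move=> r m v w rq dv /dec_genreal [_ dw]; have [x ox] := on_inh r.
  have [h1 [_ d1]] := read r x m.+1 rq ox.
  have ox2 := proj2 rq x ox; rewrite -(dw x ox).
  have -> : v = fh x m.
    apply: (proj2 (reads_real rd) (crestr r h1) m); last exact: d1.
      exact: le_trans (crestr_le _ _) (le_trans rq q2C).
    exact: dec_mono (crestr_le _ _) dv.
  have [p [_ [_ _ av] sz px]] := nodes x m.+1 (on1 x ox2).
  by rewrite addnC -px //; apply: av.
- move=> k r rq; have [x ox] := on_inh r; have ox2 := proj2 rq x ox.
  have [n En] := NR_user p1 uD uRP k.
  have [p [Gp [j Rp]]] := gen_meet g2 ox2 (ex_intro _ n erefl); rewrite En in Rp.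
  have [h1 [nh1 d1]] := read r x j rq ox.
  have [Np np] := Gp.
  have sp be : sup p be -> allK be -> sup r be.
    by move=> pb _; apply: (proj1 rq) => //; apply: (gen_sup g2) => //; apply: (cl_N_sup cl2 Np).
  have [h2 [nh2 l2]] := near_le iA sp ox (lower r x _ rq ox np).
  have [h3 [_ l31 l32]] := crestr_join (near_self ox nh1) (near_self ox nh2).
  exists (crestr r h3); split; first exact: crestr_le.
  exists (mkseq (fh x) j); split.
    by move=> m; rewrite size_mkseq => mj; rewrite nth_mkseq //; apply: dec_mono l31 (d1 m mj).
  apply: Rp; first exact: le_trans l32 l2.
  exact: le_trans (crestr_le _ _) (le_trans rq (le_trans q2p1 p1p2)).
Qed.

End Contradiction.

Lemma failure_impossible K (lt : K -> K -> Prop) (W : WO lt) rho (p0 : cond lt) : inhabited K ->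
  (forall c : nat -> K, exists b, forall n, lt (c n) b \/ c n = b) ->
  (forall (g : (nat -> K) -> code -> K) (k0 : K), exists al, lt k0 al /\
    forall e c, (forall n, lt (e n) al) -> lt (g e c) al) ->
  ~ force (@le K lt) rho (fnot phi 0) p0.
Proof.
move=> inhK bounded closed nphi; have [q [inX [qp0 inX_mono nonmeagre trace]]] := failure nphi.
have [q1 [s0 [q1q ss0 everywhere]]] := nonmeagre_everywhere inX_mono nonmeagre.
have trace1 : meagre_trace_at (le := @le K lt) inX q1.
  by move=> q2 t q2q1; apply: trace; apply: le_trans q1q.
have [al [q1_al reflect]] := reflection everywhere inX_mono inhK bounded closed.
exact: (contradiction ss0 inX_mono q1_al reflect trace1).
Qed.

Theorem theorem1p17 : consistent ZFC -> consistent (extend ZFC (phi 0)).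
Proof.
move=> _ inc; have [K [lt [W inhK bounded closed]]] := reflecting code.
have [k] := inhK; pose p0 : cond lt := Cond (wfc_empty k).
pose rho (i : nat) : name (cond lt) := nempty.
apply: (soundness inc (le := @le K lt) (rho := rho) (p := p0)) => A [zA|->].
  exact: force_ZFC.
apply: snotnot => q _ nphi; exact: (failure_impossible W inhK bounded closed nphi).
Qed.
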